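(* Let $\nu$ be a Lévy measure on $\mathbb{R}$ absolutely continuous with respect to the Lebesgue measure, with density $f=\frac{d\nu}{dx}$. Let $\varepsilon\in(0,1]$, $\alpha\in(0,1)$, $M>0$ and $f\in\mathscr L_{M,\alpha}$. Then there exists a constant $\mathrm{C}_1>0$, depending only on $\alpha$, such that $$\mathbb{P}(|tb(\varepsilon)+M_t(\varepsilon)|\geq \varepsilon)\leq 2t^2 M^2\, \mathrm{C}_1\, \varepsilon^{-2\alpha},\qquad \forall\ 0<t\leq \frac{(1-\alpha)\varepsilon^{\alpha}}{M4^{1+\alpha}} .$$ If, in addition, $f$ is a symmetric function, then there exists a constant $\mathrm{C}_2>0$, depending only on $\alpha$, such that $$\mathbb{P}(|M_t(\varepsilon)|\geq \varepsilon)\leq 2t^2 M^2\, \mathrm{C}_2\, \varepsilon^{-2\alpha},\qquad \forall\ 0<t\leq \frac{\varepsilon^\alpha(2-\alpha)}{M2^{\alpha+1}} .$$ Explicitly, one may take $$\mathrm{C}_1=16+\frac{64}{\alpha^{2}}+\mathbf C_{1,\alpha}+\mathbf C_{2,\alpha},\qquad \mathbf C_{1,\alpha}=\frac{2^{1+4\alpha}}{\alpha(2-\alpha)},$$ $$\mathbf C_{2,\alpha}=\frac{2^{2+\alpha}}{1-\alpha}+\frac{2^{4\alpha+3}\big(2^{1-\alpha}\alpha(2-\alpha)+2+\alpha\big)}{\alpha(2-\alpha)(1-\alpha)3^{1+\alpha}}+\frac{28\times 4^{2\alpha}}{\alpha^2(2-\alpha)}+\frac{2^{1+4\alpha}}{\alpha(2-\alpha)},$$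 $$\mathrm{C}_2=\frac{3\times 2^{2\alpha-1}e^{2+1/e}}{(2-\alpha)^2}+\frac{4^{1+\alpha}}{\alpha(1-\alpha)(2-\alpha)}+\frac{4^\alpha}{\alpha^2}.$$
   Context: A Lévy measure is a Borel measure $\nu$ on $\mathbb{R}$ with $\nu(\{0\})=0$ and $\int_{\mathbb{R}}(y^2\wedge 1)\nu(dy)<\infty$. For $M>0$ and $\alpha\in(0,2)$, $\mathscr L_{M,\alpha}$ is the class of functions $f$ with $f(x)\leq M|x|^{-(1+\alpha)}$ for all $0<|x|\leq 2$. When $\int_{|x|\le 1}|x|\nu(dx)<\infty$ (which is automatic here since $\alpha<1$), $b(\varepsilon):=\int_{|x|\leq\varepsilon}x\,\nu(dx)$. For $\varepsilon\in(0,1]$, $M(\varepsilon)=(M_t(\varepsilon))_{t\ge0}$ is the Lévy process of the centered (compensated) jumps of size at most $\varepsilon$ of a Lévy process $X$ with Lévy measure $\nu$: $$M_t(\varepsilon)=\lim_{\eta\to0}\Big(\sum_{s\le t}\Delta X_s\mathbf 1_{\eta<|\Delta X_s|\le\varepsilon}-t\int_{\eta<|x|\le\varepsilon}x\,\nu(dx)\Big),\qquad \Delta X_s=X_s-\lim_{u\uparrow s}X_u;$$ equivalently $\mathbb{E}[e^{iuM_t(\varepsilon)}]=\exp\big(t\int_{|x|\le\varepsilon}(e^{iux}-1-iux)\nu(dx)\big)$. (The constant $M$ and the process $M_t(\varepsilon)$ are unrelated.) *)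

(* Defs.v *)
From HB Require Import structures.
From mathcomp Require Import all_boot all_order all_algebra.
From mathcomp Require Import all_classical all_reals all_analysis.

Set Implicit Arguments.
Unset Strict Implicit.
Unset Printing Implicit Defensive.

Import Order.TTheory GRing.Theory Num.Theory.
Import numFieldNormedType.Exports.

Local Open Scope classical_set_scope.
Local Open Scope ring_scope.

Section paths.
Context {R : realType}.
Implicit Type x : R -> R.

(* Time is [0, +oo[: the values of a path at negative times are irrelevant. *)
Definition cadlag x :=
  (forall t, 0 <= t -> x u @[u --> t^'+] --> x t) /\
  (forall t, 0 < t -> cvg (x u @[u --> t^'-])).

Definition jump x (s : R) : R := x s - lim (x u @[u --> s^'-]).

(* Time 0 is excluded: a path has no jump there. *)
Definition jump_times x (t : R) (A : set R) : set R :=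
  [set s | [/\ 0 < s, s <= t & A (jump x s)]].

End paths.

Section levy.
Context {R : realType}.
Implicit Types (nu : {measure set (measurableTypeR R) -> \bar R}) (f : R -> R).

Definition levy_measure nu :=
  nu [set 0] = 0%E /\ (\int[nu]_y (Num.min ((y : R) ^+ 2) 1)%R%:E < +oo)%E.

Definition has_density nu f :=
  [/\ measurable_fun setT f, (forall x, 0 <= f x) &
      forall A : set (measurableTypeR R), measurable A ->
        nu A = (\int[lebesgue_measure]_(x in A) (f x)%:E)%E].

Definition L_class (M alpha : R) f :=
  forall x, 0 < `|x| <= 2 -> f x <= M * `|x| `^ (- (1 + alpha)).

Definition symmetric_fun f := forall x, f (- x) = f x.

Definition small_jump_mean nu (eps : R) : R :=
  (\int[nu]_(x in [set x : measurableTypeR R | (`|x| <= eps)%R]) (x : R))%R.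

Context {d : measure_display} {T : measurableType d} (P : probability T R).

(* The product rule for subfamilies is the case where some B i are setT. *)
Definition mutually_independent (n : nat) (Y : 'I_n -> T -> R) :=
  forall B : 'I_n -> set (measurableTypeR R), (forall i, measurable (B i)) ->
    P [set w | forall i, B i (Y i w)] =
    (\prod_(i < n) P [set w | B i (Y i w)])%E.

Record levy_process (X : R -> {RV P >-> R}) : Prop := LevyProcess {
  levy_start : {ae P, forall w, X 0 w = 0} ;
  levy_independent : forall (n : nat) (t : nat -> R),
    0 <= t 0%N -> (forall i, t i <= t i.+1) ->
    @mutually_independent n (fun i w => X (t i.+1) w - X (t i) w) ;
  levy_stationary : forall s h (B : set (measurableTypeR R)),
    0 <= s -> 0 <= h -> measurable B ->
    P [set w | B (X (s + h) w - X s w)] = P [set w | B (X h w - X 0 w)] ;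
  levy_stochastic_continuity : forall t e, 0 <= t -> 0 < e ->
    P [set w | e <= `|X u w - X t w|]
      @[u --> within [set u | 0 <= u] (nbhs t)] --> 0%E ;
  levy_cadlag : {ae P, forall w, cadlag (X ^~ w)}
}.

(* nu is the intensity of the nonzero jumps of X per unit of time:
   nu A = E[#{s <= 1 : jump of X at s is nonzero and in A}].
   The integrand is a random variable on the almost sure event of cadlag
   paths only; its values elsewhere do not affect the integral. *)
Definition has_levy_measure (X : R -> {RV P >-> R}) nu :=
  forall A : set (measurableTypeR R), measurable A ->
    nu A = (\int[P]_w counting (jump_times (X ^~ w) 1%R (A `\ (0 : R)%R)))%E.

(* On a cadlag path and for 0 < eta the sum below has finitely many terms. *)
Definition compensated_jump_sum nu (x : R -> R) (eps eta t : R) : R :=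
  \sum_(s \in jump_times x t [set y | eta < `|y| <= eps]) jump x s
  - t * (\int[nu]_(x in [set x : measurableTypeR R | (eta < `|x| <= eps)%R])
           (x : R))%R.

(* Mt is the process of the compensated jumps of X of size at most eps, any
   version: the limit eta -> 0 is almost sure, for each t. *)
Definition compensated_small_jumps (X : R -> {RV P >-> R}) nu (eps : R)
    (Mt : R -> {RV P >-> R}) :=
  forall t, 0 <= t ->
    {ae P, forall w,
      compensated_jump_sum nu (X ^~ w) eps eta t @[eta --> 0^'+] --> Mt t w}.

End levy.

Section constants.
Context {R : realType}.
Implicit Type alpha : R.

Definition bold_C1 alpha : R :=
  2 `^ (1 + 4 * alpha) / (alpha * (2 - alpha)).

Definition bold_C2 alpha : R :=
  2 `^ (2 + alpha) / (1 - alpha)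
  + 2 `^ (4 * alpha + 3)
      * (2 `^ (1 - alpha) * alpha * (2 - alpha) + 2 + alpha)
      / (alpha * (2 - alpha) * (1 - alpha) * 3 `^ (1 + alpha))
  + 28 * 4 `^ (2 * alpha) / (alpha ^+ 2 * (2 - alpha))
  + 2 `^ (1 + 4 * alpha) / (alpha * (2 - alpha)).

Definition C1 alpha : R :=
  16 + 64 / alpha ^+ 2 + bold_C1 alpha + bold_C2 alpha.

Definition C2 alpha : R :=
  3 * 2 `^ (2 * alpha - 1) * expR (2 + (expR 1)^-1) / (2 - alpha) ^+ 2
  + 4 `^ (1 + alpha) / (alpha * (1 - alpha) * (2 - alpha))
  + 4 `^ alpha / alpha ^+ 2.

End constants.

(* Main.v *)
(* Since alpha < 1, the jumps of size at most eps are summable and t b(eps) + M_t(eps)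
   is their sum S, as is M_t(eps) when f is symmetric.  On a fine mesh of [0, t], the
   increments of X are i.i.d. and, once rounded to a grid away from 0, they recover the
   large jumps path by path; the probability that an increment falls in a cell of the
   grid is about (t / m) nu(cell).  For independent variables with these laws, |S| >= eps
   forces one of two events.  Either some value exceeds eps / 2 and the other ones add
   up to what is missing: its density is at most M (eps / 2)^(-(1 + alpha)), so this costs
   t M (eps / 2)^(-(1 + alpha)) times the mean of the sum of the sizes, of order
   t M eps^(1 - alpha).  Or all values are at most eps / 2 and, y_i being the centered ones,
   (sum y_i)^2 = sum y_i^2 + 2 e_2(y) is large.  As y_i^2 <= eps^2 / 4, this forces e_2(y)
   or e_2(y^2) to be large, and E e_2(y)^2 and E e_2(y^2) are both at most
   (sum E y_i^2)^2 / 2, of order t^2 M^2 eps^(4 - 2 alpha). *)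

Require Import Defs.
From HB Require Import structures.
From mathcomp Require Import all_boot all_order all_algebra.
From mathcomp Require Import finmap.
From mathcomp Require Import all_classical all_reals all_analysis.
From mathcomp Require Import measurable_realfun ring lra.

Set Implicit Arguments.
Unset Strict Implicit.
Unset Printing Implicit Defensive.

Import Order.TTheory GRing.Theory Num.Theory.
Import numFieldNormedType.Exports.

Local Open Scope classical_set_scope.
Local Open Scope ring_scope.

(** * The second elementary symmetric sum *)

Section second_symmetric.
Context {R : realFieldType}.
Implicit Type l : seq R.

(** Chebyshev's inequality for the sum itself only gives order t, since a single jump carries the
    variance. Each statistic used here involves two distinct increments, so that independence makes
    its mean a product and yields t^2. The measure [nu] is given only as the mean number of jumps
    before time 1, and independence only for increments: the law of a short increment has to be
    recovered from [nu]. Blocks of length t / n serve for this, because about n / t of them fit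
    before time 1, with the same law, and the number of those that contain a jump in a set compares
    with the number of jumps. Upper bounds on the cells control all sizes; lower bounds serve for
    symmetric f, where opposite cells must balance so that the mean of the small values nearly
    vanishes. The mesh, the grid and the inner cutoff [eta] go to their limits one after the other,
    in this order, through lower limits of events. Every passage consumes a strict inequality, which
    costs a slack [th] in the threshold and in [M]; it tends to 0 at the end. To leave room for it,
    the natural bounds 3/4, 1/4 and 1/4 on the centered sum, on the squares and on the mean are
    relaxed to 37/50, 13/50 and 51/200. *)

Fixpoint esym2 l : R := if l is x :: l' then x * (\sum_(y <- l') y) + esym2 l' else 0.

Lemma sqr_sum_esym2 l : (\sum_(x <- l) x) ^+ 2 = \sum_(x <- l) x ^+ 2 + 2 * esym2 l.
Proof.
elim: l => [|x l IH] /=; first by rewrite !big_nil; ring.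
rewrite !big_cons sqrrD IH; ring.
Qed.

Lemma esym2_ge0 l : (forall x, x \in l -> 0 <= x) -> 0 <= esym2 l.
Proof.
elim: l => [|x l IH] //= h.
have hl y : y \in l -> 0 <= y by move=> yl; apply: h; rewrite inE yl orbT.
apply: addr_ge0; last exact: IH.
apply: mulr_ge0; first by apply: h; exact: mem_head.
by rewrite big_seq; apply: sumr_ge0.
Qed.

(* A large sum forces one of the two elementary symmetric sums to be large, and
   both of these have a variance of the second order. *)
Lemma large_sum_esym2 (e : R) l : 0 < e ->
  (forall x, x \in l -> x ^+ 2 <= 13 / 50 * e ^+ 2) ->
  37 / 50 * e <= `|\sum_(x <- l) x| ->
  e ^+ 4 <= 100 * esym2 l ^+ 2 + 329 / 5 * esym2 [seq x ^+ 2 | x <- l].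
Proof.
move=> e0 hl hT; have := sqr_sum_esym2 l.
set T := \sum_(x <- l) x in hT *; set V := \sum_(x <- l) x ^+ 2; set Q := esym2 l => TVQ.
set U := esym2 _.
have U0 : 0 <= U by apply: esym2_ge0 => y /mapP[x _ ->]; apply: sqr_ge0.
have V0 : 0 <= V by apply: sumr_ge0 => x _; apply: sqr_ge0.
have VU : V ^+ 2 <= 13 / 50 * e ^+ 2 * V + 2 * U.
  have := sqr_sum_esym2 [seq x ^+ 2 | x <- l]; rewrite !big_map -/V -/U => ->.
  rewrite lerD2r /V mulr_sumr ![X in X <= _]big_seq ![X in _ <= X]big_seq.
  apply: ler_sum => x xl; rewrite [x ^+ 2 ^+ 2]expr2.
  by apply: ler_wpM2r; [exact: sqr_ge0 | exact: hl].
have T2 : (37 / 50 * e) ^+ 2 <= T ^+ 2.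
  by rewrite -[leRHS]real_normK ?num_real// ler_sqr// nnegrE//; lra.
have e2 : 0 < e ^+ 2 by rewrite exprn_gt0.
have e4 : e ^+ 4 = (e ^+ 2) ^+ 2 by rewrite -exprM.
have Q2 := sqr_ge0 Q.
rewrite e4; set E := e ^+ 2 in e2 VU T2 *.
have {}T2 : 1369 / 2500 * E <= V + 2 * Q by rewrite -TVQ; move: T2; rewrite exprMn -/E; lra.
(* If 2 Q >= E / 5, then 100 Q^2 >= E^2 already. Otherwise V is at least (1369/2500 - 1/5) E =
   (869/2500) E, and [VU] bounds V (V - 13/50 E) by 2 U, so that U is at least about E^2 / 65.7:
   hence 329/5. *)
have [hQ|hQ] := leP (1 / 5 * E) (2 * Q).
  have : (1 / 5 * E) ^+ 2 <= (2 * Q) ^+ 2 by rewrite ler_sqr// nnegrE; lra.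
  rewrite !exprMn; lra.
have hV : 869 / 2500 * E <= V by lra.
have : 0 <= (V - 869 / 2500 * E) * (V + (869 / 2500 - 13 / 50) * E).
  by apply: mulr_ge0; lra.
have -> : (V - 869 / 2500 * E) * (V + (869 / 2500 - 13 / 50) * E)
   = V ^+ 2 - 13 / 50 * E * V - (869 / 2500) * (869 / 2500 - 13 / 50) * E ^+ 2 by field.
have E2 := sqr_ge0 E; lra.
Qed.

End second_symmetric.

(** * Independent identically distributed variables on a finite set *)

Section product_law.
Context {R : realFieldType} {S I : finType} (p : S -> R).
Local Notation outcome := {ffun I -> S}.
Hypotheses (p_ge0 : forall a, 0 <= p a) (p_sum1 : \sum_a p a = 1).
Implicit Types (s : {ffun I -> S}) (F G : {ffun I -> S} -> R) (phi psi : S -> R) (i j : I)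
  (r : seq I).

Definition mean_law phi : R := \sum_a p a * phi a.

Definition mean_prod F : R := \sum_(s : {ffun I -> S}) (\prod_i p (s i)) * F s.

Local Notation E := mean_prod.
Local Notation Ep := mean_law.

Lemma prod_law_ge0 s : 0 <= \prod_i p (s i).
Proof. by apply: prodr_ge0. Qed.

Lemma mean_prodD F G : E (fun s : outcome => F s + G s) = E F + E G.
Proof. by rewrite -big_split; apply: eq_bigr => s _; rewrite mulrDr. Qed.

Lemma mean_prodZ c F : E (fun s : outcome => c * F s) = c * E F.
Proof. by rewrite mulr_sumr; apply: eq_bigr => s _; rewrite mulrCA. Qed.

Lemma mean_prod_sum (J : Type) (r : seq J) (P : pred J) (F : J -> {ffun I -> S} -> R) :
  E (fun s : outcome => \sum_(j <- r | P j) F j s) = \sum_(j <- r | P j) E (F j).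
Proof.
rewrite [RHS]exchange_big; apply: eq_bigr => s _.
by rewrite mulr_sumr.
Qed.

Lemma eq_mean_prod F G : F =1 G -> E F = E G.
Proof. by move=> FG; apply: eq_bigr => s _; rewrite FG. Qed.

Lemma le_mean_prod F G : (forall s, F s <= G s) -> E F <= E G.
Proof. by move=> FG; apply: ler_sum => s _; apply: ler_wpM2l => //; exact: prod_law_ge0. Qed.

Lemma mean_prod1 : E (fun=> 1) = 1.
Proof.
rewrite /mean_prod; under eq_bigr do rewrite mulr1.
by rewrite -(bigA_distr_bigA (fun _ => p)) big1.
Qed.

Definition ffupd s i a : {ffun I -> S} := [ffun j => if j == i then a else s j].

Definition indep_of i F := forall s a, F (ffupd s i a) = F s.

(** Resampling coordinate i is a bijection between the outcomes with value b at i and those with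
    value a. Neither F nor the weight of the other coordinates sees it, so the partial sum [C a]
    does not depend on a. *)
Lemma mean_prod_coord i phi F : indep_of i F ->
  E (fun s : outcome => phi (s i) * F s) = Ep phi * E F.
Proof.
move=> iF; pose W (s : outcome) := \prod_(j | j != i) p (s j).
pose C a := \sum_(s : outcome | s i == a) W s * F s.
have CC a b : C a = C b.
  rewrite /C (reindex_onto (fun s : outcome => ffupd s i a) (fun s : outcome => ffupd s i
    b)) /=; last first.
    by move=> s /eqP sa; apply/ffunP => j; rewrite !ffunE; case: eqP => // ->.
  apply: eq_big => [s|s _].
    rewrite ffunE eqxx eqxx /=; apply/eqP/eqP => [/ffunP/(_ i)|sb].
      by rewrite !ffunE eqxx.
    by apply/ffunP => j; rewrite !ffunE; case: eqP => // ->.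
  rewrite iF; congr (_ * _); apply: eq_bigr => j ji.
  by rewrite ffunE (negbTE ji).
have Esplit psi : E (fun s : outcome => psi (s i) * F s) = \sum_a p a * psi a * C a.
  rewrite /mean_prod (partition_big (fun s : outcome => s i) xpredT) //=.
  apply: eq_bigr => a _; rewrite /C mulr_sumr; apply: eq_bigr => s /eqP sa.
  rewrite (bigD1 i) //= -/(W s) sa; ring.
have -> : E F = \sum_b p b * C b.
  rewrite -[LHS](@eq_mean_prod (fun s : outcome => 1 * F s)); last by move=> s; rewrite mul1r.
  by rewrite (Esplit (fun=> 1)); apply: eq_bigr => a _; rewrite mulr1.
rewrite Esplit /mean_law mulr_suml; apply: eq_bigr => a _; congr (_ * _).
rewrite -[LHS]mul1r -p_sum1 mulr_suml; apply: eq_bigr => b _.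
by rewrite (CC a b).
Qed.

Lemma indep_of_map i r psi (H : seq R -> R) : i \notin r ->
  indep_of i (fun s : outcome => H [seq psi (s j) | j <- r]).
Proof.
move=> ir s a; congr H; apply/eq_in_map => j jr.
by rewrite ffunE; case: eqP => // ji; move: ir; rewrite -ji jr.
Qed.

Lemma mean_prod_coord1 i phi : E (fun s : outcome => phi (s i)) = Ep phi.
Proof.
have /= h := @mean_prod_coord i phi (fun=> 1) (fun s a => erefl).
rewrite mean_prod1 mulr1 in h; rewrite -h.
by apply: eq_mean_prod => s; rewrite mulr1.
Qed.

Lemma mean_prod_sum_coord r phi :
  E (fun s : outcome => \sum_(i <- r) phi (s i)) = (size r)%:R * Ep phi.
Proof.
rewrite mean_prod_sum (eq_bigr (fun=> Ep phi)); last by move=> i _; exact: mean_prod_coord1.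
by rewrite big_const_seq count_predT iter_addr_0 mulr_natl.
Qed.

(** The number of pairs, computed in R to avoid truncated subtraction. *)
Let triangle (k : nat) : R := k%:R * (k%:R - 1) / 2.

(** The two indices of a pair are distinct, hence independent, and each pair contributes a square:
    applied to squared values, this is where a second factor t comes from. *)
Lemma mean_prod_esym2 r phi : uniq r ->
  E (fun s : outcome => esym2 [seq phi (s i) | i <- r]) = triangle (size r) * Ep phi ^+ 2.
Proof.
elim: r => [|i r IH] /=.
  rewrite /triangle !mul0r /mean_prod big1// => s _; by rewrite mulr0.
move=> /andP[ir ur].
rewrite mean_prodD IH// (mean_prod_coord phi (F := fun s : outcome => \sum_(y <- [seq phi
  (s j) | j <- r]) y)); last first.
  exact: (@indep_of_map i r phi (fun l => \sum_(y <- l) y)).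
rewrite (@eq_mean_prod _ (fun s : outcome => \sum_(j <- r) phi (s j))); last by move=> s;
  rewrite big_map.
rewrite mean_prod_sum_coord /triangle -natr1; by field.
Qed.

(** In the expanded square, a product of two different pairs has mean 0, since some index occurs in
    it once only and psi is centered; the diagonal leaves one term per pair. *)
Lemma mean_prod_sqr_esym2 r psi : Ep psi = 0 -> uniq r ->
  E (fun s : outcome => esym2 [seq psi (s i) | i <- r] ^+ 2) =
  triangle (size r) * Ep (fun a => psi a ^+ 2) ^+ 2.
Proof.
move=> psi0; set v := Ep _.
have ES k : uniq k -> E (fun s : outcome => (\sum_(y <- [seq psi (s i) | i <- k]) y) ^+ 2)
  = (size k)%:R * v.
  elim: k => [_|i k IH /= /andP[ik uk]].
    by rewrite mul0r /mean_prod big1// => s _; rewrite big_nil expr0n mulr0.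
  rewrite (@eq_mean_prod _ (fun s : outcome => psi (s i) ^+ 2 * 1
     + (2 * (psi (s i) * \sum_(y <- [seq psi (s j) | j <- k]) y)
     + (\sum_(y <- [seq psi (s j) | j <- k]) y) ^+ 2))); last first.
    by move=> s; rewrite big_cons; ring.
  rewrite !mean_prodD mean_prodZ (mean_prod_coord psi); last first.
    exact: (@indep_of_map i k psi (fun l => \sum_(y <- l) y)).
  rewrite psi0 mul0r mulr0 add0r IH//.
  rewrite (mean_prod_coord (fun a => psi a ^+ 2) (F := fun=> 1))//.
  by rewrite mean_prod1 -/v -natr1; ring.
elim: r => [_|i r IH /= /andP[ir ur]].
  by rewrite /triangle !mul0r /mean_prod big1// => s _; rewrite expr0n mulr0.
rewrite (@eq_mean_prod _ (fun s : outcome => psi (s i) ^+ 2 * (\sum_(y <- [seq psi (s j) |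
  j <- r]) y) ^+ 2
   + (psi (s i) * (2 * ((\sum_(y <- [seq psi (s j) | j <- r]) y) * esym2 [seq psi (s j) | j
     <- r]))
   + esym2 [seq psi (s j) | j <- r] ^+ 2))); last by move=> s; ring.
rewrite !mean_prodD IH//.
rewrite (mean_prod_coord (fun a => psi a ^+ 2) (F := fun s : outcome => (\sum_(y <- [seq
  psi (s j) | j <- r]) y) ^+ 2)); last first.
  exact: (@indep_of_map i r psi (fun l => (\sum_(y <- l) y) ^+ 2)).
rewrite (mean_prod_coord psi (F := fun s : outcome => 2 * ((\sum_(y <- [seq psi (s j) | j
  <- r]) y) * esym2 [seq psi (s j) | j <- r]))); last first.
  exact: (@indep_of_map i r psi (fun l => 2 * ((\sum_(y <- l) y) * esym2 l))).
rewrite psi0 mul0r add0r ES// -/v /triangle -natr1; by field.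
Qed.

(** Markov's inequality for the combination in [large_sum_esym2]. Both means are at most half of the
    square of n v, and 100 / 2 + (329 / 5) / 2 = 82.9 is rounded up to 83. *)
Lemma large_centered_sum (e : R) psi : 0 < e -> Ep psi = 0 ->
  (forall a, psi a ^+ 2 <= 13 / 50 * e ^+ 2) ->
  E (fun s : outcome => (37 / 50 * e <= `|\sum_i psi (s i)|)%R%:R) <=
  83 * (#|I|%:R * Ep (fun a => psi a ^+ 2)) ^+ 2 / e ^+ 4.
Proof.
move=> e0 psi0 hpsi; set v := Ep _.
have e4 : 0 < e ^+ 4 by rewrite exprn_gt0.
rewrite ler_pdivlMr// mulrC -mean_prodZ.
set l := fun s : outcome => [seq psi (s i) | i <- enum I].
apply: (@le_trans _ _ (E (fun s : outcome => 100 * esym2 (l s) ^+ 2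
    + 329 / 5 * esym2 [seq psi (s i) ^+ 2 | i <- enum I]))).
  apply: le_mean_prod => s; move: (@large_sum_esym2 _ e (l s) e0).
  have ls x : x \in l s -> x ^+ 2 <= 13 / 50 * e ^+ 2.
    by move=> /mapP[i _ ->].
  have -> : \sum_(x <- l s) x = \sum_i psi (s i) by rewrite big_map big_enum.
  have -> : [seq psi (s i) ^+ 2 | i <- enum I] = [seq x ^+ 2 | x <- l s] by rewrite /l;
    elim: (enum I) => //= a k ->.
  move=> /(_ ls) h; case: (boolP (37 / 50 * e <= _)) => [hT|_]; first by rewrite mulr1;
    exact: h.
  rewrite mulr0; apply: addr_ge0; apply: mulr_ge0.
  - exact: ler0n.
  - exact: sqr_ge0.
  - by apply: divr_ge0; exact: ler0n.
  - apply: esym2_ge0 => x /mapP[i _ ->]; exact: sqr_ge0.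
rewrite mean_prodD !mean_prodZ mean_prod_sqr_esym2 ?enum_uniq//.
rewrite (mean_prod_esym2 (fun a => psi a ^+ 2)) ?enum_uniq// -/v /triangle -cardE.
have n0 : 0 <= #|I|%:R :> R by [].
rewrite exprMn; set n := #|I|%:R in n0 *.
have h1 : 0 <= n * v ^+ 2 by apply: mulr_ge0 => //; exact: sqr_ge0.
have h2 : 0 <= n ^+ 2 * v ^+ 2 by apply: mulr_ge0; exact: sqr_ge0.
have -> : 100 * (n * (n - 1) / 2 * v ^+ 2) + 329 / 5 * (n * (n - 1) / 2 * v ^+ 2)
  = 829 / 10 * (n ^+ 2 * v ^+ 2 - n * v ^+ 2) by field.
lra.
Qed.

(* Either some big value occurs and the other variables must supply at least
   [e' - |x a|], or the centered small values have a large sum.  The numerical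
   constants are 3/4, 1/4 and 1/4, with some room for passing to limits. *)
Lemma tail_bound (x : S -> R) (big : pred S) (e e' sigma2 D rho : R) :
  0 < e -> 199 / 200 * e <= e' ->
  (forall a, ~~ big a -> `|x a| <= e / 2) ->
  let mu := Ep (fun a => if big a then 0 else x a) in
  #|I|%:R * `|mu| <= 51 / 200 * e -> `|mu| <= e / 200 ->
  #|I|%:R * Ep (fun a => if big a then 0 else x a ^+ 2) <= sigma2 ->
  (forall z, 0 <= z -> \sum_(a | big a && (e' - z <= `|x a|)) #|I|%:R * p a <= D * (z + rho)) ->
  E (fun s : outcome => (e' < `|\sum_i x (s i)|)%R%:R) <=
  83 * sigma2 ^+ 2 / e ^+ 4 + D * (#|I|%:R * Ep (fun a => `|x a|) + rho).
Proof.
move=> e0 ee' hsmall mu nmu mule hs2 hD.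
pose x0 a := if big a then 0 else x a.
have Ex0 : Ep x0 = mu by []; clearbody mu.
pose psi a := x0 a - mu.
have Epsi0 : Ep psi = 0.
  rewrite /mean_law; under eq_bigr do rewrite /psi mulrBr.
  by rewrite sumrB -/(Ep x0) Ex0 -mulr_suml p_sum1 mul1r subrr.
have x0e a : `|x0 a| <= e / 2.
  rewrite /x0; case: ifPn => [_|/hsmall//]; rewrite normr0; lra.
have psi2 a : psi a ^+ 2 <= 13 / 50 * e ^+ 2.
  (* 1/2 for the value and 1/200 for the mean; (101/200)^2 is below the 13/50 that
     [large_centered_sum] allows. *)
  have : `|psi a| <= 101 / 200 * e.
    by rewrite (le_trans (ler_normB _ _))//; have := x0e a; lra.
  rewrite -[psi a ^+ 2]real_normK ?num_real// => h.
  have : `|psi a| ^+ 2 <= (101 / 200 * e) ^+ 2 by rewrite ler_sqr ?nnegrE//; lra.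
  rewrite exprMn; have := sqr_ge0 e; lra.
pose Z (s : outcome) : R := \sum_i `|x (s i)|.
(* Summed over a list that omits i, so that [indep_of_map] applies. *)
pose Zi i (s : outcome) : R := \sum_(y <- [seq `|x (s j)| | j <- enum I & j != i]) y.
have ZiE i s : Zi i s = \sum_(j | j != i) `|x (s j)|.
  by rewrite /Zi big_map big_filter big_enum_cond.
pose F (s : outcome) : R := (37 / 50 * e <= `|\sum_i psi (s i)|)%R%:R.
(* Union bound over the index and the value of a big variable: the sizes of the other ones must make
   up for e' - |x a|. *)
pose G (s : outcome) : R := \sum_i \sum_(a | big a) ((s i == a)%:R * (e' - `|x a| <= Zi i
  s)%R%:R).
apply: (@le_trans _ _ (E (fun s : outcome => F s + G s))); first (rewrite /F /G).
  apply: le_mean_prod => s; have [hs|] := ltP e' _ => /=; last first.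
    by move=> _; rewrite addr_ge0// sumr_ge0// => i _; rewrite sumr_ge0// => a _;
      rewrite mulr_ge0.
  have [/existsP[i bi]|/existsPn nb] := boolP [exists i, big (s i)].
    rewrite -[X in X <= _]add0r lerD//.
    rewrite (bigD1 i)//= -[X in X <= _]addr0 lerD//; last first.
      by rewrite sumr_ge0// => j _; rewrite sumr_ge0// => a _; rewrite mulr_ge0.
    rewrite (bigD1 (s i))//= -[X in X <= _]addr0 lerD//; last first.
      by rewrite sumr_ge0// => a _; rewrite mulr_ge0.
    rewrite eqxx mul1r; set c := (e' - _ <= _); suff -> : c by [].
    rewrite /c ZiE lerBlDr (le_trans (ltW hs))// (bigD1 i)//= addrC.
    by rewrite (le_trans (ler_normD _ _))// lerD2r ler_norm_sum.
  rewrite -[X in X <= _]addr0 lerD//; last first.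
    by rewrite sumr_ge0// => j _; rewrite sumr_ge0// => a _; rewrite mulr_ge0.
  set c := (37 / 50 * e <= _); suff -> : c by [].
  (* Without big values the uncentered sum exceeds e' >= 199/200 e, and centering changes it by at
     most 51/200 e: the difference is 37/50 e. *)
  rewrite /c; have -> : \sum_i psi (s i) = \sum_i x (s i) - #|I|%:R * mu.
    rewrite /psi sumrB sumr_const -(mulr_natl mu); congr (_ - _).
    by apply: eq_bigr => i _; rewrite /x0 (negbTE (nb i)).
  have := lerB_dist (\sum_i x (s i)) (#|I|%:R * mu).
  by rewrite normrM normr_nat; lra.
rewrite mean_prodD; apply: lerD; rewrite {}/F {}/G.
  apply: le_trans (large_centered_sum e0 Epsi0 psi2) _.
  have e4 : 0 < e ^+ 4 by rewrite exprn_gt0.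
  rewrite ler_pM2r ?invr_gt0// ler_pM2l// ler_sqr ?nnegrE; last 2 first.
  - by rewrite mulr_ge0// sumr_ge0// => a _; rewrite mulr_ge0// sqr_ge0.
  - apply: le_trans hs2; rewrite mulr_ge0// sumr_ge0// => a _; rewrite mulr_ge0//.
    by case: ifP => // _; exact: sqr_ge0.
  apply: le_trans hs2; rewrite ler_wpM2l//.
  have -> : Ep (fun a => psi a ^+ 2) = Ep (fun a => x0 a ^+ 2) - mu ^+ 2.
    transitivity (Ep (fun a => x0 a ^+ 2) - 2 * mu * Ep x0 + mu ^+ 2 * (\sum_a p a)).
      rewrite /mean_law !mulr_sumr -sumrB -big_split; apply: eq_bigr => a _ /=.
      by rewrite /psi; ring.
    by rewrite Ex0 p_sum1; ring.
  rewrite lerBlDr -[X in X <= _]addr0 lerD ?sqr_ge0//.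
  apply: ler_sum => a _; apply: ler_wpM2l => //; rewrite /x0.
  by case: ifP; rewrite ?expr0n.
rewrite mean_prod_sum.
(* Independence separates the value a at i from [Zi i], which is then enlarged to the full sum [Z].
   Being the same for all i, [Z] lets [hD] be applied outcome by outcome with z = Z s. *)
apply: (@le_trans _ _ (E (fun s : outcome => \sum_(a | big a) #|I|%:R * p a * (e' - `|x a|
  <= Z s)%R%:R))).
  rewrite mean_prod_sum (eq_bigr (fun i => \sum_(a | big a) E (fun s : outcome => (s i ==
    a)%:R * (e' - `|x a| <= Zi i s)%R%:R))); last by move=> i _; rewrite mean_prod_sum.
  rewrite exchange_big /=; apply: ler_sum => a ba.
  rewrite mean_prodZ -mulrA mulr_natl -sumr_const; apply: ler_sum => i _.
  rewrite (mean_prod_coord (fun b => (b == a)%:R) (F := fun s : outcome => (e' - `|x a| <=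
    Zi i s)%R%:R)); last first.
    apply: (@indep_of_map i [seq j <- enum I | j != i] (fun a => `|x a|) (fun l => (e' -
      `|x a| <= \sum_(y <- l) y)%R%:R)).
    by rewrite mem_filter eqxx.
  have -> : Ep (fun b => (b == a)%:R) = p a.
    rewrite /mean_law (bigD1 a)//= eqxx mulr1 big1 ?addr0// => b /negbTE ->.
    by rewrite mulr0.
  apply: ler_wpM2l => //; apply: le_mean_prod => s; rewrite ler_nat.
  case: leP => // h; set c := (e' - _ <= _); suff -> : c by [].
  apply: le_trans h _; rewrite ZiE /Z [leRHS](bigD1 i)//= -[X in X <= _]add0r.
  by rewrite lerD.
apply: (@le_trans _ _ (E (fun s : outcome => D * (Z s + rho)))).
  apply: le_mean_prod => s; apply: le_trans (hD (Z s) _); last first.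
    by apply: sumr_ge0.
  rewrite [X in _ <= X]big_mkcondr /=; apply: ler_sum => a _.
  rewrite lerBlDr addrC -lerBlDr; case: ifP => _; [by rewrite mulr1|by rewrite mulr0].
rewrite mean_prodZ mean_prodD /Z mean_prod_sum.
rewrite (eq_bigr (fun=> Ep (fun a => `|x a|))); last by move=> i _;
  exact: (mean_prod_coord1 i (fun a => `|x a|)).
rewrite sumr_const -[Ep _ *+ _]mulr_natl.
have -> : E (fun=> rho) = rho.
  by rewrite -[RHS]mulr1 -mean_prod1 -mean_prodZ; apply: eq_mean_prod => s; rewrite mulr1.
by [].
Qed.

End product_law.

(** * Increments and jumps of a cadlag path *)

Section cadlag_paths.
Context {R : realType}.
Variable x : R -> R.
Hypothesis x_cadlag : cadlag x.
Implicit Types (s t u v g e : R).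

Lemma cadlag_right_near s g : 0 <= s -> 0 < g ->
  exists2 e, 0 < e & forall u, s <= u < s + e -> `|x u - x s| < g.
Proof.
move=> s0 g0; have /cvgrPdist_lt/(_ _ g0) := x_cadlag.1 s s0.
move=> /nbhs_ballP[e /= e0 h]; exists e => // u /andP[su use].
move: su; rewrite le_eqVlt => /predU1P[<-|su]; first by rewrite subrr normr0.
rewrite distrC; apply: h => //.
by rewrite /ball /= distrC ger0_norm; lra.
Qed.

Lemma cadlag_left_near s g : 0 < s -> 0 < g ->
  exists2 e, 0 < e & forall u, s - e < u < s -> `|x u - (x s - jump x s)| < g.
Proof.
move=> s0 g0; have := x_cadlag.2 s s0.
rewrite /jump subKr => /cvgrPdist_lt/(_ _ g0).
move=> /nbhs_ballP[e /= e0 h]; exists e => // u /andP[seu us].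
rewrite distrC; apply: h => //.
by rewrite /ball /= ger0_norm; lra.
Qed.

Lemma cadlag_local s g : 0 <= s -> 0 < g -> exists2 e, 0 < e &
  forall u v, 0 <= u -> u <= v -> `|u - s| < e -> `|v - s| < e ->
    if u < s <= v then `|x v - x u - jump x s| < g else `|x v - x u| < g.
Proof.
move=> s0 g0; have g2 : 0 < g / 2 by rewrite divr_gt0.
have [e1 e1_gt0 h1] := cadlag_right_near s0 g2.
have [e2 e2_gt0 h2] : exists2 e, 0 < e & forall u, 0 <= u -> s - e < u < s ->
    `|x u - (x s - jump x s)| < g / 2.
  (* At time 0 there is no left limit, and no admissible u lies to the left either. *)
  move: s0; rewrite le_eqVlt => /predU1P[<-|s0].
    by exists 1 => // u u0 /andP[_ /(le_lt_trans u0)]; rewrite ltxx.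
  have [e e0 h] := cadlag_left_near s0 g2.
  by exists e => // u _; exact: h.
exists (Num.min e1 e2); first by rewrite lt_min e1_gt0.
move=> u v u0 uv ue ve; rewrite lt_min !ltr_distl in ue; rewrite lt_min !ltr_distl in ve.
case/andP: ue => /andP[u1 u2] /andP[u3 u4]; case/andP: ve => /andP[v1 v2] /andP[v3 v4].
have dist3 (a b c : R) : `|a - c| < g / 2 -> `|b - c| < g / 2 -> `|a - b| < g.
  move=> ac bc; rewrite -(subrKA c) (le_lt_trans (ler_normD _ _))//.
  by rewrite [ `|c - b|]distrC; lra.
case: ifPn => [/andP[us sv]|].
  have -> : x v - x u - jump x s = (x v - x s) - (x u - (x s - jump x s)) by ring.
  rewrite (le_lt_trans (ler_normB _ _))// [g]splitr ltrD//.
    by apply: h1; rewrite sv.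
  by apply: h2 => //; rewrite u3.
rewrite negb_and -leNgt -ltNge => /orP[su|vs].
  apply: (@dist3 _ _ (x s)); apply: h1; first by rewrite (le_trans su).
  by rewrite su.
apply: (@dist3 _ _ (x s - jump x s)); apply: h2 => //; last by rewrite u3 (le_lt_trans uv).
- exact: le_trans u0 uv.
- by rewrite v3.
Qed.

(** Compactness of [0, t], as a Lebesgue number. The predicate is left abstract because uniform
    continuity fails at jumps: each use puts into it what remains true around a jump. *)
Lemma time_lebesgue_number t (P : R -> R -> Prop) :
  (forall s, 0 <= s -> exists2 e, 0 < e &
     forall u v, 0 <= u -> 0 <= v -> `|u - s| < e -> `|v - s| < e -> P u v) ->
  exists2 e, 0 < e &
    forall u v, 0 <= u <= t -> 0 <= v <= t -> `|u - v| < e -> P u v.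
Proof.
move=> H.
have /compact_near_coveringP := @segment_compact R 0 t.
move=> /(_ _ (0^'+ : set_system R)
  (fun d s => forall u v, 0 <= u -> 0 <= v -> `|u - s| < d -> `|v - s| < d -> P u v)).
case=> [s /=|].
  rewrite in_itv /= => /andP[s0 _]; have [e e0 he] := H s s0.
  have e2 : 0 < e / 2 by rewrite divr_gt0.
  exists (ball s (e / 2), [set d | d < e / 2]).
    split; first exact: nbhsx_ballx.
    by apply: nbhs_right_lt.
  move=> [y d] /= [sy de] u v u0 v0 uy vy; apply: he => //.
    rewrite -(subrKA y) (le_lt_trans (ler_normD _ _))//.
    by move: sy; rewrite /ball /= [ `|s - y|]distrC; lra.
  rewrite -(subrKA y) (le_lt_trans (ler_normD _ _))//.
  by move: sy; rewrite /ball /= [ `|s - y|]distrC; lra.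
move=> d /= d0 /(_ (d / 2)) => h; exists (d / 2); first by rewrite divr_gt0.
move=> u v u01 v01 uv; apply: (h _ _ v) => //.
- by rewrite /ball /= sub0r normrN ger0_norm; lra.
- by lra.
- by case/andP: u01.
- by case/andP: v01.
- by rewrite subrr normr0 divr_gt0.
Qed.

Lemma cadlag_increment t g : 0 < g -> exists2 e, 0 < e &
  forall u v, 0 <= u -> u <= v -> v <= t -> v - u < e ->
    `|x v - x u| < g \/
    exists2 s, u < s <= v & `|x v - x u - jump x s| < g.
Proof.
move=> g0; have [|e e0 h] := @time_lebesgue_number t (fun u v => u <= v ->
   `|x v - x u| < g \/ exists2 s, u < s <= v & `|x v - x u - jump x s| < g).
  move=> s s0; have [e e0 h] := cadlag_local s0 g0.
  exists e => // u v u0 v0 us vs uv; have := h u v u0 uv us vs.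
  by case: ifP => [usv ?|_]; [right; exists s|left].
exists e => // u v u0 uv vt vue; apply: h => //.
- by rewrite u0 (le_trans uv).
- by rewrite vt (le_trans u0).
- by rewrite distrC ger0_norm ?subr_ge0.
Qed.

Lemma jump_le s g e : 0 < s -> 0 < e ->
  (forall u, 0 <= u -> s - e < u < s -> `|x s - x u| <= g) -> `|jump x s| <= g.
Proof.
move=> s0 e0 h; apply/ler_addgt0Pr => d d0.
have [e' e'0 h'] := cadlag_left_near s0 d0.
pose m := Num.min s (Num.min e e').
have m0 : 0 < m by rewrite !lt_min s0 e0.
have : m <= s /\ (m <= e /\ m <= e') by rewrite !ge_min !lexx !orbT.
move=> [ms [me me']].
have hu : `|x s - x (s - m / 2)| <= g by apply: h; lra.
have hu' : `|x (s - m / 2) - (x s - jump x s)| < d by apply: h'; lra.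
have -> : jump x s = (x s - x (s - m / 2)) + (x (s - m / 2) - (x s - jump x s)) by ring.
by rewrite (le_trans (ler_normD _ _))// lerD// ltW.
Qed.

(** Around a time r, the increments that do not straddle r are smaller than g, so the jump at a
    nearby time other than r is at most g: r alone can carry a larger one. *)
Lemma large_jumps_apart t g : 0 < g -> exists2 e, 0 < e &
  forall s s', 0 < s <= t -> 0 < s' <= t -> g < `|jump x s| -> g < `|jump x s'| ->
    `|s - s'| < e -> s = s'.
Proof.
move=> g0.
have [|e e0 h] := @time_lebesgue_number t (fun s s' => 0 < s -> 0 < s' ->
    g < `|jump x s| -> g < `|jump x s'| -> s = s'); last first.
  exists e => // s s' /andP[s0 st] /andP[s'0 s't] js js' ss'.
  by apply: h => //; [rewrite (ltW s0)|rewrite (ltW s'0)].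
move=> r r0; have [e e0 h] := cadlag_local r0 g0.
exists e => //.
have sr s : 0 < s -> `|s - r| < e -> g < `|jump x s| -> s = r.
  move=> s0 sre; apply: contraTeq => /eqP sr; rewrite -leNgt.
  have [lt_sr|lt_rs|//] := ltgtP s r.
    apply: (@jump_le _ _ (e - (r - s))) => //.
      by rewrite ltr_distl in sre; lra.
    move=> u u0 /andP[seu us].
    have := h u s u0 (ltW us); rewrite [r <= s]leNgt lt_sr andbF => h'.
    by apply/ltW/h' => //; rewrite ltr_distl; lra.
  apply: (@jump_le _ _ (s - r)) => //; first by lra.
  move=> u u0 /andP[seu us].
  have ur : r < u by lra.
  have := h u s u0 (ltW us); rewrite [u < r]ltNge (ltW ur) => h'.
  by apply/ltW/h' => //; move: sre; rewrite !ltr_distl; lra.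
by move=> s s' _ _ sr1 sr2 s0 s'0 j1 j2; rewrite (sr s)// (sr s').
Qed.

Lemma increment_at_jump s g : 0 < s -> 0 < g -> exists2 e, 0 < e &
  forall u v, 0 <= u -> u < s <= v -> v - u < e -> `|x v - x u - jump x s| < g.
Proof.
move=> s0 g0; have [e e0 h] := cadlag_local (ltW s0) g0; exists e => // u v u0 usv vu.
have := h u v u0; rewrite usv; case/andP: usv => us sv; apply; first lra.
- by rewrite ltr_distl; lra.
- by rewrite ltr_distl; lra.
Qed.

End cadlag_paths.

(** * Meshes of an interval and the increments along them *)

Lemma near_all_seq {T : eqType} {I : Type} (F : set_system I) {FF : Filter F}
    (r : seq T) (P : T -> I -> Prop) :
  (forall x, x \in r -> \forall k \near F, P x k) ->
  \forall k \near F, forall x, x \in r -> P x k.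
Proof.
elim: r => [|a r IH] h; first by near=> k.
have h1 := h a (mem_head _ _).
have h2 : \forall k \near F, forall x, x \in r -> P x k.
  by apply: IH => x xr; apply: h; rewrite inE xr orbT.
near=> k => x; rewrite inE => /predU1P[->|]; first by near: k.
by move: x; near: k.
Unshelve. all: by end_near. Qed.

Section mesh.
Context {R : realType}.
Implicit Types (t e d a b g : R) (m n : nat).

Lemma near_div t e : 0 < e -> \forall m \near \oo, t / m%:R < e.
Proof.
move=> e0; near=> m.
have m0 : 0 < m%:R :> R by rewrite ltr0n; near: m; exact: nbhs_infty_gt.
rewrite ltr_pdivrMr// mulrC -ltr_pdivrMr//.
by near: m; exact: nbhs_infty_gtr.
Unshelve. all: by end_near. Qed.

(** Cells are open on the left and closed on the right: by right continuity, an increment sees a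
    jump at the right end of its cell and not one at the left end. *)
Lemma mesh_index m h s t : 0 < h -> s < t <= s + m%:R * h ->
  exists2 j, (j < m)%N & s + j%:R * h < t <= s + j.+1%:R * h.
Proof.
move=> h0; elim: m => [|m IH].
  by rewrite mul0r addr0 => /andP[/lt_le_trans/[apply]]; rewrite ltxx.
move=> /andP[st tm]; have [tm'|tm'] := leP t (s + m%:R * h).
  by have [|j jm hj] := IH; [rewrite st|exists j => //; exact: leqW].
by exists m => //; rewrite tm'.
Qed.

Lemma mesh_index_inj h s t j k : 0 < h ->
  s + j%:R * h < t <= s + j.+1%:R * h -> s + k%:R * h < t <= s + k.+1%:R * h -> j = k.
Proof.
move=> h0 /andP[j1 j2] /andP[k1 k2].
have := lt_le_trans j1 k2; rewrite ltrD2l ltr_pM2r// ltr_nat ltnS => jk.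
have := lt_le_trans k1 j2; rewrite ltrD2l ltr_pM2r// ltr_nat ltnS => kj.
by apply/eqP; rewrite eqn_leq jk.
Qed.

End mesh.

Definition increment {R : realType} (x : R -> R) (s h : R) (j : nat) : R :=
  x (s + j.+1%:R * h) - x (s + j%:R * h).

Section cadlag_mesh.
Context {R : realType}.
Variable x : R -> R.
Hypothesis x_cadlag : cadlag x.
Implicit Types (s t e l a b : R) (m : nat) (B U : set R).

Lemma mesh_increment_jump s l B : 0 <= s -> 0 < l -> closed B -> ~ B 0 ->
  (forall N, exists2 m, (N <= m)%N &
     exists2 j, (j < m)%N & B (increment x s (l / m%:R) j)) ->
  exists2 t, s < t <= s + l & B (jump x t).
Proof.
move=> s0 l0 cB B0 H; apply: contrapT => nojump.
have [|e e0 he] := @time_lebesgue_number R (s + l)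
    (fun u v => s <= u -> v <= s + l -> u <= v -> ~ B (x v - x u)).
  (* A jump at r = s or outside the interval is not seen by the increments inside it, and 0 stands
     for it. *)
  move=> r r0; pose z := if s < r <= s + l then jump x r else 0.
  have nBz : ~ B z.
    rewrite /z; case: ifP => // srl Bj; apply: nojump; by exists r.
  have gap y : ~ B y -> exists2 d, 0 < d & forall y', `|y' - y| < d -> ~ B y'.
    move=> nBy; have : nbhs y (~` B) by apply: open_nbhs_nbhs; split => //; exact: closed_openC.
    move=> /nbhs_ballP[d d0 hd]; exists d => // y' y'd; apply: hd.
    by rewrite /ball /= distrC.
  have [d1 d10 h1] := gap _ nBz; have [d2 d20 h2] := gap _ B0.
  have d0 : 0 < Num.min d1 d2 by rewrite lt_min d10.
  have [e e0 he] := cadlag_local x_cadlag r0 d0; exists e => // u v u0 v0 ur vr su vl uv.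
  have := he u v u0 uv ur vr; case: ifPn => [/andP[ur' rv]|_].
    rewrite lt_min => /andP[h _]; apply: h1; rewrite /z (le_lt_trans su ur')/=.
    by rewrite (le_trans rv vl).
  by rewrite lt_min => /andP[_ h]; apply: h2; rewrite subr0.
have [N _ hN] : \forall m \near \oo, l / m%:R < e by exact: near_div.
have [m Nm [j jm]] := H (maxn N 1); rewrite /increment.
have m0 : 0 < m%:R :> R by rewrite ltr0n (leq_trans _ Nm)// leq_max orbT.
have h0 : 0 < l / m%:R by rewrite divr_gt0.
have jh : 0 <= j%:R * (l / m%:R) by rewrite mulr_ge0// ltW.
have jm' : j.+1%:R * (l / m%:R) <= l.
  by rewrite mulrCA ger_pMr// ler_pdivrMr// mul1r ler_nat.
have hd : j.+1%:R * (l / m%:R) = j%:R * (l / m%:R) + l / m%:R by rewrite -natr1 mulrDl mul1r.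
have le : l / m%:R < e by apply: hN; rewrite /= (leq_trans _ Nm)// leq_maxl.
apply: he; rewrite ?hd in jm' *; try lra.
by rewrite ltr_distl; lra.
Qed.

(** A converse, for an open set and for all fine meshes instead of infinitely many. Hence closed
    sets go with upper limits of events and open sets with lower limits. *)
Lemma jump_mesh_increment s l t U : 0 <= s -> 0 < l -> open U ->
  s < t <= s + l -> U (jump x t) ->
  \forall m \near \oo, exists2 j, (j < m)%N & U (increment x s (l / m%:R) j).
Proof.
move=> s0 l0 oU stl Ut.
have /nbhs_ballP[d /= d0 hd] : nbhs (jump x t) U by exact: open_nbhs_nbhs.
have t0 : 0 < t by case/andP: stl => /(le_lt_trans s0).
have [e e0 he] := increment_at_jump x_cadlag t0 d0.
near=> m.
have m0 : 0 < m%:R :> R by rewrite ltr0n; near: m; exact: nbhs_infty_gt.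
have h0 : 0 < l / m%:R by rewrite divr_gt0.
have [|j jm hj] := @mesh_index R m (l / m%:R) s t h0; first by rewrite mulrC divfK ?gt_eqF.
exists j => //; apply: hd; rewrite /ball /= distrC; apply: he => //.
  by rewrite addr_ge0// mulr_ge0// ltW.
have -> : s + j.+1%:R * (l / m%:R) - (s + j%:R * (l / m%:R)) = l / m%:R.
  by rewrite -natr1; ring.
by near: m; exact: near_div.
Unshelve. all: by end_near. Qed.

(** Large jumps are a positive distance apart, so a fine mesh gives each its own cell. *)
Lemma finite_large_jumps t a (A : set R) : 0 < t -> 0 < a ->
  (forall y, A y -> a < `|y|) -> finite_set (jump_times x t A).
Proof.
move=> t0 a0 Aa; have [e e0 he] := large_jumps_apart x_cadlag t a0.
have [m m1 hm] : exists2 m, (0 < m)%N & t / m%:R < e.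
  have : \forall m \near \oo, t / m%:R < e by exact: near_div.
  move=> [N _ hN]; exists (maxn N 1); first by rewrite leq_max orbT.
  by apply: hN; rewrite /= leq_maxl.
have m0 : 0 < m%:R :> R by rewrite ltr0n.
have h0 : 0 < t / m%:R by rewrite divr_gt0.
have idx s : exists j : 'I_m, jump_times x t A s -> 0 + j%:R * (t / m%:R) < s <= 0 +
  j.+1%:R * (t / m%:R).
  have [js|njs] := pselect (jump_times x t A s); last by exists (Ordinal m1).
  case: js => s0 st As; have [|j jm hj] := @mesh_index R m (t / m%:R) 0 s h0.
    by rewrite s0 mulrC divfK ?gt_eqF// add0r.
  by exists (Ordinal jm).
have [f hf] := choice idx.
have finj : set_inj (jump_times x t A) f.
  move=> s s'; rewrite !inE => js js' fss'.
  have := hf s js; have := hf s' js'; rewrite -fss'.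
  case: js => s0 st As; case: js' => s'0 s't As' /andP[h1 h2] /andP[h3 h4].
  apply: he => //.
  - by rewrite s0.
  - by rewrite s'0.
  - exact: Aa.
  - exact: Aa.
  rewrite -natr1 in h2 h4.
  by rewrite (le_lt_trans _ hm)// ler_distl; apply/andP; split; lra.
rewrite -(eq_finite_set (inj_card_eq finj)); exact: finite_finset.
Qed.


(** The function g will be a rounding, which is discontinuous, so the mesh sum need not converge to
    a sum over jumps. It is instead an exact sum of g at points [xi s] close to the jumps, [xi s]
    being the increment of the cell of s. The gap between b and a ensures that a cell with an
    increment above a contains a jump above b. *)
Lemma mesh_sum_jumps t a b e (g : R -> R) : 0 < t -> 0 < b < a -> 0 < e ->
  (forall y, `|y| <= a -> g y = 0) ->
  let J := jump_times x t [set y | b < `|y|] in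
  \forall m \near \oo, exists2 xi : R -> R, (forall s, J s -> `|xi s - jump x s| < e) &
    \sum_(j < m) g (increment x 0 (t / m%:R) j) = \sum_(s <- fset_set J) g (xi s).
Proof.
move=> t0 /andP[b0 ba] e0 ga J.
have finJ : finite_set J by apply: (@finite_large_jumps t b).
have [d1 d10 h1] := large_jumps_apart x_cadlag t b0.
have ab : 0 < a - b by rewrite subr_gt0.
have [d2 d20 h2] := cadlag_increment x_cadlag t ab.
have h3 : \forall m \near \oo, forall s, s \in enum_fset (fset_set J) ->
    forall u v, 0 <= u -> u < s <= v -> v - u <= t / m%:R -> `|x v - x u - jump x s| < e.
  apply: near_all_seq => s; rewrite -[_ \in _]/(s \in fset_set J) in_fset_set// inE => -[s0
    st _].
  have [d d0 hd] := increment_at_jump x_cadlag s0 e0.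
  near=> m; move=> u v u0 usv uv; apply: hd => //; apply: (le_lt_trans uv).
  by near: m; exact: near_div.
near=> m.
have m0 : (0 < m)%N by near: m; exact: nbhs_infty_gt.
have m1 : 0 < m%:R :> R by rewrite ltr0n.
set h := t / m%:R; have h0 : 0 < h by rewrite divr_gt0.
have hd1 : h < d1 by rewrite /h; near: m; exact: near_div.
have hd2 : h < d2 by rewrite /h; near: m; exact: near_div.
have idx s : exists j : 'I_m, J s -> 0 + j%:R * h < s <= 0 + j.+1%:R * h.
  have [js|njs] := pselect (J s); last by exists (Ordinal m0).
  case: js => s0 st As; have [|j jm hj] := @mesh_index R m h 0 s h0.
    by rewrite s0 mulrC divfK ?gt_eqF// add0r.
  by exists (Ordinal jm).
have [f hf] := choice idx.
have step (j : nat) : 0 + j.+1%:R * h - (0 + j%:R * h) = h by rewrite -natr1; ring.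
exists (fun s => increment x 0 h (f s)).
  move=> s Js; have : s \in enum_fset (fset_set J).
    by rewrite -[_ \in _]/(s \in fset_set J) in_fset_set// inE.
  move: s Js => s Js sJ; rewrite /increment.
  have H : forall s, s \in enum_fset (fset_set J) ->
    forall u v, 0 <= u -> u < s <= v -> v - u <= t / m%:R -> `|x v - x u - jump x s| < e.
    by near: m.
  by apply: H => //; [rewrite add0r mulr_ge0// ltW|exact: hf|rewrite step].
pose F (j : 'I_m) := g (increment x 0 h j).
have urf : uniq (map f (fset_set J)).
  rewrite map_inj_in_uniq ?fset_uniq// => s s'.
  rewrite !in_fset_set// !inE => Js Js' fss'.
  have := hf s Js; have := hf s' Js'; rewrite -fss'.
  case: Js => s0 st As; case: Js' => s'0 s't As' /andP[u1 u2] /andP[u3 u4].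
  apply: h1 => //; first by rewrite s0.
    by rewrite s'0.
  have := step (f s) => st'.
  by rewrite (le_lt_trans _ hd1)// ler_distl; apply/andP; split; lra.
transitivity (\sum_(j <- map f (fset_set J)) F j); last by rewrite big_map.
rewrite (big_uniq _ urf) /= [RHS]big_mkcond /=; apply: eq_bigr => j _.
(* An increment above a in a cell without listed jump is impossible: by [h2] it is smaller than a -
   b, or within a - b of a jump, which then exceeds b and is listed. *)
case: ifPn => // jf; apply: ga; rewrite leNgt; apply/negP => aj.
have jh : 0 <= 0 + j%:R * h by rewrite add0r mulr_ge0// ltW.
have [|||||] := h2 (0 + j%:R * h) (0 + j.+1%:R * h) => //.
- by rewrite -subr_ge0 step ltW.
- by rewrite add0r /h mulrCA ger_pMr// ler_pdivrMr// mul1r ler_nat ltn_ord.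
- by rewrite step.
- by move=> H; have := lt_trans aj H; rewrite ltrBrDr => /ltW;
  rewrite -subr_le0 addrC addKr leNgt b0.
move=> [s sj hs].
have Js : J s.
  split => /=; first by case/andP: sj => /(le_lt_trans jh).
    case/andP: sj => _ /le_trans; apply.
    by rewrite add0r /h mulrCA ger_pMr// ler_pdivrMr// mul1r ler_nat ltn_ord.
  rewrite /increment in aj; move: aj hs; set w := x _ - x _ => aj hs.
  have := ler_normB (w - jump x s) w; rewrite addrAC subrr add0r normrN.
  have := lerB_dist w (jump x s); lra.
move/negP: jf; apply; apply/mapP; exists s; first by rewrite in_fset_set// inE.
by apply/val_inj/(mesh_index_inj h0 sj)/hf.
Unshelve. all: by end_near. Qed.

(* [g K] rounds a jump down to a multiple of the grid step [d K]. *)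
Lemma rounded_jump_sum t eta eps e' (d : nat -> R) (g : nat -> R -> R) :
  0 < t -> 0 < eta < eps -> (forall K, 0 < d K) ->
  (forall r, 0 < r -> \forall K \near \oo, d K < r) ->
  (forall K y, `|y| <= eta + d K -> g K y = 0) ->
  (forall K y, eps + d K < `|y| -> g K y = 0) ->
  (forall K y, eta + 2 * d K < `|y| <= eps + d K -> `|g K y - y| <= d K) ->
  e' < `|\sum_(s \in jump_times x t [set y | eta < `|y| <= eps]) jump x s| ->
  \forall K \near \oo, \forall m \near \oo,
    e' < `|\sum_(j < m) g K (increment x 0 (t / m%:R) j)|.
Proof.
move=> t0 /andP[eta0 etaeps] d0 dcvg g1 g2 g3.
set J := jump_times x t [set y | eta < `|y|].
set J' := jump_times _ _ _.
have finJ : finite_set J by apply: (@finite_large_jumps t eta).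
pose r := enum_fset (fset_set J).
have rJ s : (s \in r) = (s \in J) by rewrite -[_ \in r]/(s \in fset_set J) in_fset_set.
have -> : \sum_(s \in J') jump x s = \sum_(s <- r) if `|jump x s| <= eps then jump x s else 0.
  have -> : J' = J `&` [set s | `|jump x s| <= eps].
    apply/seteqP; split => s /=; first by move=> [s0 st /andP[]].
    by move=> [[s0 st h1] h2]; split => //; apply/andP.
  rewrite fsbig_mkcondr fsbig_finite//= [RHS]big_mkcond/=.
  by apply: eq_bigr => s _; rewrite mem_setE.
move=> he'.
set T := \sum_(s <- r) _ in he' *.
pose N : R := (size r)%:R.
have N0 : 0 <= N by [].
have N1 : 0 < N + 1 by lra.
(* Each of the N jumps contributes an error of at most 2 d K; N + 1 avoids a division by 0. *)
have sl : 0 < (`|T| - e') / (2 * (N + 1)) by rewrite divr_gt0 ?subr_gt0// mulr_gt0.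
(* The listed jumps are finitely many, all strictly above eta and each either at most eps or
   strictly above it. For a small step, [g2] or [g3] therefore applies to every increment within d K
   of a jump. *)
have hK : \forall K \near \oo, forall s, s \in r ->
    eta + 4 * d K < `|jump x s| /\ (`|jump x s| <= eps \/ eps + 2 * d K < `|jump x s|).
  apply: near_all_seq => s; rewrite rJ inE => -[s0 st /= js].
  have p1 : 0 < (`|jump x s| - eta) / 4 by rewrite divr_gt0// subr_gt0.
  have [le_j|lt_j] := leP `|jump x s| eps.
    near=> K; split; last by left.
    have : d K < (`|jump x s| - eta) / 4 by near: K; exact: dcvg.
    lra.
  have p2 : 0 < (`|jump x s| - eps) / 2 by rewrite divr_gt0// subr_gt0.
  near=> K.
  have : d K < (`|jump x s| - eta) / 4 by near: K; exact: dcvg.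
  have : d K < (`|jump x s| - eps) / 2 by near: K; exact: dcvg.
  by split; [lra|right; lra].
near=> K.
have ad : 0 < eta < eta + d K by rewrite eta0 ltrDl d0.
have := @mesh_sum_jumps t (eta + d K) eta (d K) (g K) t0 ad (d0 K) (g1 K).
apply: filterS => m [xi hxi ->]; rewrite -/r.
have Kr : forall s, s \in r ->
    eta + 4 * d K < `|jump x s| /\ (`|jump x s| <= eps \/ eps + 2 * d K < `|jump x s|).
  by near: K.
have Ksl : d K < (`|T| - e') / (2 * (N + 1)) by near: K; exact: dcvg.
have dist : `|\sum_(s <- r) g K (xi s) - T| <= N * (2 * d K).
  rewrite -sumrB (le_trans (ler_norm_sum _ _ _))//.
  apply: (@le_trans _ _ (\sum_(s <- r) 2 * d K)); last first.
    by rewrite big_const_seq count_predT iter_addr_0 /N [leRHS]mulr_natl lexx.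
  rewrite ![\sum_(s <- r) _]big_seq; apply: ler_sum => s sr.
  have hs : `|xi s - jump x s| < d K by apply: hxi; move: sr; rewrite rJ inE.
  have := lerB_dist (jump x s) (xi s); have := lerB_dist (xi s) (jump x s).
  rewrite [ `|jump x s - _|]distrC => k1 k2.
  have dK := d0 K.
  have [k3 [k4|k4]] := Kr s sr.
    rewrite k4; have : `|g K (xi s) - xi s| <= d K by apply: g3; apply/andP; split; lra.
    move=> k5; rewrite -(subrKA (xi s)) (le_trans (ler_normD _ _))//; lra.
  rewrite ifN ?subr0; last by rewrite -ltNge; lra.
  by rewrite g2 ?normr0; lra.
have := lerB_dist T (\sum_(s <- r) g K (xi s)); rewrite distrC => h.
have : N * (2 * d K) < `|T| - e'.
  rewrite (@le_lt_trans _ _ (d K * (2 * (N + 1))))//; last by rewrite -ltr_pdivlMr// mulr_gt0.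
  by have := d0 K; nra.
lra.
Unshelve. all: by end_near. Qed.

End cadlag_mesh.

(** * Comparison of integrals when one side may fail to be measurable *)

Section integral_monotone.
Local Open Scope ereal_scope.
Context {d : measure_display} {T : measurableType d} {R : realType}.
Variable mu : {measure set T -> \bar R}.
Implicit Types f g : T -> \bar R.
Import HBNNSimple.

(* The integral is a supremum over simple functions below the integrand, which
   is monotone without any measurability of the larger function. *)
Lemma integral_le_nonmeasurable f g : (forall w, 0 <= f w) ->
  (forall w, f w <= g w) -> \int[mu]_w f w <= \int[mu]_w g w.
Proof.
move=> f0 fg; have g0 w : 0 <= g w by exact: le_trans (fg w).
rewrite !ge0_integralTE//; apply: ub_ereal_sup => _ [h hf <-].
by apply: ereal_sup_ubound; exists h => // w; exact: le_trans (fg w).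
Qed.

(** The number of jumps will be the larger side. Making f vanish on a measurable null set turns the
    almost sure inequality into one that holds everywhere. *)
Lemma integral_ae_le_nonmeasurable_right f g : measurable_fun setT f ->
  (forall w, 0 <= f w) -> (forall w, 0 <= g w) ->
  {ae mu, forall w, f w <= g w} -> \int[mu]_w f w <= \int[mu]_w g w.
Proof.
move=> mf f0 g0 [N [mN N0 sN]].
pose f' := f \_ (~` N).
have mf' : measurable_fun setT f'.
  by apply/(measurable_restrictT _ (measurableC mN)).1; exact: measurable_funS mf.
have f'0 w : 0 <= f' w by rewrite /f' patchE; case: ifP.
apply: (@le_trans _ _ (\int[mu]_w f' w)).
  apply: ae_ge0_le_integral => //; exists N; split => // w /=; apply: contra_notP => nN _.
  by rewrite /f' patchE mem_set.
apply: integral_le_nonmeasurable => // w; rewrite /f' patchE; case: ifPn => //.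
rewrite inE => /= nN; apply: contrapT => nfg; apply: nN; exact: sN.
Qed.

(** Every simple function below f is almost surely below g, and these two are measurable. *)
Lemma integral_ae_le_nonmeasurable_left f g : measurable_fun setT g ->
  (forall w, 0 <= f w) -> (forall w, 0 <= g w) ->
  {ae mu, forall w, f w <= g w} -> \int[mu]_w f w <= \int[mu]_w g w.
Proof.
move=> mg f0 g0 fg; rewrite [leLHS]ge0_integralTE//; apply: ub_ereal_sup => _ [h hf <-].
have -> : sintegral mu h = \int[mu]_w (h w)%:E by rewrite integral_nnsfun// patch_setT.
apply: ae_ge0_le_integral => //.
- by move=> w _; rewrite lee_fin; exact: fun_ge0.
- by apply/measurable_EFinP; exact: measurable_funTS.
- by apply: filterS fg => w fgw _; exact: le_trans (hf w) fgw.
Qed.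

End integral_monotone.

(** * Lower and upper limits of events *)

Section limit_sets.
Context {d : measure_display} {T : measurableType d} {R : realType}.
Variable P : probability T R.
Implicit Types (E : (set T)^nat) (c e : R).

Definition lim_inf_set (U : Type) (F : (set U)^nat) := \bigcup_N \bigcap_(m in [set m | (N
  <= m)%N]) F m.

Lemma lim_inf_setP (U : Type) (F : (set U)^nat) w :
  lim_inf_set F w <-> \forall m \near \oo, F m w.
Proof.
split; first by move=> [N _ h]; exists N => // m /= Nm; exact: h.
by move=> [N _ h]; exists N => // m /= Nm; exact: h.
Qed.

Lemma measurable_lim_inf_set E : (forall m, measurable (E m)) -> measurable (lim_inf_set E).
Proof.
move=> mE; apply: bigcupT_measurable => N; apply: bigcap_measurable => //.
by exists N => /=.
Qed.

Lemma measurable_lim_sup_set E : (forall m, measurable (E m)) -> measurable (lim_sup_set E).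
Proof.
move=> mE; apply: bigcap_measurable => // N _.
exact: bigcup_measurable.
Qed.

(** The intersection over m >= N lies in each of its members, so one good index beyond each N is
    enough; continuity from below does the rest. *)
Lemma lim_inf_set_le E c : (forall m, measurable (E m)) ->
  (forall N, exists2 m, (N <= m)%N & (P (E m) <= c%:E)%E) ->
  (P (lim_inf_set E) <= c%:E)%E.
Proof.
move=> mE h; pose F N := \bigcap_(m in [set m | (N <= m)%N]) E m.
have mF N : measurable (F N) by apply: bigcap_measurable => //; exists N => /=.
have cv : P \o F @ \oo --> P (lim_inf_set E).
  apply: nondecreasing_cvg_mu => //; first exact: bigcupT_measurable.
  move=> m n mn; apply/subsetPset => w hw k /= nk; apply: hw => /=.
  exact: leq_trans nk.
rewrite -(cvg_lim _ cv)//; apply: lime_le; first by apply/cvg_ex; eexists; exact: cv.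
apply: nearW => N /=; have [m Nm hm] := h N.
apply: le_trans hm; apply: le_measure; rewrite ?inE//.
by move=> w; apply.
Qed.

Lemma lim_sup_set_ge E e : (forall m, measurable (E m)) -> 0 < e ->
  \forall m \near \oo, (P (E m) <= P (lim_sup_set E) + e%:E)%E.
Proof.
move=> mE e0; pose F N := \bigcup_(m in [set m | (N <= m)%N]) E m.
have mF N : measurable (F N) by exact: bigcup_measurable.
have Pfin A : measurable A -> P A \is a fin_num by exact: fin_num_measure.
have cv : P \o F @ \oo --> P (lim_sup_set E).
  apply: lim_sup_set_cvg => //.
  by rewrite (le_lt_trans (probability_le1 _ _)) ?ltry//; exact: bigcup_measurable.
have mL := measurable_lim_sup_set mE.
have hlt : (P (lim_sup_set E) < P (lim_sup_set E) + e%:E)%E.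
  by rewrite lteDl ?Pfin// lte_fin.
have /cv : nbhs (P (lim_sup_set E)) [set x | (x < P (lim_sup_set E) + e%:E)%E].
  exact: open_ereal_lt'.
move=> [M _ hM]; exists M => // N MN; apply: ltW; apply: le_lt_trans (hM N MN).
apply: le_measure; rewrite ?inE//; by move=> w ew; exists N => /=.
Qed.

End limit_sets.

(** * Laws of the increments *)

Section increments.
Context {R : realType} {d : measure_display} {T : measurableType d} {P : probability T R}.
Variable X : R -> {RV P >-> R}.
Hypothesis X_levy : levy_process X.
Implicit Types (s t h l : R) (m n : nat) (B : set (measurableTypeR R)).

(** [X 0] is subtracted because it is 0 only almost surely. *)
Definition incr_prob h B : R := fine (P [set w | B (X h w - X 0 w)]).

Lemma measurable_increment s t B : measurable B ->
  measurable [set w | B (X t w - X s w)].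
Proof.
move=> mB; have mf : measurable_fun setT (fun w => X t w - X s w) by exact: measurable_funB.
by have := mf measurableT B mB; rewrite setTI.
Qed.

Lemma incr_prob_ge0 h B : 0 <= incr_prob h B.
Proof. by rewrite /incr_prob fine_ge0. Qed.

Lemma incr_probE s h B : 0 <= s -> 0 <= h -> measurable B ->
  P [set w | B (X (s + h) w - X s w)] = (incr_prob h B)%:E.
Proof.
move=> s0 h0 mB; rewrite (levy_stationary X_levy)// /incr_prob fineK//.
by apply: fin_num_measure; exact: measurable_increment.
Qed.

Lemma incr_prob_le1 h B : measurable B -> incr_prob h B <= 1.
Proof.
move=> mB; rewrite -lee_fin /incr_prob fineK; last first.
  by apply: fin_num_measure; exact: measurable_increment.
by apply: probability_le1; exact: measurable_increment.
Qed.

Lemma incr_probC h B : measurable B -> incr_prob h (~` B) = 1 - incr_prob h B.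
Proof.
move=> mB; have mI := measurable_increment 0 h mB.
rewrite /incr_prob.
rewrite (_ : [set w | (~` B) (X h w - X 0 w)] = ~` [set w | B (X h w - X 0 w)])//.
rewrite probability_setC// fineB// ?fin_num_measure//.
Qed.

Lemma increments_law s h m (B : 'I_m -> set (measurableTypeR R)) : 0 <= s -> 0 <= h ->
  (forall j, measurable (B j)) ->
  P [set w | forall j : 'I_m, B j (increment (X ^~ w) s h j)] =
  (\prod_(j < m) incr_prob h (B j))%:E.
Proof.
move=> s0 h0 mB.
have t0 : 0 <= s + 0%:R * h by rewrite mul0r addr0.
have tS i : s + i%:R * h <= s + i.+1%:R * h by rewrite lerD2l ler_wpM2r// ler_nat.
rewrite /increment (levy_independent X_levy (t := fun i => s + i%:R * h) t0 tS mB).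
rewrite -prodEFin; apply: eq_bigr => j _.
rewrite (_ : s + j.+1%:R * h = (s + j%:R * h) + h); last by rewrite -natr1; ring.
by apply: incr_probE => //; rewrite addr_ge0// mulr_ge0.
Qed.

Definition hit s l B m : set T :=
  [set w | exists2 j, (j < m)%N & B (increment (X ^~ w) s (l / m%:R) j)].

Lemma hitC s l B m :
  ~` hit s l B m = [set w | forall j : 'I_m, (~` B) (increment (X ^~ w) s (l / m%:R) j)].
Proof.
apply/seteqP; split => w /= h; first by move=> j Bj; apply: h; exists j.
by move=> [j jm Bj]; exact: (h (Ordinal jm)).
Qed.

Lemma measurable_hit s l B m : measurable B -> measurable (hit s l B m).
Proof.
move=> mB; rewrite -[hit _ _ _ _]setCK hitC; apply: measurableC.
rewrite (_ : [set w | _] = \bigcap_(j in [set: 'I_m])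
    [set w | (~` B) (increment (X ^~ w) s (l / m%:R) j)]).
  apply: fin_bigcap_measurable => [|j _]; first exact: finite_finset.
  by apply: measurable_increment; exact: measurableC.
by apply/seteqP; split => w /= h j => [_|]; exact: h.
Qed.

Lemma hit_law s l B m : 0 <= s -> 0 <= l -> measurable B ->
  P (hit s l B m) = (1 - (1 - incr_prob (l / m%:R) B) ^+ m)%:E.
Proof.
move=> s0 l0 mB; rewrite -[hit _ _ _ _]setCK probability_setC; last first.
  by apply: measurableC; exact: measurable_hit.
rewrite hitC (increments_law (B := fun=> ~` B))//; last 2 first.
- by rewrite divr_ge0.
- by move=> _; exact: measurableC.
by rewrite incr_probC// prodr_const card_ord.
Qed.

Lemma hit_le s l B m : 0 <= s -> 0 <= l -> measurable B ->
  (P (hit s l B m) <= (m%:R * incr_prob (l / m%:R) B)%:E)%E.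
Proof.
move=> s0 l0 mB; rewrite hit_law// lee_fin.
set p := incr_prob _ _.
have p0 : 0 <= p := incr_prob_ge0 _ _.
have p1 : p <= 1 := incr_prob_le1 _ mB.
elim: (m) => [|k IH]; first by rewrite expr0 mul0r subrr.
have q0 : 0 <= (1 - p) ^+ k by rewrite exprn_ge0// subr_ge0.
have q1 : (1 - p) ^+ k <= 1 by rewrite exprn_ile1 ?subr_ge0// gerBl.
rewrite exprS -natr1.
have : 0 <= p * (1 - (1 - p) ^+ k) by rewrite mulr_ge0// subr_ge0.
nra.
Qed.

(** With y = m p, it rests on (1 - p)^m (1 + y) <= 1. For short blocks y is small, and y / (1 + y)
    is close to the upper bound y of [hit_le]. *)
Lemma hit_ge s l B m : 0 <= s -> 0 <= l -> measurable B ->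
  (((m%:R * incr_prob (l / m%:R) B) / (1 + m%:R * incr_prob (l / m%:R) B))%:E <=
    P (hit s l B m))%E.
Proof.
move=> s0 l0 mB; rewrite hit_law// lee_fin.
set p := incr_prob _ _.
have p0 : 0 <= p := incr_prob_ge0 _ _.
have p1 : p <= 1 := incr_prob_le1 _ mB.
have y0 : 0 < 1 + m%:R * p by rewrite ltr_wpDr// mulr_ge0.
rewrite ler_pdivrMr//.
suff : (1 - p) ^+ m * (1 + m%:R * p) <= 1 by lra.
elim: (m) => [|k IH]; first by rewrite expr0 mul1r mul0r addr0.
apply: le_trans IH; rewrite exprS -mulrA [leLHS]mulrCA.
apply: ler_wpM2l; first by rewrite exprn_ge0// subr_ge0.
rewrite -natr1; have k0 : 0 <= k%:R :> R by [].
have : 0 <= k%:R * p ^+ 2 by rewrite mulr_ge0// sqr_ge0.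
have := sqr_ge0 p; nra.
Qed.

End increments.

(** * The measure nu as the intensity of the increments *)

Section jump_intensity.
Context {R : realType} {d : measure_display} {T : measurableType d} {P : probability T R}.
Variable X : R -> {RV P >-> R}.
Hypothesis X_levy : levy_process X.
Variable nu : {measure set (measurableTypeR R) -> \bar R}.
Hypothesis X_nu : has_levy_measure X nu.
Implicit Types (s t h l c r a : R) (m n N : nat) (B O : set (measurableTypeR R)).

Lemma counting_ge (J : set R) (s : seq R) : uniq s -> (forall x, x \in s -> J x) ->
  (((size s)%:R : R)%:E <= counting J :> \bar R)%E.
Proof.
move=> us sJ; rewrite /counting; case: asboolP => finJ; last by rewrite leey.
rewrite lee_fin ler_nat; apply: uniq_leq_size => // x /sJ Jx.
by rewrite in_fset_set// inE.
Qed.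

(** The blocks are disjoint and lie before time 1. One that is met along infinitely many meshes
    contains a jump in B, so the number of such blocks is at most the number of jumps, whose mean is
    nu B. *)
Lemma sum_lim_sup_hit l N B : 0 < l -> N%:R * l <= 1 -> closed B -> ~ B 0 ->
  measurable B ->
  (\sum_(k < N) P (lim_sup_set (hit X (k%:R * l) l B)) <= nu B)%E.
Proof.
move=> l0 Nl cB B0 mB.
have mA (k : 'I_N) : measurable (lim_sup_set (hit X (k%:R * l) l B)).
  by apply: measurable_lim_sup_set => m; exact: measurable_hit.
rewrite (X_nu mB).
have -> : B `\ (0 : R) = B.
  by apply/seteqP; split => x /=; [case|move=> Bx; split => // x0; apply: B0; rewrite -x0].
apply: (@le_trans _ _ (\int[P]_w (\sum_(k < N) (\1_(lim_sup_set (hit X (k%:R * l) l B))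
  w)%:E))%E).
  rewrite ge0_integral_sum//; last first.
    by move=> k; apply/measurable_EFinP; exact: measurable_indic.
  by apply: lee_sum => k _; rewrite integral_indic// setIT.
apply: integral_ae_le_nonmeasurable_right.
- by apply: emeasurable_sum => k; apply/measurable_EFinP; exact: measurable_indic.
- by move=> w; apply: sume_ge0 => k _; rewrite lee_fin.
- move=> w; rewrite /counting; case: ifP => _; rewrite ?lee_fin ?leey//.
apply: filterS (levy_cadlag X_levy) => w cw.
pose K := [seq k : 'I_N <- enum 'I_N | w \in lim_sup_set (hit X (k%:R * l) l B)].
have K_time (k : 'I_N) : exists s, k \in K -> k%:R * l < s <= k%:R * l + l /\ B (jump (X ^~
  w) s).
  have [kK|kK] := boolP (k \in K); last by exists 0.
  move: kK; rewrite mem_filter => /andP[/set_mem hw _].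
  have [|||||s hs Bs] := @mesh_increment_jump R (X ^~ w) cw (k%:R * l) l B => //.
  - by rewrite mulr_ge0// ltW.
  - by move=> M; have [m Mm hm] := hw M I; exists m.
  by exists s.
have [f hf] := choice K_time.
have step (k : 'I_N) : k%:R * l + l = 0 + k.+1%:R * l by rewrite -natr1; ring.
apply: (@le_trans _ _ ((size (map f K))%:R : R)%:E).
  rewrite size_map sumEFin lee_fin size_filter -sum1_count natr_sum [leRHS]big_mkcond /=.
  rewrite [leRHS]big_enum /=.
  apply: ler_sum => k _; rewrite indicE; by case: ifP.
apply: counting_ge; last first.
  move=> _ /mapP[k kK ->]; have [/andP[h1 h2] h3] := hf k kK; split => //.
    by rewrite (le_lt_trans _ h1)// mulr_ge0// ltW.
  rewrite (le_trans h2)// (le_trans _ Nl)// step add0r ler_pM2r// ler_nat.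
  exact: ltn_ord.
have uK : uniq K by exact: filter_uniq (enum_uniq _).
rewrite map_inj_in_uniq// => k k' kK k'K ff.
have [h1 _] := hf k kK; have [h2 _] := hf k' k'K.
rewrite -ff in h2; rewrite step -[k%:R * l]add0r in h1; rewrite step -[k'%:R * l]add0r in h2.
exact/val_inj/(mesh_index_inj l0 h1 h2).
Qed.

(* A block of [m] increments over a time [t / n] meets [B] with probability close
   to [m * incr_prob], and the expected number of such blocks before time 1 is at
   most [nu B]. *)
Lemma incr_prob_le t c r B : 0 < t -> closed B -> ~ B 0 -> measurable B ->
  nu B = r%:E -> t * r < c ->
  \forall n \near \oo, \forall m \near \oo,
    (n * m)%:R * incr_prob X (t / (n * m)%:R) B <= c.
Proof.
move=> t0 cB B0 mB nuB trc.
have r0 : 0 <= r by rewrite -lee_fin -nuB.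
have [e e0 he] : exists2 e, 0 < e & t * (r + e) < c.
  exists ((c - t * r) / (2 * t)); first by rewrite divr_gt0 ?subr_gt0// mulr_gt0.
  have -> : t * (r + (c - t * r) / (2 * t)) = (t * r + c) / 2.
    by field; rewrite gt_eqF.
  lra.
set r' := r + e in he; have r'0 : 0 < r' by rewrite /r'; lra.
have ct : 0 < c / t - r' by rewrite subr_gt0 ltr_pdivlMr// mulrC.
near=> n.
have n0 : 0 < n%:R :> R by rewrite ltr0n; near: n; exact: nbhs_infty_gt.
set l := t / n%:R; have l0 : 0 < l by rewrite divr_gt0.
(* The number of whole blocks of length l before time 1. *)
set N := Num.truncn (n%:R / t).
have /andP[N1 N2] : N%:R <= n%:R / t < N.+1%:R.
  by apply: truncn_itv; rewrite divr_ge0// ltW.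
have Nl : N%:R * l <= 1.
  by rewrite /l mulrA ler_pdivrMr// mul1r -ler_pdivlMr.
(* Together with N + 1 > n / t, this gives n r' <= c (N - r'), to be combined with the bound y (N -
   r') <= r' for one block. *)
have nbig : c * (1 + r') <= n%:R * (c / t - r').
  rewrite -ler_pdivrMr//; near: n; exact: nbhs_infty_ger.
have rn : r' < N%:R.
  have c0 : 0 < c by rewrite (le_lt_trans _ he)// mulr_ge0// ltW.
  rewrite -natr1 in N2.
  have : c * (1 + r') <= n%:R * (c / t) - n%:R * r' by lra.
  have : 0 < n%:R * r' by rewrite mulr_gt0.
  have -> : n%:R * (c / t) = c * (n%:R / t) by ring.
  move=> h1 h2; have : c * (1 + r') < c * (n%:R / t) by lra.
  rewrite ltr_pM2l//; lra.
have := sum_lim_sup_hit l0 Nl cB B0 mB; rewrite nuB.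
set A := fun k : nat => lim_sup_set (hit X (k%:R * l) l B) => sumA.
have mA k : measurable (A k).
  by apply: measurable_lim_sup_set => m; exact: measurable_hit.
have eN : 0 < e / N%:R by rewrite divr_gt0// (lt_trans r'0).
have : \forall m \near \oo, forall k, k \in iota 0 N ->
    (P (hit X (k%:R * l) l B m) <= P (A k) + (e / N%:R)%:E)%E.
  apply: near_all_seq => k _; apply: lim_sup_set_ge => // m.
  exact: measurable_hit.
apply: filterS => m hm.
set y := m%:R * incr_prob X (l / m%:R) B.
have y0 : 0 <= y by rewrite mulr_ge0// incr_prob_ge0.
have hy : N%:R * (y / (1 + y)) <= r'.
  rewrite -lee_fin /r' EFinD; apply: le_trans (leeD2r e%:E sumA).
  have -> : e%:E = (\sum_(k < N) (e / N%:R)%:E)%E.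
    rewrite sumEFin sumr_const card_ord -(mulr_natr (e / _)) divfK//.
    by rewrite gt_eqF// (lt_trans r'0).
  rewrite -big_split /=.
  have -> : (N%:R * (y / (1 + y)))%:E = (\sum_(k < N) (y / (1 + y))%:E)%E.
    by rewrite sumEFin sumr_const card_ord -(mulr_natl (y / _)).
  apply: lee_sum => k _; apply: le_trans (hm k _); last by rewrite mem_iota ltn_ord.
  by apply: hit_ge => //; [rewrite mulr_ge0// ltW|rewrite ltW].
have -> : (n * m)%:R * incr_prob X (t / (n * m)%:R) B = n%:R * y.
  have -> : t / (n * m)%:R = t / n%:R / m%:R by rewrite natrM invfM mulrA.
  by rewrite natrM -mulrA.
have hy' : y * (N%:R - r') <= r'.
  have y1 : 0 < 1 + y by lra.
  by move: hy; rewrite mulrA ler_pdivrMr//; lra.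
have hn : n%:R * r' <= c * (N%:R - r').
  rewrite -natr1 in N2; have c0 : 0 < c by rewrite (le_lt_trans _ he)// mulr_ge0// ltW.
  have : c * (n%:R / t) <= c * (N%:R + 1) by rewrite ler_pM2l// ltW.
  have -> : c * (n%:R / t) = n%:R * (c / t) by ring.
  lra.
have Nr : 0 < N%:R - r' by lra.
rewrite -(ler_pM2r Nr) -mulrA; apply: le_trans hn.
by rewrite ler_pM2l.
Unshelve. all: by end_near. Qed.

(** [D n] counts the blocks in which all fine meshes meet O. Once the blocks are shorter than the
    distance between large jumps, every jump in O before time 1 has a block of its own, and Fatou's
    lemma bounds nu O by the lower limit of the means of [D n]. If the conclusion failed for a large
    n, each block would have probability at most c / n, which is too little for about n / t
    blocks. *)
Lemma incr_prob_ge t c r a O : 0 < t -> open O -> measurable O -> 0 < a ->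
  (forall y, O y -> a < `|y|) -> nu O = r%:E -> c < t * r ->
  \forall n \near \oo, \forall m \near \oo,
    c <= (n * m)%:R * incr_prob X (t / (n * m)%:R) O.
Proof.
move=> t0 oO mO a0 Oa nuO ctr.
pose h n := t / n%:R : R.
(* One block more than the integer part, so that the blocks cover the times up to 1. *)
pose N n := (Num.truncn (n%:R / t)).+1.
pose L n (k : nat) := lim_inf_set (hit X (k%:R * h n) (h n) O).
have mL n k : measurable (L n k).
  by apply: measurable_lim_inf_set => m; exact: measurable_hit.
pose D n w : \bar R := (\sum_(k < N n) (\1_(L n k) w)%:E)%E.
have mD n : measurable_fun setT (D n).
  by apply: emeasurable_sum => k; apply/measurable_EFinP; exact: measurable_indic.
have D0 n w : (0 <= D n w)%E by apply: sume_ge0 => k _; rewrite lee_fin.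
have intD n : (\int[P]_w D n w = \sum_(k < N n) P (L n k))%E.
  rewrite ge0_integral_sum//; last first.
    by move=> k; apply/measurable_EFinP; exact: measurable_indic.
  by apply: eq_bigr => k _; rewrite integral_indic// setIT.
have rD : (r%:E <= limn_einf (fun n => \int[P]_w D n w))%E.
  apply: le_trans (fatou P measurableT mD (fun n w _ => D0 n w)).
  rewrite -nuO (X_nu mO).
  have -> : O `\ (0 : R) = O.
    apply/seteqP; split => y /=; [by case|move=> Oy; split => // y0].
    by have := Oa y Oy; rewrite y0 normr0 ltNge (ltW a0).
  have mlim : measurable_fun setT (fun w => limn_einf (D ^~ w)).
    apply: measurableT_comp => //; apply: measurable_fun_limn_esup => n.
    exact: measurableT_comp.
  apply: integral_ae_le_nonmeasurable_left => //.
    move=> w; rewrite limn_einf_lim; apply: lime_ge; first exact: is_cvg_einfs.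
    by apply: nearW => n; apply: le_ereal_inf_tmp => _ [k _ <-].
  apply: filterS (levy_cadlag X_levy) => w cw.
  pose J := jump_times (X ^~ w) 1 O.
  have finJ : finite_set J by apply: (@finite_large_jumps R (X ^~ w) cw 1 a O).
  have [e e0 he] := large_jumps_apart cw 1 a0.
  have cD : \forall n \near \oo, (counting J <= D n w)%E.
    near=> n.
    have n0 : 0 < n%:R :> R by rewrite ltr0n; near: n; exact: nbhs_infty_gt.
    have h0 : 0 < h n by rewrite divr_gt0.
    have hn : h n < e by near: n; exact: near_div.
    have /andP[_ N2] : (Num.truncn (n%:R / t))%:R <= n%:R / t < (N n)%:R.
      by apply: truncn_itv; rewrite divr_ge0// ltW.
    have Nh : 1 <= (N n)%:R * h n.
      by rewrite /h mulrA ler_pdivlMr// mul1r -ler_pdivrMr// ltW.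
    have idx s : exists k : 'I_(N n), J s -> 0 + k%:R * h n < s <= 0 + k.+1%:R * h n.
      have [Js|nJs] := pselect (J s); last by exists ord0.
      case: Js => s0 s1 _; have [|k kN hk] := @mesh_index R (N n) (h n) 0 s h0.
        by rewrite s0 add0r (le_trans s1).
      by exists (Ordinal kN).
    have [f hf] := choice idx.
    have step (k : nat) : 0 + k.+1%:R * h n = k%:R * h n + h n by rewrite -natr1; ring.
    have urf : uniq (map f (fset_set J)).
      rewrite map_inj_in_uniq ?fset_uniq// => s s'.
      rewrite !in_fset_set// !inE => Js Js' fss'.
      have := hf s Js; have := hf s' Js'; rewrite -fss' step add0r.
      case: Js => s0 st As; case: Js' => s'0 s't As' /andP[u1 u2] /andP[u3 u4].
      apply: he; [by rewrite s0|by rewrite s'0|exact: Oa|exact: Oa|].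
      by rewrite (le_lt_trans _ hn)// ler_distl; apply/andP; split; lra.
    rewrite /counting asboolT//.
    apply: (@le_trans _ _ (\sum_(k <- map f (fset_set J)) (\1_(L n k) w)%:E)%E).
      rewrite big_map /=.
      rewrite (eq_big_seq (fun=> 1%E)); last first.
        move=> s; rewrite in_fset_set// inE => Js; have := hf s Js; rewrite step add0r => fs.
        rewrite indicE mem_set//; apply/lim_inf_setP.
        case: Js => s0 st Os.
        by apply: (jump_mesh_increment cw _ h0 oO fs Os); rewrite mulr_ge0// ltW.
      by rewrite sumEFin big_const_seq count_predT iter_addr_0 /=.
    rewrite (big_uniq _ urf) /= /D big_mkcond /=; apply: lee_sum => k _.
    by case: ifP => // _; rewrite lee_fin.
  rewrite limn_einf_lim; apply: lime_ge; first exact: is_cvg_einfs.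
  move: cD => [M _ hM]; exists M => // n Mn /=.
  by apply: le_ereal_inf_tmp => _ [k /= nk <-]; apply: hM => /=; exact: leq_trans nk.
(* Halfway between c / t and r, to leave room for the cost c / n of the extra block. *)
pose r2 := (c / t + r) / 2.
have cr : c / t < r by rewrite ltr_pdivrMr// mulrC.
have r2r : r2 < r by rewrite /r2; lra.
have hn : \forall n \near \oo, (r2%:E < \int[P]_w D n w)%E.
  move: rD; rewrite limn_einf_lim => rD.
  have rD' : (r2%:E < limn (einfs (fun n => \int[P]_w D n w)))%E.
    by rewrite (lt_le_trans _ rD)// lte_fin.
  have cv := @is_cvg_einfs R (fun n => \int[P]_w D n w)%E.
  have /cv [M _ hM] : nbhs (limn (einfs (fun n => \int[P]_w D n w)%E)) [set x | (r2%:E < x)%E].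
    exact: open_ereal_gt'.
  exists M => // n Mn /=; apply: (lt_le_trans (hM n Mn)).
  by apply: ereal_inf_lbound; exists n => /=.
near=> n.
have n0 : 0 < n%:R :> R by rewrite ltr0n; near: n; exact: nbhs_infty_gt.
have h0 : 0 < h n by rewrite divr_gt0.
have rn : (r2%:E < \int[P]_w D n w)%E by near: n.
have nbig : (c / t + c / n%:R < r2)%R.
  near: n; have cr2 : 0 < r2 - c / t by rewrite /r2; lra.
  have := @near_div R c _ cr2; apply: filterS => n; lra.
apply: contrapT => H.
have H' M : exists2 m, (M <= m)%N & (n * m)%:R * incr_prob X (t / (n * m)%:R) O < c.
  apply: contrapT => nM; apply: H; exists M => // m Mm /=.
  by rewrite leNgt; apply/negP => lt_c; apply: nM; exists m.
have PL k : (P (L n k) <= (c / n%:R)%:E)%E.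
  apply: lim_inf_set_le => [m|M]; first exact: measurable_hit.
  have [m Mm hm] := H' M; exists m => //.
  have kh : 0 <= k%:R * h n by rewrite mulr_ge0// ltW.
  apply: (le_trans (hit_le X_levy m kh (ltW h0) mO)).
  rewrite lee_fin ler_pdivlMr// mulrC mulrA -natrM ltW//.
  rewrite (_ : h n / m%:R = t / (n * m)%:R)//.
  by rewrite natrM invfM mulrA.
have c0 : 0 <= c.
  have [m _ hm] := H' 0%N; apply: ltW; apply: le_lt_trans hm.
  by rewrite mulr_ge0// incr_prob_ge0.
have : (\int[P]_w D n w <= ((N n)%:R * (c / n%:R))%:E)%E.
  rewrite intD (@le_trans _ _ (\sum_(k < N n) (c / n%:R)%:E)%E)//.
    by apply: lee_sum => k _; exact: PL.
  by rewrite sumEFin sumr_const card_ord -(mulr_natl (c / _)).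
apply/negP; rewrite -ltNge (le_lt_trans _ rn)// lee_fin.
have /andP[N1 _] : (Num.truncn (n%:R / t))%:R <= n%:R / t < (N n)%:R.
  by apply: truncn_itv; rewrite divr_ge0// ltW.
apply: (@le_trans _ _ ((n%:R / t + 1) * (c / n%:R))).
  by rewrite ler_wpM2r ?divr_ge0// /N -natr1 lerD2r.
have -> : (n%:R / t + 1) * (c / n%:R) = c / t + c / n%:R.
  by field; rewrite !gt_eqF.
exact: ltW.
Unshelve. all: by end_near. Qed.

End jump_intensity.

(** * Riemann sums of powers *)

Section power_sums.
Context {R : realType}.
Implicit Types (s r a b e al : R).

(** Young's inequality for the product of s^r and 1, with the conjugate exponents 1 / r and 1 / (1 -
    r). *)
Lemma powR_le_tangent s r : 0 <= s -> 0 < r < 1 -> s `^ r <= r * s + (1 - r).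
Proof.
move=> s0 /andP[r0 r1].
have r1' : 0 < 1 - r by rewrite subr_gt0.
have := @conjugate_powR R (s `^ r) 1 r^-1 (1 - r)^-1.
rewrite powR_ge0 ler01 !invr_gt0 r0 r1' !invrK powR1 -powRrM mulfV ?gt_eqF// powRr1//.
rewrite mulr1 mul1r mulrC => /(_ isT isT isT isT); apply; ring.
Qed.

(** The concave case at s^r with exponent 1 / r. *)
Lemma powR_ge_tangent s r : 0 <= s -> 1 < r -> r * s - (r - 1) <= s `^ r.
Proof.
move=> s0 r1; have r0 : 0 < r by exact: lt_trans r1.
have ri : 0 < r^-1 < 1 by rewrite invr_gt0 r0 invf_lt1.
have := @powR_le_tangent (s `^ r) r^-1 (powR_ge0 _ _) ri.
rewrite -powRrM mulfV ?gt_eqF// powRr1//.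
rewrite -(ler_pM2l r0); have -> : r * (r^-1 * s `^ r + (1 - r^-1)) = s `^ r + (r - 1).
  by field; rewrite gt_eqF.
by rewrite lerBlDr.
Qed.

Lemma powR_div a b r : 0 <= b -> 0 < a -> (b / a) `^ r = b `^ r / a `^ r.
Proof.
move=> b0 a0; rewrite powRM ?invr_ge0 ?(ltW a0)//; congr (_ * _).
by rewrite -powR_inv1 ?(ltW a0)// -powRrM mulN1r powRN.
Qed.

Lemma powR_pred a r : 0 < a -> a `^ (r - 1) = a `^ r / a.
Proof. by move=> a0; rewrite powRB ?(gt_eqF a0) ?implybT// powRr1// ltW. Qed.

(** The right side is the integral of x^(-al) from b to a, and the left side the rectangle at its
    minimum; the tangent inequality at b / a replaces calculus. *)
Lemma powR_step_concave a b al : 0 < al < 1 -> 0 <= b < a ->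
  (a - b) * a `^ (- al) <= (a `^ (1 - al) - b `^ (1 - al)) / (1 - al).
Proof.
move=> /andP[al0 al1] /andP[b0 ba]; have a0 : 0 < a by exact: le_lt_trans ba.
have r0 : 0 < 1 - al by rewrite subr_gt0.
have ri : 0 < 1 - al < 1 by rewrite r0 gtrBl.
have := @powR_le_tangent (b / a) (1 - al) (divr_ge0 b0 (ltW a0)) ri.
rewrite powR_div//.
have A0 : 0 < a `^ (1 - al) by rewrite powR_gt0.
rewrite ler_pdivrMr// => h; rewrite ler_pdivlMr//.
have -> : a `^ (- al) = a `^ (1 - al) / a by rewrite -powR_pred//; congr (_ `^ _); ring.
have -> : (a - b) * (a `^ (1 - al) / a) * (1 - al) =
  a `^ (1 - al) - ((1 - al) * (b / a) + (1 - (1 - al))) * a `^ (1 - al).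
  by field; rewrite gt_eqF.
by lra.
Qed.

Lemma powR_step_convex a b al : 0 < al < 1 -> 0 < a -> 0 <= b ->
  (b - a) * a `^ (1 - al) <= (b `^ (2 - al) - a `^ (2 - al)) / (2 - al).
Proof.
move=> /andP[al0 al1] a0 b0.
have r1 : 1 < 2 - al by lra.
have r0 : 0 < 2 - al by lra.
have := @powR_ge_tangent (b / a) (2 - al) (divr_ge0 b0 (ltW a0)) r1.
rewrite powR_div//.
have A0 : 0 < a `^ (2 - al) by rewrite powR_gt0.
rewrite ler_pdivlMr// => h; rewrite ler_pdivlMr//.
have -> : a `^ (1 - al) = a `^ (2 - al) / a by rewrite -powR_pred//; congr (_ `^ _); ring.
have -> : (b - a) * (a `^ (2 - al) / a) * (2 - al) =
  ((2 - al) * (b / a) - (2 - al - 1)) * a `^ (2 - al) - a `^ (2 - al).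
  by field; rewrite gt_eqF.
by lra.
Qed.

Lemma sum_powR_concave e al (k : nat) : 0 < al < 1 -> 0 < e ->
  \sum_(1 <= i < k.+1) e * (i%:R * e) `^ (- al) <= (k%:R * e) `^ (1 - al) / (1 - al).
Proof.
move=> al01 e0; have /andP[al0 al1] := al01.
elim: k => [|k IH]; first by rewrite big_geq// mul0r powR0 ?mul0r// gt_eqF ?subr_gt0.
rewrite big_nat_recr//=; apply: le_trans (lerD IH (lexx _)) _.
have := @powR_step_concave (k.+1%:R * e) (k%:R * e) al al01.
have -> : k.+1%:R * e - k%:R * e = e by rewrite -natr1; ring.
rewrite mulr_ge0 ?ltr_pM2r ?ltr_nat ?leqnn ?(ltW e0)// => /(_ isT).
rewrite mulrBl; lra.
Qed.

(** As x^(1 - al) increases, values at right ends exceed the integral. Read as values at left ends,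
    all terms but the last fit below it, and the last one stays as an error. *)
Lemma sum_powR_convex e al (k : nat) : 0 < al < 1 -> 0 < e ->
  \sum_(1 <= i < k.+1) e * (i%:R * e) `^ (1 - al) <=
  (k%:R * e) `^ (2 - al) / (2 - al) + e * (k%:R * e) `^ (1 - al).
Proof.
move=> al01 e0; have /andP[al0 al1] := al01.
have a2 : 0 < 2 - al by lra.
case: k => [|k].
  by rewrite big_geq// addr_ge0// mulr_ge0 ?powR_ge0 ?invr_ge0 ?(ltW a2) ?(ltW e0).
rewrite big_nat_recr//= lerD2r.
elim: k => [|k IH]; first by rewrite big_geq// divr_ge0 ?powR_ge0// ltW.
rewrite big_nat_recr//=; apply: le_trans (lerD IH (lexx _)) _.
have k0 : 0 < k.+1%:R * e by rewrite mulr_gt0.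
have := @powR_step_convex (k.+1%:R * e) (k.+2%:R * e) al al01 k0.
have -> : k.+2%:R * e - k.+1%:R * e = e by rewrite -[k.+2%:R]natr1; ring.
rewrite mulr_ge0 ?(ltW e0)// => /(_ isT).
rewrite mulrBl; lra.
Qed.

End power_sums.

(** * Measure of intervals away from 0 *)

Section density.
Context {R : realType}.
Variables (nu : {measure set (measurableTypeR R) -> \bar R}) (f : R -> R).
Hypothesis nu_f : has_density nu f.
Variables (M al : R).
Hypotheses (M0 : 0 < M) (al0 : 0 < al) (fM : L_class M al f).
Implicit Types (a b : R).

Lemma density_cell a b (A : set (measurableTypeR R)) : measurable A ->
  0 < a <= b -> b <= 2 ->
  (lebesgue_measure A <= (b - a)%:E)%E -> (forall y, A y -> a <= `|y| <= b) ->
  (nu A <= ((b - a) * (M * a `^ (- (1 + al))))%:E)%E.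
Proof.
move=> mA /andP[a0 ab] b2 lA Aab; have [mf f0 nuE] := nu_f.
rewrite nuE//.
pose c := M * a `^ (- (1 + al)).
have c0 : 0 <= c by rewrite mulr_ge0 ?powR_ge0// ltW.
apply: (@le_trans _ _ (\int[lebesgue_measure]_(x in A) (cst c%:E) x)%E).
  apply: ge0_le_integral => //.
  - by move=> y _; rewrite lee_fin.
  - by apply/measurable_EFinP; exact: measurable_funTS.
  move=> y /Aab /andP[ay yb]; rewrite lee_fin.
  have y0 : 0 < `|y| by exact: lt_le_trans ay.
  apply: le_trans (fM _) _; first by rewrite y0 (le_trans yb).
  rewrite ler_pM2l// !powRN lef_pV2 ?posrE ?powR_gt0//.
  apply: ge0_ler_powR => //; rewrite ?nnegrE ?(ltW a0) ?(ltW y0)//.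
  by rewrite addr_ge0// ltW.
rewrite integral_cst// -/c mulrC (EFinM c); apply: lee_wpmul2l => //.
Qed.

Lemma density_itvcc a b : 0 < a <= b -> b <= 2 ->
  (nu `[a, b]%classic <= ((b - a) * (M * a `^ (- (1 + al))))%:E)%E.
Proof.
move=> /andP[a0 ab] b2; apply: density_cell; rewrite ?a0//.
- have := lebesgue_measure_itv `[a, b]; move=> /= ->.
  by case: ifP; rewrite ?lee_fin ?subr_ge0.
- by move=> y /=; rewrite in_itv /= => /andP[ay yb];
  rewrite ger0_norm ?ay ?yb// (le_trans (ltW a0)).
Qed.

Lemma density_itvccN a b : 0 < a <= b -> b <= 2 ->
  (nu `[(- b)%R, (- a)%R]%classic <= ((b - a) * (M * a `^ (- (1 + al))))%:E)%E.
Proof.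
move=> /andP[a0 ab] b2; apply: density_cell; rewrite ?a0//.
- have := lebesgue_measure_itv `[- b, - a]; move=> /= ->.
  case: ifP; rewrite ?lee_fin ?subr_ge0 ?ab// => _.
  by rewrite opprK addrC.
- move=> y /=; rewrite in_itv /= => /andP[by_ ya].
  have y0 : (y : R) <= 0 by apply: (le_trans ya); rewrite oppr_le0 ltW.
  by rewrite ler0_norm//; apply/andP; split; [rewrite lerNr|rewrite lerNl].
Qed.

Lemma density_fin_num (A : set (measurableTypeR R)) a b : measurable A -> 0 < a <= b -> b
  <= 2 ->
  (forall y, A y -> a <= `|y| <= b) -> nu A \is a fin_num.
Proof.
move=> mA ab b2 Aab; rewrite ge0_fin_numE//.
apply: (@le_lt_trans _ _ (nu (`[a, b]%classic `|` `[(- b)%R, (- a)%R]%classic))).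
  apply: le_measure; rewrite ?inE//; first exact: measurableU.
  move=> y /Aab /andP[ay yb]; rewrite /= !in_itv /=.
  have [y0|y0] := leP 0 y; [left|right]; move: ay yb.
    by rewrite ger0_norm// => -> ->.
  by rewrite ltr0_norm// lerNr lerNl => -> ->.
apply: le_lt_trans (measureU2 _ _ _) _ => //.
apply: lte_add_pinfty; [apply: le_lt_trans (density_itvcc ab b2) _|
  apply: le_lt_trans (density_itvccN ab b2) _]; exact: ltry.
Qed.

Lemma density_symmetric (A : set (measurableTypeR R)) : symmetric_fun f -> measurable A ->
  nu ((-%R : measurableTypeR R -> measurableTypeR R) @^-1` A) = nu A.
Proof.
move=> fsym mA; have [mf f0 nuE] := nu_f.
have mN : measurable_fun setT (-%R : measurableTypeR R -> measurableTypeR R).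
  exact: oppr_measurable.
have mNA : measurable ((-%R : measurableTypeR R -> measurableTypeR R) @^-1` A).
  by rewrite -[X in measurable X]setTI; exact: mN.
rewrite !nuE//.
transitivity (\int[pushforward lebesgue_measure (-%R : measurableTypeR R -> measurableTypeR
  R)]_(x in A) (f x)%:E)%E.
  rewrite ge0_integral_pushforward//; last 2 first.
  - by apply/measurable_EFinP; exact: measurable_funTS.
  - by move=> y _; rewrite lee_fin.
  by apply: eq_integral => y _ /=; rewrite fsym.
by apply: eq_measure_integral => B mB _; exact: lebesgue_measureN.
Qed.

End density.

(** * Tail bound for the values on the grid *)

Section cells_tail.
Context {R : realType}.
Variables (t M al eps th : R) (n m : nat) (p : option (bool * 'I_n.+2) -> R).
Let d : R := eps / n.+1%:R.
Hypotheses (t0 : 0 < t) (M0 : 0 < M) (al01 : 0 < al < 1) (eps0 : 0 < eps).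
Hypotheses (th0 : 0 < th <= 1 / 200) (d_th : d <= eps * th / 4).
Hypotheses (p_ge0 : forall a, 0 <= p a) (p_sum1 : \sum_a p a = 1).
Hypothesis p_cell0 : forall b, p (Some (b, ord0)) = 0.
Hypothesis p_cell : forall b (i : 'I_n.+2), (0 < i)%N ->
  m%:R * p (Some (b, i)) <= t * M * (d * (i%:R * d) `^ (- (1 + al))).

(** [None] is the value 0. The other values are the ends of the cells nearest to 0, with [b] for a
    minus sign. For step d the last one is (n + 1) d = eps, whose cell leaves room for increments
    slightly above eps. *)
Definition cell_value (step : R) (a : option (bool * 'I_n.+2)) : R :=
  if a is Some (b, i) then (-1) ^+ b * (i%:R * step) else 0.

Local Notation x := (cell_value d).
Let big a := eps / 2 < `|x a|.

Let d0 : 0 < d. Proof. by rewrite divr_gt0. Qed.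

Lemma norm_cell_value b i : `|x (Some (b, i))| = i%:R * d.
Proof. by rewrite /= normrM normr_sign mul1r ger0_norm// mulr_ge0// ltW. Qed.

Lemma sum_cells (F : option (bool * 'I_n.+2) -> R) :
  \sum_a F a = F None + \sum_(b : bool) \sum_(i < n.+2) F (Some (b, i)).
Proof.
rewrite (bigD1 None) //=; congr (_ + _).
rewrite pair_big /= (reindex_omap (fun a : bool * 'I_n.+2 => Some a) id) /=; last by case.
by apply: eq_big => [[b i]|[b i] _] //=; rewrite eqxx.
Qed.

(** Common frame of the three moment bounds: G gives the terms of a Riemann sum over one half-line,
    and the factor 2 stands for the two signs. *)
Lemma sum_cells_le (F : option (bool * 'I_n.+2) -> R) (G : nat -> R) (c : R) (k : nat) :
  (k <= n.+1)%N -> F None = 0 ->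
  (forall b (i : 'I_n.+2), (0 < i <= k)%N -> m%:R * (p (Some (b, i)) * F (Some (b, i))) <=
    t * M * G i) ->
  (forall b (i : 'I_n.+2), (k < i)%N -> F (Some (b, i)) = 0) ->
  \sum_(1 <= i < k.+1) G i <= c ->
  m%:R * mean_law p F <= 2 * (t * M) * c.
Proof.
move=> kn F0 FG Fk Gc; have tM : 0 < t * M by rewrite mulr_gt0.
rewrite /mean_law sum_cells F0 mulr0 add0r.
have H b : m%:R * \sum_(i < n.+2) p (Some (b, i)) * F (Some (b, i)) <= t * M * c.
  apply: (@le_trans _ _ (t * M * \sum_(1 <= i < k.+1) G i)); last by rewrite ler_pM2l.
  rewrite !mulr_sumr.
  rewrite big_ord_recl p_cell0 mul0r mulr0 add0r.
  rewrite (big_addn 0 k.+1 1) subn1 /= big_mkord.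
  rewrite (big_ord_widen n.+1 (fun i => t * M * G (i + 1)%N) kn) big_mkcond /=
    [leRHS]big_mkcond /=.
  apply: ler_sum => i _; case: ifPn => ik.
    by rewrite addn1; apply: (FG b (lift ord0 i)).
  by rewrite Fk ?mulr0// lift0 ltnS leqNgt.
rewrite big_bool /= mulrDr.
by have := H true; have := H false; lra.
Qed.

Lemma mean_norm_cells :
  m%:R * mean_law p (fun a => `|x a|) <= 2 * (t * M) * (eps `^ (1 - al) / (1 - al)).
Proof.
apply: (@sum_cells_le _ (fun i => d * (i%:R * d) `^ (- al)) _ n.+1) => //.
- by rewrite /= normr0.
- move=> b i /andP[i0 _]; rewrite norm_cell_value.
  have id0 : 0 < i%:R * d by rewrite mulr_gt0// ltr0n.
  rewrite mulrA; apply: le_trans (ler_wpM2r (ltW id0) (p_cell b i0)) _.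
  have -> : - (1 + al) = - al - 1 by ring.
  by rewrite -!mulrA !ler_pM2l// powR_pred// divfK// gt_eqF.
- by move=> b i; rewrite ltnNge -ltnS ltn_ord.
- have -> : eps = n.+1%:R * d by rewrite /d mulrC divfK.
  exact: sum_powR_concave.
Qed.

Lemma small_index (i : nat) : (i%:R * d <= eps / 2) = (i <= n.+1./2)%N.
Proof.
rewrite /d mulrA ler_pdivrMr ?ltr0n// mulrC -mulrA ler_pM2l//.
by rewrite mulrC ler_pdivlMr// -natrM ler_nat muln2 geq_half_double.
Qed.

Lemma half_le : n.+1./2%:R * d <= eps / 2.
Proof. by rewrite small_index. Qed.

Lemma mean_small_norm_cells :
  m%:R * mean_law p (fun a => if big a then 0 else `|x a|)
  <= 2 * (t * M) * ((eps / 2) `^ (1 - al) / (1 - al)).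
Proof.
have /andP[al0 al1] := al01; have r0 : 0 < 1 - al by rewrite subr_gt0.
apply: (@sum_cells_le _ (fun i => d * (i%:R * d) `^ (- al)) _ n.+1./2) => //.
- by rewrite -[leqRHS]doubleK half_leq// -addnn leq_addr.
- by rewrite /= normr0 if_same.
- move=> b i /andP[i0 ik]; rewrite /big norm_cell_value ltNge small_index ik /=.
  have id0 : 0 < i%:R * d by rewrite mulr_gt0// ltr0n.
  rewrite mulrA; apply: le_trans (ler_wpM2r (ltW id0) (p_cell b i0)) _.
  have -> : - (1 + al) = - al - 1 by ring.
  by rewrite -!mulrA !ler_pM2l// powR_pred// divfK// gt_eqF.
- by move=> b i ki; rewrite /big norm_cell_value ltNge small_index leqNgt ki.
- apply: le_trans (sum_powR_concave _ al01 d0) _.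
  have e2 : 0 < eps / 2 by rewrite divr_gt0.
  have kd0 : 0 <= n.+1./2%:R * d by rewrite mulr_ge0// ltW.
  by rewrite ler_pM2r ?invr_gt0// ge0_ler_powR ?nnegrE ?half_le ?(ltW r0) ?(ltW e2).
Qed.

Lemma mean_small_sqr_cells :
  m%:R * mean_law p (fun a => if big a then 0 else x a ^+ 2)
  <= 2 * (t * M) * ((1 + th) * ((eps / 2) `^ (2 - al) / (2 - al))).
Proof.
have /andP[al0 al1] := al01; have r0 : 0 < 1 - al by rewrite subr_gt0.
have r2 : 0 < 2 - al by lra.
apply: (@sum_cells_le _ (fun i => d * (i%:R * d) `^ (1 - al)) _ n.+1./2) => //.
- by rewrite -[leqRHS]doubleK half_leq// -addnn leq_addr.
- by rewrite /= expr0n if_same.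
- move=> b i /andP[i0 ik].
  rewrite -[x _ ^+ 2]real_normK ?num_real// /big norm_cell_value ltNge small_index ik /=.
  have id0 : 0 < i%:R * d by rewrite mulr_gt0// ltr0n.
  rewrite mulrA; apply: le_trans (ler_wpM2r (sqr_ge0 _) (p_cell b i0)) _.
  rewrite -!mulrA !ler_pM2l//.
  have -> : - (1 + al) = (1 - al) - 1 - 1 by ring.
  by rewrite !powR_pred// expr2 mulrA !divfK// gt_eqF.
- by move=> b i ki; rewrite /big norm_cell_value ltNge small_index leqNgt ki.
- apply: le_trans (sum_powR_convex _ al01 d0) _.
  have e2 : 0 < eps / 2 by rewrite divr_gt0.
  have kd0 : 0 <= n.+1./2%:R * d by rewrite mulr_ge0// ltW.
  apply: (@le_trans _ _ ((eps / 2) `^ (2 - al) / (2 - al) + d * (eps / 2) `^ (1 - al))).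
    apply: lerD.
      by rewrite ler_pM2r ?invr_gt0// ge0_ler_powR ?nnegrE ?half_le ?(ltW r2) ?(ltW e2).
    by rewrite ler_pM2l// ge0_ler_powR ?nnegrE ?half_le ?(ltW r0) ?(ltW e2).
  (* The last term of [sum_powR_convex] is absorbed by th: d <= eps th / 4 gives 2 d / eps <= th / 2
     <= th / (2 - al). *)
  rewrite mulrDl mul1r lerD2l.
  have -> : (eps / 2) `^ (1 - al) = (eps / 2) `^ (2 - al) / (eps / 2).
    by rewrite -powR_pred//; congr (_ `^ _); ring.
  have A0 := powR_gt0 (2 - al) e2; set A := _ `^ (2 - al) in A0 *.
  have -> : d * (A / (eps / 2)) = A * (2 * d / eps) by field; rewrite gt_eqF.
  have -> : th * (A / (2 - al)) = A * (th / (2 - al)) by ring.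
  rewrite ler_pM2l// ler_pdivrMr//; case/andP: th0 => th0' _.
  have h : eps * (th / 2) <= eps * (th / (2 - al)).
    by rewrite !ler_pM2l// lef_pV2 ?posrE//; lra.
  rewrite mulrC; move: d_th h; lra.
Qed.

Lemma count_cells (k : nat) (y : R) :
  \sum_(i < k) (if y <= i%:R * d then d else 0) <= Num.max 0 (k%:R * d - y).
Proof.
elim: k => [|k IH]; first by rewrite big_ord0 le_max lexx.
rewrite big_ord_recr /=; apply: le_trans (lerD IH (lexx _)) _.
rewrite -natr1 mulrDl mul1r; have := d0.
case: ifPn => [yk d00|]; last rewrite -ltNge => yk d00.
  by rewrite (max_r (_ : 0 <= k%:R * d - y)) ?subr_ge0// le_max; apply/orP; right; lra.
by rewrite (max_l (_ : k%:R * d - y <= 0)) ?subr_le0 ?(ltW yk)// addr0 le_max lexx.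
Qed.

(** Above eps / 2 the density is at most M (eps / 2)^(-(1 + al)), and on each side the cells
    concerned cover a length of at most z + (eps + d - e'); the second term is the [rho] of
    [tail_bound]. *)
Lemma big_cells e' z : 0 <= z -> e' <= eps ->
  \sum_(a | big a && (e' - z <= `|x a|)) m%:R * p a <=
  2 * (t * M) * (eps / 2) `^ (- (1 + al)) * (z + (eps + d - e')).
Proof.
move=> z0 ee; have tM : 0 < t * M by rewrite mulr_gt0.
have /andP[al0 al1] := al01.
have e2 : 0 < eps / 2 by rewrite divr_gt0.
set Q := (eps / 2) `^ _; have Q0 : 0 < Q by rewrite powR_gt0.
rewrite big_mkcond sum_cells /big /= normr0 ltNge (ltW e2)/= add0r.
have H b : \sum_(i < n.+2) (if (eps / 2 < `|x (Some (b, i))|) && (e' - z <= `|x (Some (b, i))|)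
    then m%:R * p (Some (b, i)) else 0) <= t * M * Q * (z + (eps + d - e')).
  apply: (@le_trans _ _ (\sum_(i < n.+2) t * M * Q * (if e' - z <= i%:R * d then d else 0))).
    apply: ler_sum => i _; rewrite norm_cell_value.
    have [ei|ei] /= := ltP (eps / 2) (i%:R * d); last first.
      by rewrite mulr_ge0// ?mulr_ge0 ?(ltW t0) ?(ltW M0) ?(ltW Q0)//; case: ifP => // _;
        exact: ltW.
    case: ifPn => _; last by rewrite mulr0.
    have i0 : (0 < i)%N.
      rewrite lt0n; apply: contraTneq ei => ->; by rewrite mul0r -leNgt ltW.
    apply: le_trans (p_cell b i0) _.
    have id0 : 0 < i%:R * d by exact: lt_trans ei.
    rewrite -[leRHS]mulrA [Q * d]mulrC !ler_pM2l// /Q !powRN lef_pV2 ?posrE ?powR_gt0//.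
    by rewrite ge0_ler_powR ?nnegrE ?(ltW e2) ?(ltW ei) ?(ltW id0)// addr_ge0// ltW.
  rewrite -mulr_sumr ler_pM2l ?mulr_gt0//; apply: le_trans (count_cells _ _) _.
  rewrite ge_max; have d0' : 0 < d := d0; apply/andP; split; first by lra.
  have -> : n.+2%:R * d = eps + d by rewrite -natr1 mulrDl mul1r /d mulrC divfK.
  lra.
rewrite big_bool /= -!mulrA [2 * _]mulrDl ?mul1r.
have := H true; have := H false; rewrite /= -/(x _) => h1 h2.
by have := lerD h2 h1; lra.
Qed.

Lemma cells_tail : (200 <= m)%N ->
  m%:R * `|mean_law p (fun a => if big a then 0 else x a)| <= 51 / 200 * eps ->
  mean_prod p (fun s : {ffun 'I_m -> option (bool * 'I_n.+2)} =>
    ((1 - th) * eps < `|\sum_i x (s i)|)%R%:R) <=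
  83 * (2 * (t * M) * ((1 + th) * ((eps / 2) `^ (2 - al) / (2 - al)))) ^+ 2 / eps ^+ 4
  + 2 * (t * M) * (eps / 2) `^ (- (1 + al)) *
    (2 * (t * M) * (eps `^ (1 - al) / (1 - al)) + 2 * th * eps).
Proof.
move=> m200 hmu; have /andP[th0' th1] := th0.
have tM : 0 < t * M by rewrite mulr_gt0.
pose D := 2 * (t * M) * (eps / 2) `^ (- (1 + al)).
have D0 : 0 <= D by rewrite !mulr_ge0 ?powR_ge0// ltW.
have H1 : 199 / 200 * eps <= (1 - th) * eps by rewrite ler_pM2r//; lra.
have H2 a : ~~ big a -> `|x a| <= eps / 2 by rewrite -leNgt.
(* With m >= 200, the bound on m |mu| leaves at most eps / 200 for one variable. *)
have H4 : `|mean_law p (fun a => if big a then 0 else x a)| <= eps / 200.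
  have m0 : 0 < m%:R :> R by rewrite ltr0n (leq_trans _ m200).
  rewrite -(ler_pM2l m0); apply: le_trans hmu _.
  have : 200%:R * eps <= m%:R * eps by rewrite ler_pM2r// ler_nat.
  rewrite mulrA ler_pdivlMr//; have := eps0; lra.
have H6 z : 0 <= z -> \sum_(a | big a && ((1 - th) * eps - z <= `|x a|)) m%:R * p a <=
    D * (z + (eps + d - (1 - th) * eps)).
  by move=> z0; apply: big_cells => //; rewrite ger_pMl// gerBl ltW.
have := @tail_bound R _ 'I_m p p_ge0 p_sum1 x big eps ((1 - th) * eps)
  (2 * (t * M) * ((1 + th) * ((eps / 2) `^ (2 - al) / (2 - al)))) D (eps + d - (1 - th) *
    eps) eps0.
rewrite card_ord => /(_ H1 H2) /= /(_ hmu H4 mean_small_sqr_cells H6) H.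
(* Here rho = d + th eps, and d <= th eps / 4. *)
apply: le_trans H _; rewrite lerD2l ler_wpM2l// lerD ?mean_norm_cells//.
have := d_th; have := mulr_gt0 eps0 th0'; lra.
Qed.

End cells_tail.

(** * Finite covers and partitions of events *)

Section finite_partition.
Context {R : realType} {d : measure_display} {T : measurableType d} {P : probability T R}.
Context {I : finType} (F : I -> set T).
Hypothesis mF : forall i, measurable (F i).

Lemma measurable_bigcup_finType (D : pred I) : measurable (\bigcup_(i in [set i | D i]) F i).
Proof. by apply: fin_bigcup_measurable => // ; exact: finite_finset. Qed.

Let int_indic (B : set T) : measurable B -> (\int[P]_w (\1_B w)%:E = P B)%E.
Proof. by move=> mB; rewrite integral_indic// setIT. Qed.

Let sum_integral : (\sum_i P (F i) = \int[P]_w (\sum_i (\1_(F i) w)%:E))%E.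
Proof.
rewrite ge0_integral_sum//; last first.
  by move=> k; apply/measurable_EFinP; exact: measurable_indic.
by apply: eq_bigr => k _; rewrite int_indic.
Qed.

Lemma probability_cover (A : set T) : measurable A ->
  (forall w, A w -> exists i, F i w) -> (P A <= \sum_i P (F i))%E.
Proof.
move=> mA AF; rewrite -(int_indic mA) sum_integral.
apply: integral_le_nonmeasurable => w; rewrite ?lee_fin//.
rewrite sumEFin lee_fin [leLHS]indicE; have [/set_mem/AF[i Fi]|_] := boolP (w \in A).
  by rewrite (bigD1 i)//= indicE mem_set// lerDl sumr_ge0.
exact: sumr_ge0.
Qed.

Lemma probability_partition : (forall w, exists i, F i w) ->
  (forall w i j, F i w -> F j w -> i = j) -> (\sum_i P (F i) = 1)%E.
Proof.
move=> Fex Funiq; rewrite sum_integral -(probability_setT P).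
rewrite -(int_indic measurableT); apply: eq_integral => w _.
have [i Fi] := Fex w; rewrite sumEFin (bigD1 i)//= !indicE mem_set// in_setT big1 ?addr0//.
move=> j ji; rewrite indicE memNset// => Fj.
by move: ji; rewrite (Funiq w j i)// eqxx.
Qed.

End finite_partition.

(** * Rounding on a grid *)

Section grid.
Context {R : realType}.
Variables (eta eps : R) (n : nat).
Hypotheses (eta0 : 0 < eta) (eps0 : 0 < eps).
Implicit Types (a : bool * 'I_n.+2) (y : R).

Definition grid_step : R := eps / n.+1%:R.
Local Notation d := grid_step.

(** Only cells that start at eta + d or beyond are kept: [round_jump] then vanishes up to eta + d,
    as [rounded_jump_sum] requires, and every cell stays away from 0, where nu may have infinite
    mass. *)
Definition in_cell a y : bool :=
  (eta + d <= a.2%:R * d) && (a.2%:R * d < (-1) ^+ a.1 * y <= a.2.+1%:R * d).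

Definition cell_of y : option (bool * 'I_n.+2) := [pick a | in_cell a y].

Definition round_jump y : R := cell_value d (cell_of y).

Lemma grid_step_gt0 : 0 < d. Proof. by rewrite divr_gt0. Qed.

Lemma in_cell_norm a y : in_cell a y ->
  `|y| = (-1) ^+ a.1 * y /\ eta + d <= a.2%:R * d < `|y|.
Proof.
have d0 := grid_step_gt0.
case/andP => h1 /andP[h2 h3]; have y0 : 0 < (-1) ^+ a.1 * y by apply: lt_trans h2;
  apply: lt_le_trans h1; rewrite addr_gt0.
have <- : `|(-1) ^+ a.1 * y| = `|y| by rewrite normrM normr_sign mul1r.
by rewrite gtr0_norm// h1 h2.
Qed.

Lemma in_cell_inj a a' y : in_cell a y -> in_cell a' y -> a = a'.
Proof.
move=> ca ca'; have [na _] := in_cell_norm ca; have [na' ha'] := in_cell_norm ca'.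
have d0 := grid_step_gt0.
have y0 : 0 < `|y|.
  by case/andP: ha' => h1 h2; apply: lt_trans h2; apply: lt_le_trans h1; rewrite addr_gt0.
case/andP: ca => _; rewrite -na -[_ * d]add0r -[_.+1%:R * d]add0r => ca.
case/andP: ca' => _; rewrite -na' -[_ * d]add0r -[_.+1%:R * d]add0r => ca'.
have ii := mesh_index_inj d0 ca ca'.
case: a na ca ii => b i /= nb _; case: a' na' ca' {ha'} => b' i' /= nb' _ /val_inj ->.
congr (_, _); move: y0; rewrite {1}nb; rewrite nb in nb'.
by case: b nb nb'; case: b' => //=; rewrite !expr1 !expr0 mulN1r mul1r; lra.
Qed.

Lemma cell_ofP a y : cell_of y = Some a <-> in_cell a y.
Proof.
rewrite /cell_of; case: pickP => [a' ca'|nc]; split => //.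
- by move=> [<-].
- by move=> ca; rewrite (in_cell_inj ca ca').
- by move=> ca; have := nc a; rewrite ca.
Qed.

Lemma round_jump_small y : `|y| <= eta + d -> round_jump y = 0.
Proof.
rewrite /round_jump; case E : cell_of => [a|//].
move/cell_ofP/in_cell_norm: E => -[_ /andP[h1 h2]] h3.
by have := lt_le_trans (le_lt_trans h1 h2) h3; rewrite ltxx.
Qed.

Lemma round_jump_large y : eps + d < `|y| -> round_jump y = 0.
Proof.
rewrite /round_jump; case E : cell_of => [a|//].
move/cell_ofP: E => /[dup] /in_cell_norm[-> _] /andP[_ /andP[_ h]] h'.
have := lt_le_trans h' h.
have -> : eps + d = n.+2%:R * d by rewrite -natr1 mulrDl mul1r {2}/d mulrC divfK.
by rewrite ltr_pM2r ?grid_step_gt0// ltr_nat ltnS ltnNge -ltnS ltn_ord.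
Qed.

Lemma round_jump_close y : eta + 2 * d < `|y| <= eps + d -> `|round_jump y - y| <= d.
Proof.
have d0 := grid_step_gt0; have eta0' := eta0; move=> /andP[h1 h2].
have [|i ni hi] := @mesh_index R n.+2 d 0 `|y| d0.
  have -> : 0 + n.+2%:R * d = eps + d by rewrite -natr1 mulrDl mul1r {2}/d mulrC divfK// add0r.
  by rewrite h2 andbT; lra.
rewrite !add0r in hi; case/andP: hi => i1 i2.
have id1 : i.+1%:R * d = i%:R * d + d by rewrite -natr1 mulrDl mul1r.
pose a : bool * 'I_n.+2 := (y < 0, Ordinal ni).
have ya : (-1) ^+ a.1 * y = `|y|.
  by rewrite /=; case: ltP => y0; [rewrite expr1 mulN1r ltr0_norm|rewrite expr0 mul1r
    ger0_norm].
have ca : in_cell a y by rewrite /in_cell ya /= i1 i2 !andbT; lra.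
have /cell_ofP E := ca; rewrite /round_jump E /=.
have -> : (-1) ^+ (y < 0)%R * (i%:R * d) - y = (-1) ^+ (y < 0)%R * (i%:R * d - `|y|).
  by rewrite -ya /= mulrBr signrMK.
by rewrite normrM normr_sign mul1r ler_norml; apply/andP; split; lra.
Qed.

Definition cell_set (s : option (bool * 'I_n.+2)) : set (measurableTypeR R) :=
  [set y | cell_of y = s].

(** A cell is half-open: its probability is bounded above through a closed set and below through an
    open one. These two have the same nu-mass because nu has a density. *)
Definition cell_closure a : set (measurableTypeR R) :=
  [set y : R | a.2%:R * d <= (-1) ^+ a.1 * y <= a.2.+1%:R * d].
Definition cell_interior a : set (measurableTypeR R) :=
  [set y : R | a.2%:R * d < (-1) ^+ a.1 * y < a.2.+1%:R * d].

Let signE (b : bool) (y : R) : (-1) ^+ b * y = if b then - y else y.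
Proof. by case: b; rewrite ?expr1 ?expr0 ?mulN1r ?mul1r. Qed.

Lemma cell_closureE a : cell_closure a = if a.1 then `[- (a.2.+1%:R * d), - (a.2%:R *
  d)]%classic
  else `[a.2%:R * d, a.2.+1%:R * d]%classic.
Proof.
apply/seteqP; split => y; rewrite /cell_closure /= signE; case: a.1 => /=;
  by rewrite in_itv //= [_ <= - y]lerNr [- y <= _]lerNl andbC.
Qed.

Lemma cell_interiorE a : cell_interior a = if a.1 then `]- (a.2.+1%:R * d), - (a.2%:R *
  d)[%classic
  else `]a.2%:R * d, a.2.+1%:R * d[%classic.
Proof.
apply/seteqP; split => y; rewrite /cell_interior /= signE; case: a.1 => /=;
  by rewrite in_itv //= [_ < - y]ltrNr [- y < _]ltrNl andbC.
Qed.

Lemma cell_set_closure a : cell_set (Some a) `<=` cell_closure a.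
Proof.
by move=> y /cell_ofP /andP[_ /andP[h1 h2]]; rewrite /cell_closure /= h2 (ltW h1).
Qed.

Lemma cell_interior_set a : eta + d <= a.2%:R * d -> cell_interior a `<=` cell_set (Some a).
Proof.
by move=> ha y /andP[h1 h2]; apply/cell_ofP; rewrite /in_cell ha h1 (ltW h2).
Qed.

Lemma cell_set0 a : ~~ (eta + d <= a.2%:R * d) -> cell_set (Some a) = set0.
Proof.
by move=> /negP ha; apply/seteqP; split => // y /cell_ofP /andP[].
Qed.

Lemma measurable_cell_set s : measurable (cell_set s).
Proof.
have mS a : measurable (cell_set (Some a)).
  have [ha|/cell_set0 ->//] := boolP (eta + d <= a.2%:R * d).
  have -> : cell_set (Some a) = if a.1 then `[- (a.2.+1%:R * d), - (a.2%:R * d)[%classic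
      else `]a.2%:R * d, a.2.+1%:R * d]%classic.
    apply/seteqP; split => y.
      move=> /cell_ofP /andP[_]; rewrite signE; case: a.1 => /=;
        by rewrite in_itv //= [_ < - y]ltrNr [- y <= _]lerNl andbC.
    move=> hy; apply/cell_ofP; rewrite /in_cell ha signE /=; move: hy; case: a.1 => /=;
        by rewrite in_itv //= [_ < - y]ltrNr [- y <= _]lerNl andbC.
  by case: a.1.
case: s => [a|]; first exact: mS.
rewrite (_ : cell_set None = ~` \bigcup_(a in [set: bool * 'I_n.+2]) cell_set (Some a)).
  apply: measurableC; apply: fin_bigcup_measurable => //; exact: finite_finset.
apply/seteqP; split => y; rewrite /cell_set /=.
  by move=> yN [a _] /=; rewrite yN.
by case E : cell_of => [a|//] H; exfalso; apply: H; exists a.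
Qed.

End grid.

(** * From the mesh to a product law *)

Section grid_law.
Context {R : realType} {d : measure_display} {T : measurableType d} {P : probability T R}.
Variable X : R -> {RV P >-> R}.
Hypothesis X_levy : levy_process X.
Variables (eta eps : R) (n : nat).
Hypotheses (eta0 : 0 < eta) (eps0 : 0 < eps).
Implicit Types (t h c : R) (m : nat).

Local Notation cell := (option (bool * 'I_n.+2)).

Definition cell_prob h (s : cell) : R := incr_prob X h (cell_set eta eps s).

Lemma le_incr_prob h (A B : set (measurableTypeR R)) : measurable A -> measurable B ->
  A `<=` B -> incr_prob X h A <= incr_prob X h B.
Proof.
move=> mA mB AB; have mA' := measurable_increment X 0 h mA.
have mB' := measurable_increment X 0 h mB.
apply: fine_le; rewrite ?fin_num_measure//.
by apply: le_measure; rewrite ?inE// => w; exact: AB.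
Qed.

Let mcell h (s : cell) : measurable [set w | cell_set eta eps s (X h w - X 0 w)].
Proof. by apply: measurable_increment; exact: measurable_cell_set. Qed.

Lemma cell_prob_sum1 h : \sum_(s : cell) cell_prob h s = 1.
Proof.
apply: EFin_inj; rewrite -sumEFin.
rewrite -[RHS](@probability_partition R _ T P _ (fun s : cell => [set w | cell_set eta eps
  s (X h w - X 0 w)]))//.
- by apply: eq_bigr => s _; rewrite /cell_prob /incr_prob fineK ?fin_num_measure.
- by move=> w; exists (cell_of eta eps n (X h w - X 0 w)).
- by move=> w s s' <- <-.
Qed.

Definition grid_event t (e' : R) m : set T :=
  [set w | e' < `|\sum_(j < m) round_jump eta eps n (increment (X ^~ w) 0 (t / m%:R) j)|].

Let pattern t e' m (s : {ffun 'I_m -> cell}) : set T :=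
  if e' < `|\sum_(j < m) cell_value (grid_step eps n) (s j)| then
    [set w | forall j : 'I_m, cell_set eta eps (s j) (increment (X ^~ w) 0 (t / m%:R) j)]
  else set0.

Let mpattern t e' m (s : {ffun 'I_m -> cell}) : measurable (pattern t e' s).
Proof.
rewrite /pattern; case: ifP => // _.
rewrite (_ : [set w | _] = \bigcap_(j in [set: 'I_m])
    [set w | cell_set eta eps (s j) (increment (X ^~ w) 0 (t / m%:R) j)]).
  apply: fin_bigcap_measurable => [|j _]; first exact: finite_finset.
  by apply: measurable_increment; exact: measurable_cell_set.
by apply/seteqP; split => w /= h j => [_|]; exact: h.
Qed.

Let grid_event_pattern t e' m :
  grid_event t e' m = \bigcup_(s in [set s : {ffun 'I_m -> cell} | predT s]) pattern t e' s.
Proof.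
apply/seteqP; split => w.
  rewrite /grid_event /= => hw.
  pose s := [ffun j : 'I_m => cell_of eta eps n (increment (X ^~ w) 0 (t / m%:R) j)].
  have sE : \sum_(j < m) cell_value (grid_step eps n) (s j) =
      \sum_(j < m) round_jump eta eps n (increment (X ^~ w) 0 (t / m%:R) j).
    by apply: eq_bigr => j _; rewrite ffunE.
  by exists s => //; rewrite /pattern sE hw => j; rewrite ffunE.
move=> [s _]; rewrite /pattern; case: ifPn => // hs hw; rewrite /grid_event /=.
rewrite (eq_bigr (fun j => cell_value (grid_step eps n) (s j)))// => j _.
by rewrite /round_jump (hw j).
Qed.

Lemma measurable_grid_event t e' m : measurable (grid_event t e' m).
Proof. by rewrite grid_event_pattern; apply: measurable_bigcup_finType => s;
  exact: mpattern. Qed.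

(** The event is a finite union over the sequences of cells with a large sum; independence and
    stationarity make the probability of each sequence a product. *)
Lemma grid_event_le t e' m : 0 <= t ->
  (P (grid_event t e' m) <= (mean_prod (cell_prob (t / m%:R))
    (fun s : {ffun 'I_m -> cell} =>
      (e' < `|\sum_i cell_value (grid_step eps n) (s i)|)%R%:R))%:E)%E.
Proof.
move=> t0; apply: le_trans (probability_cover (@mpattern t e' m) (measurable_grid_event t
  e' m) _) _.
  by move=> w; rewrite grid_event_pattern => -[s _ hs]; exists s.
rewrite /mean_prod -sumEFin; apply: lee_sum => s _; rewrite /pattern.
case: ifP => _; last by rewrite measure0 mulr0.
rewrite (increments_law X_levy (B := fun j => cell_set eta eps (s j)))//.
- by rewrite mulr1.
- by rewrite divr_ge0.
- by move=> j; exact: measurable_cell_set.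
Qed.

End grid_law.

(** * Asymptotic probability of a cell *)

Section cell_bounds.
Context {R : realType} {d : measure_display} {T : measurableType d} {P : probability T R}.
Variable X : R -> {RV P >-> R}.
Hypothesis X_levy : levy_process X.
Variable nu : {measure set (measurableTypeR R) -> \bar R}.
Hypothesis X_nu : has_levy_measure X nu.
Variables (f : R -> R) (M al : R).
Hypothesis nu_f : has_density nu f.
Hypotheses (M0 : 0 < M) (al01 : 0 < al < 1) (fM : L_class M al f).
Variables (eta eps t : R) (n : nat).
Hypotheses (eta0 : 0 < eta) (eps01 : 0 < eps <= 1) (t0 : 0 < t).
Implicit Types (a : bool * 'I_n.+2) (i : 'I_n.+2) (b : bool) (c : R).
Local Notation dl := (grid_step eps n).

Let eps0 : 0 < eps. Proof. by case/andP: eps01. Qed.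
Let dl0 : 0 < dl. Proof. exact: grid_step_gt0. Qed.

Let mclosure (a : bool * 'I_n.+2) : measurable (cell_closure eps a).
Proof. by rewrite cell_closureE; case: a.1. Qed.

Let minterior (a : bool * 'I_n.+2) : measurable (cell_interior eps a).
Proof. by rewrite cell_interiorE; case: a.1. Qed.

Let id_gt0 (a : bool * 'I_n.+2) : eta + dl <= a.2%:R * dl -> 0 < a.2%:R * dl.
Proof. by apply: lt_le_trans; rewrite addr_gt0. Qed.

(** The cells reach up to eps + dl <= 2 eps <= 2, inside the range where [L_class] bounds f. *)
Let id_le2 (a : bool * 'I_n.+2) : a.2.+1%:R * dl <= 2.
Proof.
apply: (@le_trans _ _ (n.+2%:R * dl)); first by rewrite ler_pM2r// ler_nat ltn_ord.
have -> : n.+2%:R * dl = eps + dl by rewrite -natr1 mulrDl mul1r {1}/grid_step mulrC divfK.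
have : dl <= eps by rewrite /grid_step ler_pdivrMr// ler_peMr ?ler1n// ltW.
by case/andP: eps01 => _; lra.
Qed.

Let step (a : bool * 'I_n.+2) : a.2.+1%:R * dl - a.2%:R * dl = dl.
Proof. by rewrite -natr1; ring. Qed.

Lemma closure_fin a : eta + dl <= a.2%:R * dl -> nu (cell_closure eps a) \is a fin_num.
Proof.
move=> /id_gt0 ha; have /andP[al0 _] := al01.
apply: (density_fin_num nu_f M0 al0 fM (a := a.2%:R * dl) (b := a.2.+1%:R * dl)) => //.
  by rewrite ha/= -subr_ge0 step ltW.
move=> y; rewrite /cell_closure /= => /andP[h1 h2].
have -> : `|y : R| = (-1) ^+ a.1 * (y : R).
  by rewrite -(ger0_norm (le_trans (ltW ha) h1)) normrM normr_sign mul1r.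
by rewrite h1 h2.
Qed.

Lemma closure_le a : eta + dl <= a.2%:R * dl ->
  fine (nu (cell_closure eps a)) <= M * (dl * (a.2%:R * dl) `^ (- (1 + al))).
Proof.
move=> ha; have ha0 := id_gt0 ha; have /andP[al0 _] := al01.
rewrite -lee_fin fineK ?closure_fin// cell_closureE.
have hab : 0 < a.2%:R * dl <= a.2.+1%:R * dl by rewrite ha0/= -subr_ge0 step ltW.
have -> : M * (dl * (a.2%:R * dl) `^ (- (1 + al))) =
    (a.2.+1%:R * dl - a.2%:R * dl) * (M * (a.2%:R * dl) `^ (- (1 + al))).
  by rewrite step mulrCA.
case: a.1; first exact: (density_itvccN nu_f M0 al0 fM).
exact: (density_itvcc nu_f M0 al0 fM).
Qed.

Lemma closed_cell_closure a : closed (cell_closure eps a : set R).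
Proof. by rewrite cell_closureE; case: a.1; exact: itv_closed. Qed.

Lemma open_cell_interior a : open (cell_interior eps a : set R).
Proof. by rewrite cell_interiorE; case: a.1; exact: itv_open. Qed.

Lemma interior_closure_measure a : nu (cell_interior eps a) = nu (cell_closure eps a).
Proof.
have [mf f0 nuE] := nu_f.
rewrite !nuE// cell_interiorE cell_closureE; apply/esym.
by case: a.1; apply: integral_itv_bndoo; apply/measurable_EFinP; exact: measurable_funTS.
Qed.

Lemma closure_sign i b : symmetric_fun f ->
  nu (cell_closure eps (b, i) : set (measurableTypeR R)) = nu (cell_closure eps (false, i)).
Proof.
move=> fsym; case: b => //.
rewrite -[RHS](density_symmetric nu_f fsym)//; congr (nu _).
by apply/seteqP; split => y; rewrite /cell_closure /= expr1 expr0 mulN1r mul1r.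
Qed.

Lemma cell_prob_upper a c : eta + dl <= a.2%:R * dl ->
  t * fine (nu (cell_closure eps a)) < c ->
  \forall N \near \oo, \forall m \near \oo,
    (N * m)%:R * cell_prob X eta eps (t / (N * m)%:R) (Some a) <= c.
Proof.
move=> ha hc; have ha0 := id_gt0 ha.
have nB0 : ~ cell_closure eps a 0.
  by rewrite /cell_closure /= mulr0 leNgt ha0.
have nuE : nu (cell_closure eps a) = (fine (nu (cell_closure eps a)))%:E.
  by rewrite fineK// closure_fin.
have := incr_prob_le X_levy X_nu t0 (@closed_cell_closure a) nB0 (mclosure a) nuE hc.
apply: filterS => N; apply: filterS => m; apply: le_trans.
apply: ler_wpM2l => //; apply: le_incr_prob => //; first exact: measurable_cell_set.
exact: cell_set_closure.
Qed.

Lemma cell_prob_lower a c : eta + dl <= a.2%:R * dl ->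
  c < t * fine (nu (cell_closure eps a)) ->
  \forall N \near \oo, \forall m \near \oo,
    c <= (N * m)%:R * cell_prob X eta eps (t / (N * m)%:R) (Some a).
Proof.
move=> ha hc; have ha0 := id_gt0 ha.
have nuE : nu (cell_interior eps a) = (fine (nu (cell_closure eps a)))%:E.
  by rewrite interior_closure_measure fineK// closure_fin.
have Oa y : cell_interior eps a y -> a.2%:R * dl / 2 < `|y|.
  rewrite /cell_interior /= => /andP[h1 _].
  have -> : `|y : R| = (-1) ^+ a.1 * (y : R).
    by rewrite -(gtr0_norm (lt_trans ha0 h1)) normrM normr_sign mul1r.
  by apply: lt_trans h1; lra.
have a20 : 0 < a.2%:R * dl / 2 by rewrite divr_gt0.
have := incr_prob_ge X_levy X_nu t0 (@open_cell_interior a) (minterior a) a20 Oa nuE hc.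
apply: filterS => N; apply: filterS => m h; apply: (le_trans h).
apply: ler_wpM2l => //; apply: le_incr_prob => //; first exact: measurable_cell_set.
exact: cell_interior_set.
Qed.

End cell_bounds.

(** * The tail bound along infinitely many meshes *)

Lemma near2_all_finType (A : finType) (Q : A -> nat -> nat -> Prop) :
  (forall a, \forall N \near \oo, \forall m \near \oo, Q a N m) ->
  \forall N \near \oo, \forall m \near \oo, forall a, Q a N m.
Proof.
move=> h.
have H : \forall N \near \oo, forall a, a \in enum A -> \forall m \near \oo, Q a N m.
  by apply: near_all_seq => a _; exact: h.
near=> N.
have HN : forall a, a \in enum A -> \forall m \near \oo, Q a N m by near: N.
have H' : \forall m \near \oo, forall a, a \in enum A -> Q a N m.
  by apply: near_all_seq => a aA; exact: HN.
by apply: filterS H' => m hm a; apply: hm; rewrite mem_enum.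
Unshelve. all: by end_near. Qed.

(** The bound of [cells_tail] as a function of the slack [th]; its value at 0 is the one that
    remains in the end. *)
Definition tail_const {R : realType} (t M al eps th : R) : R :=
  83 * (2 * (t * M) * ((1 + th) * ((eps / 2) `^ (2 - al) / (2 - al)))) ^+ 2 / eps ^+ 4
  + 2 * (t * M) * (eps / 2) `^ (- (1 + al)) *
    (2 * (t * M) * (eps `^ (1 - al) / (1 - al)) + 2 * th * eps).

Section grid_event_bound.
Context {R : realType} {d : measure_display} {T : measurableType d} {P : probability T R}.
Variable X : R -> {RV P >-> R}.
Hypothesis X_levy : levy_process X.
Variable nu : {measure set (measurableTypeR R) -> \bar R}.
Hypothesis X_nu : has_levy_measure X nu.
Variables (f : R -> R) (M al : R).
Hypothesis nu_f : has_density nu f.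
Hypotheses (M0 : 0 < M) (al01 : 0 < al < 1) (fM : L_class M al f).
Variables (eta eps t th : R) (n : nat).
Hypotheses (eta0 : 0 < eta) (eps01 : 0 < eps <= 1) (t0 : 0 < t).
Hypotheses (th01 : 0 < th <= 1 / 200) (step_th : grid_step eps n <= eps * th / 4).
Hypothesis small_mean :
  2 * (t * M) * ((eps / 2) `^ (1 - al) / (1 - al)) <= eps / 4 \/ symmetric_fun f.
Local Notation dl := (grid_step eps n).
Local Notation M' := (M * (1 + th)).
Implicit Types (a : bool * 'I_n.+2) (i : 'I_n.+2) (b : bool) (c : R).

Let eps0 : 0 < eps. Proof. by case/andP: eps01. Qed.
Let dl0 : 0 < dl. Proof. exact: grid_step_gt0. Qed.
Let M'0 : 0 < M'.
Proof. by case/andP: th01 => th0 _; rewrite mulr_gt0// addr_gt0. Qed.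

Let cell_prob_out h a : ~~ (eta + dl <= a.2%:R * dl) -> cell_prob X eta eps h (Some a) = 0.
Proof. by move=> ha; rewrite /cell_prob cell_set0// /incr_prob measure0. Qed.

Let ord0_out b : ~~ (eta + dl <= (ord0 : 'I_n.+2)%:R * dl).
Proof. by rewrite mul0r -ltNge addr_gt0. Qed.

Let upper : \forall N \near \oo, \forall m \near \oo, forall a, (0 < a.2)%N ->
  (N * m)%:R * cell_prob X eta eps (t / (N * m)%:R) (Some a) <=
  t * M' * (dl * (a.2%:R * dl) `^ (- (1 + al))).
Proof.
apply: near2_all_finType => a.
have [ha|ha] := boolP (eta + dl <= a.2%:R * dl); last first.
  apply: nearW => N; apply: nearW => m _; rewrite cell_prob_out// mulr0.
  apply: mulr_ge0; first exact: ltW (mulr_gt0 t0 M'0).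
  by rewrite mulr_ge0 ?powR_ge0// ltW.
have a0 : 0 < a.2%:R * dl by apply: lt_le_trans ha; rewrite addr_gt0.
(* The factor 1 + th in M' makes the inequality strict, as [cell_prob_upper] demands. *)
have hc : t * fine (nu (cell_closure eps a)) < t * M' * (dl * (a.2%:R * dl) `^ (- (1 + al))).
  rewrite -mulrA ltr_pM2l//.
  apply: (le_lt_trans (closure_le nu_f M0 al01 fM eta0 eps01 ha)).
  have Q0 : 0 < dl * (a.2%:R * dl) `^ (- (1 + al)) by rewrite mulr_gt0// powR_gt0.
  by rewrite ltr_pM2r// ltr_pMr// ltrDl; case/andP: th01.
have := cell_prob_upper X_levy X_nu nu_f M0 al01 fM eta0 eps01 t0 ha hc.
by apply: filterS => N; apply: filterS.
Qed.

(** Opposite cells may differ by 2 gamma; over n + 2 pairs of cells with values at most eps / 2,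
    this adds up to a mean of at most eps / 4. *)
Let gamma : R := (4 * n.+2%:R)^-1.
Let gamma0 : 0 < gamma. Proof. by rewrite invr_gt0 mulr_gt0. Qed.

Let balanced : symmetric_fun f -> \forall N \near \oo, \forall m \near \oo, forall a,
  eta + dl <= a.2%:R * dl ->
  `|(N * m)%:R * cell_prob X eta eps (t / (N * m)%:R) (Some a)
     - t * fine (nu (cell_closure eps (false, a.2)))| <= gamma.
Proof.
move=> fsym; apply: near2_all_finType => a.
have [ha|ha] := boolP (eta + dl <= a.2%:R * dl); last first.
  by apply: nearW => N; apply: nearW => m.
have aE : nu (cell_closure eps a) = nu (cell_closure eps (false, a.2)).
  by case: a ha => b i _; exact: (closure_sign nu_f).
set r := fine _.
have h1 : t * fine (nu (cell_closure eps a)) < t * r + gamma by rewrite aE ltrDl.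
have h2 : t * r - gamma < t * fine (nu (cell_closure eps a)) by rewrite aE gtrBl.
have H1 := cell_prob_upper X_levy X_nu nu_f M0 al01 fM eta0 eps01 t0 ha h1.
have H2 := cell_prob_lower X_levy X_nu nu_f M0 al01 fM eta0 eps01 t0 ha h2.
near=> N; near=> m; move=> _.
rewrite ler_distl; apply/andP; split.
  by near: m; near: N.
by near: m; near: N.
Unshelve. all: by end_near. Qed.

Let good_mesh (N0 : nat) : exists m, [/\ (maxn N0 200 <= m)%N,
  (forall b i, (0 < i)%N -> m%:R * cell_prob X eta eps (t / m%:R) (Some (b, i)) <=
    t * M' * (dl * (i%:R * dl) `^ (- (1 + al)))) &
  (symmetric_fun f -> forall a, eta + dl <= a.2%:R * dl ->
    `|m%:R * cell_prob X eta eps (t / m%:R) (Some a)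
     - t * fine (nu (cell_closure eps (false, a.2)))| <= gamma)].
Proof.
have B' : \forall N \near \oo, \forall m \near \oo, symmetric_fun f -> forall a,
  eta + dl <= a.2%:R * dl ->
  `|(N * m)%:R * cell_prob X eta eps (t / (N * m)%:R) (Some a)
     - t * fine (nu (cell_closure eps (false, a.2)))| <= gamma.
  have [fsym|nsym] := pselect (symmetric_fun f); last by apply: nearW => N;
    apply: nearW => m /nsym.
  by apply: filterS (balanced fsym) => N; apply: filterS => m h _.
have [N [N1 hN1 hN2]] : exists N, [/\ (0 < N)%N,
   \forall m \near \oo, forall a, (0 < a.2)%N ->
  (N * m)%:R * cell_prob X eta eps (t / (N * m)%:R) (Some a) <=
  t * M' * (dl * (a.2%:R * dl) `^ (- (1 + al))) & \forall m \near \oo, symmetric_fun f ->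
    forall a,
  eta + dl <= a.2%:R * dl ->
  `|(N * m)%:R * cell_prob X eta eps (t / (N * m)%:R) (Some a)
     - t * fine (nu (cell_closure eps (false, a.2)))| <= gamma].
  have [N hN] := @filter_ex _ \oo _ _ (filterI (nbhs_infty_gt 0) (filterI upper B')).
  case: hN => h1 [h2 h3]; exists N; split; [exact: h1|exact: h2|exact: h3].
have [m [hm1 [hm2 hm3]]] := @filter_ex _ \oo _ _
  (filterI (nbhs_infty_ge (maxn N0 200)) (filterI hN1 hN2)).
exists (N * m)%N; split.
- by apply: (leq_trans hm1); rewrite leq_pmull.
- by move=> b i; exact: (hm2 (b, i)).
- exact: hm3.
Qed.

(* When [f] is symmetric, opposite cells have asymptotically the same probability,
   so that the small values have a mean close to 0. *)
Lemma grid_event_bound N0 : exists2 m, (N0 <= m)%N &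
  (P (grid_event X eta eps n t ((1 - th) * eps) m) <= (tail_const t M' al eps th)%:E)%E.
Proof.
have [m [Nm hup hbal]] := good_mesh N0.
have Nm' := leq_trans (leq_maxl _ _) Nm; have m200 := leq_trans (leq_maxr _ _) Nm.
exists m => //; apply: (le_trans (grid_event_le X_levy n eta0 eps0 _ m (ltW t0))).
rewrite lee_fin; set p := cell_prob _ _ _ _ in hup hbal *.
have p0 s : 0 <= p s by exact: incr_prob_ge0.
have p1 : \sum_s p s = 1 by exact: cell_prob_sum1.
have pc0 b : p (Some (b, ord0)) = 0 by rewrite /p cell_prob_out// ord0_out.
apply: (cells_tail t0 M'0 al01 eps0 th01 step_th p0 p1 pc0 hup m200).
set x := cell_value _.
have m0 : 0 < m%:R :> R by rewrite ltr0n (leq_trans _ m200).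
(* Either way the mean of the sum of the small values has to stay below 51/200 eps. In the first
   case their sizes have a mean of at most (1 + th) eps / 4, with th <= 1/200; under symmetry,
   positive and negative cells are paired. *)
have [hsm|fsym] := small_mean.
  have := mean_small_norm_cells t0 M'0 al01 eps0 pc0 hup.
  rewrite -/x => h.
  have h' : m%:R * `|mean_law p (fun s => if eps / 2 < `|x s| then 0 else x s)| <=
      m%:R * mean_law p (fun s => if eps / 2 < `|x s| then 0 else `|x s|).
    rewrite ler_pM2l// /mean_law (le_trans (ler_norm_sum _ _ _))//; apply: ler_sum => a _.
    by rewrite normrM ger0_norm//; case: ifP => //; rewrite normr0.
  apply: (le_trans h').
  apply: (le_trans h); have /andP[th0 th1] := th01.
  set A := _ `^ _ / _ in hsm *.
  have -> : 2 * (t * M') * A = (1 + th) * (2 * (t * M) * A) by ring.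
  apply: (@le_trans _ _ ((1 + th) * (eps / 4))); first by rewrite ler_pM2l// addr_gt0.
  have : th * eps <= 1 / 200 * eps by rewrite ler_pM2r.
  by have := eps0; lra.
pose y (i : 'I_n.+2) : R := if eps / 2 < i%:R * dl then 0 else i%:R * dl.
have y01 i : 0 <= y i <= eps / 2.
  rewrite /y; case: ltP => h; first by rewrite lexx/= divr_ge0// ltW.
  by rewrite h mulr_ge0// ltW.
have -> : mean_law p (fun s => if eps / 2 < `|x s| then 0 else x s) =
   \sum_(i < n.+2) (p (Some (false, i)) - p (Some (true, i))) * y i.
  rewrite /mean_law sum_cells /x /= normr0 if_same mulr0 add0r big_bool /= addrC -big_split /=.
  apply: eq_bigr => i _.
  rewrite expr0 mul1r expr1 mulN1r normrN ger0_norm; last by rewrite mulr_ge0// ltW.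
  by rewrite /y; case: ifP => _; ring.
rewrite -[m%:R]ger0_norm ?(ltW m0)// -normrM mulr_sumr (le_trans (ler_norm_sum _ _ _))//.
apply: (@le_trans _ _ (\sum_(i < n.+2) (2 * gamma) * (eps / 2))).
  apply: ler_sum => i _; rewrite [X in `|X| <= _]mulrA mulrBr normrM [ `|y i| ]ger0_norm;
    last by case/andP: (y01 i).
  apply: ler_pM => //; [by case/andP: (y01 i)| |by case/andP: (y01 i)].
  have [hi|hi] := boolP (eta + dl <= i%:R * dl); last first.
    by rewrite /p !cell_prob_out// mulr0 subrr normr0 mulr_ge0// ltW.
  have h1 := hbal fsym (false, i) hi; have h2 := hbal fsym (true, i) hi.
  rewrite -(subrKA (t * fine (nu (cell_closure eps (false, i))))).
  rewrite (le_trans (ler_normD _ _))//; rewrite distrC in h2.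
  by rewrite mulr_natl mulr2n lerD.
rewrite sumr_const card_ord -(mulr_natl (2 * gamma * _)).
have -> : n.+2%:R * (2 * gamma * (eps / 2)) = eps / 4.
  have z0 : n.+2%:R != 0 :> R by rewrite pnatr_eq0.
  by move: z0; rewrite /gamma; move: (n.+2%:R) => z z0; field.
by have := eps0; lra.
Qed.

End grid_event_bound.

(** * Passage to the limit *)

Section small_jumps_tail.
Context {R : realType} {d : measure_display} {T : measurableType d} {P : probability T R}.
Variable X : R -> {RV P >-> R}.
Hypothesis X_levy : levy_process X.
Variable nu : {measure set (measurableTypeR R) -> \bar R}.
Hypothesis X_nu : has_levy_measure X nu.
Variables (f : R -> R) (M al : R).
Hypothesis nu_f : has_density nu f.
Hypotheses (M0 : 0 < M) (al01 : 0 < al < 1) (fM : L_class M al f).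
Variables (eps t : R).
Hypotheses (eps01 : 0 < eps <= 1) (t0 : 0 < t).
Hypothesis small_mean :
  2 * (t * M) * ((eps / 2) `^ (1 - al) / (1 - al)) <= eps / 4 \/ symmetric_fun f.

Definition truncated_jump_sum (x : R -> R) (e s eta : R) : R :=
  \sum_(r \in jump_times x s [set y | eta < `|y| <= e]) jump x r.

Let eps0 : 0 < eps. Proof. by case/andP: eps01. Qed.

(** [j.+2] keeps every cutoff strictly below eps. *)
Let eta_ (j : nat) : R := eps / j.+2%:R.

(** Almost surely, |Y| >= eps makes the truncated sums exceed (1 - th) eps strictly from some cutoff
    on, then the rounded mesh sums from some grid on and, for each grid, from some mesh on. These
    are three nested lower limits of events; the bound passes through each because [lim_inf_set_le]
    asks for infinitely many indices only. *)
Lemma small_jumps_tail_slack (Y : T -> R) (th : R) : 0 < th <= 1 / 200 ->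
  measurable [set w | eps <= `|Y w|] ->
  {ae P, forall w, truncated_jump_sum (X ^~ w) eps t (eta_ j) @[j --> \oo] --> Y w} ->
  (P [set w | (eps <= `|Y w|)%R] <= (tail_const t (M * (1 + th)) al eps th)%:E)%E.
Proof.
move=> th01 mY aeY; have /andP[th0 th1] := th01.
set c := tail_const _ _ _ _ _.
have eta0 j : 0 < eta_ j by rewrite divr_gt0.
have etaeps j : 0 < eta_ j < eps.
  by rewrite eta0 /eta_ ltr_pdivrMr// ltr_pMr// ltr1n.
pose E j K := grid_event X (eta_ j) eps K t ((1 - th) * eps).
have mE j K m : measurable (E j K m) by exact: measurable_grid_event.
pose L1 j K := lim_inf_set (E j K).
have mL1 j K : measurable (L1 j K) by exact: measurable_lim_inf_set.
pose L2 j := lim_inf_set (L1 j).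
have mL2 j : measurable (L2 j) by exact: measurable_lim_inf_set.
have step_cvg r : 0 < r -> \forall K \near \oo, grid_step eps K < r.
  move=> r0; have [N _ hN] := near_div eps r0; exists N => // K /= NK.
  by apply: hN; rewrite /= (leq_trans NK).
have PL2 j : (P (L2 j) <= c%:E)%E.
  apply: lim_inf_set_le => // N.
  have r0 : 0 < eps * th / 4 by rewrite divr_gt0// mulr_gt0.
  have [N' _ hN'] := step_cvg _ r0.
  exists (maxn N N'); first exact: leq_maxl.
  apply: lim_inf_set_le => // N1.
  apply: (grid_event_bound X_levy X_nu nu_f M0 al01 fM (eta0 j) eps01 t0 th01 _ small_mean).
  by rewrite ltW//; apply: hN'; exact: leq_maxr.
have PL3 : (P (lim_inf_set L2) <= c%:E)%E.
  by apply: lim_inf_set_le => // N; exists N.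
have [N [mN PN0 sN]] : {ae P, forall w, eps <= `|Y w| -> lim_inf_set L2 w}.
  apply: filterS2 (levy_cadlag X_levy) aeY => w cw Yw epsY.
  apply/lim_inf_setP.
  have e'Y : (1 - th) * eps < `|Y w|.
    by apply: lt_le_trans epsY; rewrite gtr_pMl// gtrBl.
  have hgt := cvgr_gt _ (cvg_norm Yw) _ e'Y.
  case: hgt => [N _ hN]; exists N => // j /hN /= hj.
  apply/lim_inf_setP.
  have := @rounded_jump_sum R (X ^~ w) cw t (eta_ j) eps ((1 - th) * eps)
    (grid_step eps) (fun K => round_jump (eta_ j) eps K) t0 (etaeps j)
    (fun K => grid_step_gt0 K eps0) step_cvg
    (fun K y => @round_jump_small R _ _ K (eta0 j) eps0 y)
    (fun K y => @round_jump_large R _ _ K (eta0 j) eps0 y)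
    (fun K y => @round_jump_close R _ _ K (eta0 j) eps0 y) hj.
  by apply: filterS => K hK; apply/lim_inf_setP.
apply: le_trans PL3.
apply: (@le_trans _ _ (P (lim_inf_set L2 `|` N))).
  apply: le_measure; rewrite ?inE//.
    by apply: measurableU => //; exact: measurable_lim_inf_set.
  move=> w hw; apply: contrapT => /not_orP[h1 h2]; apply: h2; apply: sN => /= h.
  exact: h1 (h hw).
have mL3 : measurable (lim_inf_set L2) by exact: measurable_lim_inf_set.
apply: le_trans (measureU2 _ mL3 mN) _.
by rewrite [X in (_ + X)%E]PN0 adde0.
Qed.

(** Powers of 1 + th lie below their chords on [0, 1], of slopes 2^4 - 1 = 15 and 2^2 - 1 = 3, and 2
    th (1 + th) <= 4 th. *)
Lemma tail_const_slack : exists2 C, 0 <= C & forall th, 0 < th <= 1 ->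
  tail_const t (M * (1 + th)) al eps th <= tail_const t M al eps 0 + th * C.
Proof.
rewrite /tail_const.
have /andP[al0 al1] := al01; have r1 : 0 < 1 - al by lra.
set a := (eps / 2) `^ (2 - al) / (2 - al); set b := (eps / 2) `^ (- (1 + al)).
set c := eps `^ (1 - al) / (1 - al).
pose A := 83 * (2 * (t * M) * a) ^+ 2 / eps ^+ 4.
pose B := 2 * (t * M) * b; pose C := 2 * (t * M) * c.
have tM : 0 < t * M by rewrite mulr_gt0.
have A0 : 0 <= A by rewrite divr_ge0 ?exprn_ge0 ?(ltW eps0)// mulr_ge0// sqr_ge0.
have B0 : 0 <= B by rewrite mulr_ge0 ?powR_ge0// mulr_ge0// ltW.
have C0 : 0 <= C by rewrite mulr_ge0 ?divr_ge0 ?powR_ge0 ?(ltW r1)// mulr_ge0// ltW.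
have BC0 : 0 <= B * C by rewrite mulr_ge0.
have Be0 : 0 <= B * eps by rewrite mulr_ge0// ltW.
exists (15 * A + 3 * (B * C) + 4 * (B * eps)).
  by rewrite !addr_ge0// mulr_ge0.
move=> th /andP[th0 th1].
have -> : 83 * (2 * (t * (M * (1 + th))) * ((1 + th) * a)) ^+ 2 / eps ^+ 4 =
  (1 + th) ^+ 4 * A by rewrite /A; ring.
have -> : 83 * (2 * (t * M) * ((1 + 0) * a)) ^+ 2 / eps ^+ 4 = A by rewrite addr0 mul1r.
have -> : 2 * (t * (M * (1 + th))) * b * (2 * (t * (M * (1 + th))) * c + 2 * th * eps)
  = (1 + th) ^+ 2 * (B * C) + 2 * th * (1 + th) * (B * eps) by rewrite /B /C; ring.
have -> : 2 * (t * M) * b * (2 * (t * M) * c + 2 * 0 * eps) = B * C.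
  by rewrite /B /C; ring.
have p4 : (1 + th) ^+ 4 <= 1 + 15 * th.
  have -> : (1 + th) ^+ 4 = 1 + th * (4 + 6 * th + 4 * th ^+ 2 + th ^+ 3) by ring.
  have t2 : th ^+ 2 <= 1 by rewrite exprn_ile1// ltW.
  have t3 : th ^+ 3 <= 1 by rewrite exprn_ile1// ltW.
  rewrite lerD2l mulrC ler_pM2r//; lra.
have p2 : (1 + th) ^+ 2 <= 1 + 3 * th.
  have -> : (1 + th) ^+ 2 = 1 + th * (2 + th) by ring.
  rewrite lerD2l mulrC ler_pM2r//; lra.
have p1 : 2 * th * (1 + th) <= 4 * th by rewrite mulrAC ler_pM2r//; lra.
have q1 := ler_wpM2r A0 p4; have q2 := ler_wpM2r BC0 p2; have q3 := ler_wpM2r Be0 p1.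
lra.
Qed.

Lemma small_jumps_tail (Y : T -> R) : measurable [set w | eps <= `|Y w|] ->
  {ae P, forall w, truncated_jump_sum (X ^~ w) eps t (eta_ j) @[j --> \oo] --> Y w} ->
  (P [set w | (eps <= `|Y w|)%R] <= (tail_const t M al eps 0)%:E)%E.
Proof.
move=> mY aeY; set A := [set w | _].
have PA : P A = (fine (P A))%:E by rewrite fineK// fin_num_measure.
rewrite PA lee_fin; apply/ler_addgt0Pr => e e0.
have [C C0 slack] := tail_const_slack.
pose th := Num.min (1 / 200) (e / (C + 1)).
have C1 : 0 < C + 1 by lra.
have th0 : 0 < th by rewrite lt_min divr_gt0//= divr_gt0.
have th1 : th <= 1 / 200 by rewrite ge_min lexx.
have thC : th * C <= e.
  have : th * (C + 1) <= e by rewrite -ler_pdivlMr// ge_min lexx orbT.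
  lra.
have th01 : 0 < th <= 1 / 200 by rewrite th0.
have th01' : 0 < th <= 1 by rewrite th0 (le_trans th1)//; lra.
have := small_jumps_tail_slack th01 mY aeY; rewrite -/A PA lee_fin => h.
apply: (le_trans h); apply: (le_trans (slack th th01')); lra.
Qed.

End small_jumps_tail.

(** * Comparison of the constants *)

Section constants.
Context {R : realType}.
Implicit Types (t M al eps : R).

Lemma tail_const0E t M al eps : 0 < al < 1 -> 0 < eps ->
  tail_const t M al eps 0 =
  (83 / 4 * 4 `^ al / (2 - al) ^+ 2 + 4 * 2 `^ (1 + al) / (1 - al)) *
  (t ^+ 2 * M ^+ 2 * eps `^ (- (2 * al))).
Proof.
move=> /andP[al0 al1] e0; rewrite /tail_const.
have r1 : 1 - al != 0 by rewrite gt_eqF// subr_gt0.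
have r2 : 2 - al != 0 by rewrite gt_eqF//; lra.
have pd x y : x `^ (x - x) = 1 :> R by rewrite subrr powRr0.
have pe0 : eps != 0 by rewrite gt_eqF.
have e2 : eps `^ (2 - al) = eps ^+ 2 / eps `^ al.
  by rewrite powRB ?pe0 ?implybT// powR_mulrn ?(ltW e0).
have e1 : eps `^ (1 - al) = eps / eps `^ al.
  by rewrite powRB ?pe0 ?implybT// powRr1// ltW.
have eN : eps `^ (- (2 * al)) = (eps `^ al ^+ 2)^-1.
  by rewrite powRN -powR_mulrn ?powR_ge0// -powRrM mulrC.
have eN1 : eps `^ (1 + al) = eps * eps `^ al.
  by rewrite powRD ?pe0 ?implybT// powRr1// ltW.
have n20 : (2 : R) != 0 by [].
have t2 : 2 `^ (2 - al) = 4 / 2 `^ al :> R.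
  by rewrite powRB ?n20 ?implybT// powR_mulrn//; congr (_ / _); ring.
have t1 : 2 `^ (1 + al) = 2 * 2 `^ al :> R.
  by rewrite powRD ?n20 ?implybT// powRr1.
have t4 : 4 `^ al = (2 `^ al) ^+ 2 :> R.
  have -> : 4 = 2 * 2 :> R by ring.
  by rewrite powRM// expr2.
have h1 : (eps / 2) `^ (2 - al) = eps `^ (2 - al) / 2 `^ (2 - al) by rewrite powR_div// ltW.
have h2 : (eps / 2) `^ (- (1 + al)) = (eps `^ (1 + al) / 2 `^ (1 + al))^-1.
  by rewrite powRN powR_div// ltW.
rewrite h1 h2 e2 e1 eN eN1 t2 t1 t4.
have := powR_gt0 al e0; move: (eps `^ al) => E E0.
have := @powR_gt0 R 2 al (ltr0Sn _ 1); move: (2 `^ al) => F F0.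
by field; rewrite ?r1 ?r2 ?pe0 ?(gt_eqF E0) ?(gt_eqF F0).
Qed.

(** 25/4 is what [tail_const_le_C2] needs, since 83/4 = 3 * 25/4 + 2. It follows from e^x >= 1 + x
    at x = 1/8, raised to the power 16. *)
Lemma expR2_ge : 25 / 4 <= expR (2 : R).
Proof.
have -> : (2 : R) = 16%:R * 8^-1 by lra.
rewrite expRM_natl.
have h : 9 / 8 <= expR (8^-1 : R) by apply: le_trans (expR_ge1Dx _); lra.
apply: (@le_trans _ _ ((9 / 8) ^+ 16)); first by lra.
by rewrite lerXn2r ?nnegrE ?expR_ge0//; lra.
Qed.

Lemma pow4_le al : 0 < al < 1 -> 4 `^ al <= 4 :> R.
Proof.
move=> /andP[al0 al1]; rewrite -[leRHS]powRr1//.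
by apply: ler_powR; [lra|exact: ltW].
Qed.

(** The first term is at most 83 < 2 * 64, and the second is exactly twice the leading term of
    [bold_C2]. *)
Lemma tail_const_le_C1 al : 0 < al < 1 ->
  83 / 4 * 4 `^ al / (2 - al) ^+ 2 + 4 * 2 `^ (1 + al) / (1 - al) <= 2 * C1 al.
Proof.
move=> al01; have /andP[al0 al1] := al01.
have r1 : 0 < 1 - al by lra.
have r2 : 0 < 2 - al by lra.
have bC1 : 0 <= bold_C1 al.
  by rewrite /bold_C1 divr_ge0 ?powR_ge0 ?mulr_ge0 ?(ltW al0) ?(ltW r2).
have bC2 : 2 `^ (2 + al) / (1 - al) <= bold_C2 al.
  have k0 : 0 <= 2 `^ (1 - al) * al * (2 - al).
    by rewrite !mulr_ge0 ?powR_ge0 ?(ltW al0) ?(ltW r2).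
  have k1 : 0 <= al * (2 - al) * (1 - al) * 3 `^ (1 + al).
    by rewrite !mulr_ge0 ?powR_ge0 ?(ltW al0) ?(ltW r1) ?(ltW r2).
  rewrite /bold_C2 -[leRHS]addrA -[leRHS]addrA lerDl addr_ge0//; last rewrite addr_ge0//.
  - apply: divr_ge0 => //; apply: mulr_ge0; first exact: powR_ge0.
    by rewrite !addr_ge0 ?(ltW al0).
  - apply: divr_ge0; first by apply: mulr_ge0; rewrite ?powR_ge0.
    by apply: mulr_ge0; rewrite ?sqr_ge0 ?(ltW r2).
have h1 : 83 / 4 * 4 `^ al / (2 - al) ^+ 2 <= 83.
  rewrite ler_pdivrMr ?exprn_gt0//.
  have := pow4_le al01; have : 1 <= (2 - al) ^+ 2 by rewrite exprn_ege1//; lra.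
  lra.
have h2 : 64 <= 64 / al ^+ 2.
  by rewrite ler_peMr// invf_ge1 ?exprn_gt0// exprn_ile1// ltW.
have h3 : 4 * 2 `^ (1 + al) / (1 - al) = 2 * (2 `^ (2 + al) / (1 - al)).
  have -> : 2 + al = 1 + (1 + al) by ring.
  have n20 : (2 : R) != 0 by [].
  have -> : 2 `^ (1 + (1 + al)) = 2 * 2 `^ (1 + al) :> R.
    by rewrite powRD ?n20 ?implybT// powRr1.
  ring.
rewrite /C1; lra.
Qed.

(** 83/4 splits into 75/4, covered by the exponential term, and 2, covered by 4^al / al^2 as al < 2
    - al. The other term rests on 2 <= 2^(1 + al) and al (2 - al) <= 1. *)
Lemma tail_const_le_C2 al : 0 < al < 1 ->
  83 / 4 * 4 `^ al / (2 - al) ^+ 2 + 4 * 2 `^ (1 + al) / (1 - al) <= 2 * C2 al.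
Proof.
move=> al01; have /andP[al0 al1] := al01.
have r1 : 0 < 1 - al by lra.
have r2 : 0 < 2 - al by lra.
have n20 : (2 : R) != 0 by [].
have q0 : 0 < 4 `^ al :> R by rewrite powR_gt0.
have i2 : 0 < ((2 - al) ^+ 2)^-1 by rewrite invr_gt0 exprn_gt0.
have e1 : 25 / 4 <= expR (2 + (expR 1)^-1) :> R.
  by apply: le_trans expR2_ge _; rewrite ler_expR lerDl invr_ge0 expR_ge0.
have p1 : 2 `^ (2 * al - 1) = 4 `^ al / 2 :> R.
  rewrite powRB ?n20 ?implybT// powRr1// powRrM powR_mulrn//.
  by congr (_ `^ _ / _); ring.
have h1 : 75 / 4 * (4 `^ al * ((2 - al) ^+ 2)^-1) <=
    2 * (3 * 2 `^ (2 * al - 1) * expR (2 + (expR 1)^-1) / (2 - al) ^+ 2).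
  rewrite p1; have -> : 2 * (3 * (4 `^ al / 2) * expR (2 + (expR 1)^-1) / (2 - al) ^+ 2)
    = 3 * expR (2 + (expR 1)^-1) * (4 `^ al * ((2 - al) ^+ 2)^-1) by field; rewrite gt_eqF.
  by rewrite ler_pM2r ?mulr_gt0//; lra.
have h2 : 2 * (4 `^ al * ((2 - al) ^+ 2)^-1) <= 2 * (4 `^ al / al ^+ 2).
  rewrite ler_pM2l// ler_pM2l// lef_pV2 ?posrE ?exprn_gt0// ler_sqr ?nnegrE ?(ltW al0)
    ?(ltW r2)//.
  lra.
have h3 : 4 * 2 `^ (1 + al) / (1 - al) <= 2 * (4 `^ (1 + al) / (al * (1 - al) * (2 - al))).
  have -> : 4 `^ (1 + al) = 2 `^ (1 + al) * 2 `^ (1 + al) :> R.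
    by rewrite -powRM//; congr (_ `^ _); ring.
  have F2 : 2 <= 2 `^ (1 + al) :> R.
    by rewrite -[leLHS]powRr1//; apply: ler_powR; lra.
  move: F2; move: (2 `^ (1 + al)) => F F2.
  have -> : 2 * (F * F / (al * (1 - al) * (2 - al))) = 2 * F * F / (al * (2 - al)) / (1 - al).
    by field; rewrite !gt_eqF.
  rewrite ler_pM2r ?invr_gt0// ler_pdivlMr ?mulr_gt0//.
  have F0 : 0 < F by lra.
  have a1 : al * (2 - al) <= 1 by have := sqr_ge0 (1 - al); lra.
  apply: (@le_trans _ _ (4 * F)); first by rewrite ler_piMr ?a1 ?mulr_ge0 ?(ltW F0).
  by have := ler_wpM2r (ltW F0) F2; lra.
rewrite /C2.
have -> : 83 / 4 * 4 `^ al / (2 - al) ^+ 2 = 83 / 4 * (4 `^ al * ((2 - al) ^+ 2)^-1) by ring.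
have : 0 <= 4 `^ al * ((2 - al) ^+ 2)^-1 by rewrite mulr_ge0 ?(ltW q0) ?(ltW i2).
lra.
Qed.

Lemma C1_gt0 al : 0 < al < 1 -> 0 < C1 al.
Proof.
move=> al01; have := tail_const_le_C1 al01; have /andP[al0 al1] := al01.
have : 0 < 4 * 2 `^ (1 + al) / (1 - al).
  by rewrite divr_gt0 ?mulr_gt0 ?powR_gt0// subr_gt0.
have : 0 <= 83 / 4 * 4 `^ al / (2 - al) ^+ 2.
  by rewrite divr_ge0 ?sqr_ge0// mulr_ge0 ?powR_ge0.
lra.
Qed.

Lemma C2_gt0 al : 0 < al < 1 -> 0 < C2 al.
Proof.
move=> al01; have := tail_const_le_C2 al01; have /andP[al0 al1] := al01.
have : 0 < 4 * 2 `^ (1 + al) / (1 - al).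
  by rewrite divr_gt0 ?mulr_gt0 ?powR_gt0// subr_gt0.
have : 0 <= 83 / 4 * 4 `^ al / (2 - al) ^+ 2.
  by rewrite divr_ge0 ?sqr_ge0// mulr_ge0 ?powR_ge0.
lra.
Qed.

End constants.

(** * Means of the small jumps *)

Section mean_integrals.
Context {R : realType}.
Variables (nu : {measure set (measurableTypeR R) -> \bar R}) (f : R -> R).
Hypothesis nu_f : has_density nu f.
Implicit Types (eta eps a b : R) (A : set (measurableTypeR R)).

Definition annulus eta eps : set (measurableTypeR R) :=
  [set x : measurableTypeR R | (eta < `|x| <= eps)%R].

Lemma measurable_annulus eta eps : measurable (annulus eta eps).
Proof.
have mn : measurable_fun setT (fun x : measurableTypeR R => `|x| : measurableTypeR R).
  exact: normr_measurable.
have := mn measurableT `]eta, eps]%classic (measurable_itv _).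
rewrite setTI; congr measurable; apply/seteqP; split => x /=; by rewrite in_itv.
Qed.

Lemma measurable_ball0 eps :
  measurable [set x : measurableTypeR R | (`|x| <= eps)%R].
Proof.
have mn : measurable_fun setT (fun x : measurableTypeR R => `|x| : measurableTypeR R).
  exact: normr_measurable.
have := mn measurableT `]-oo, eps]%classic (measurable_itv _).
rewrite setTI; congr measurable; apply/seteqP; split => x /=; by rewrite in_itv.
Qed.

Lemma measurable_id_EFin A : measurable_fun A (fun x : measurableTypeR R => (x : R)%:E).
Proof. by apply/measurable_EFinP; apply: measurable_funTS; exact: measurable_id. Qed.

Lemma symmetric_mean0 eta eps : symmetric_fun f ->
  (\int[nu]_(x in annulus eta eps) (x : R))%R = 0.
Proof.
move=> fsym; set A := annulus eta eps; have mA : measurable A := measurable_annulus _ _.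
pose opp := (-%R : measurableTypeR R -> measurableTypeR R).
have mopp : measurable_fun setT opp by exact: oppr_measurable.
pose g (x : measurableTypeR R) := (x : R)%:E.
have E : (\int[nu]_(x in A) g^\- x = \int[nu]_(x in A) g^\+ x)%E.
  transitivity (\int[pushforward nu opp]_(x in A) g^\- x)%E.
    by apply: eq_measure_integral => B mB _; rewrite -(density_symmetric nu_f fsym).
  rewrite ge0_integral_pushforward//; last first.
    by apply: measurable_funeneg; exact: measurable_id_EFin.
  have -> : opp @^-1` A = A.
    by apply/seteqP; split => x; rewrite /A /annulus /opp /= normrN.
  by apply: eq_integral => x _; rewrite /g /opp /= funenegE funeposE /= opprK.
rewrite /Rintegral integralE E.
(* If the common value is infinite, [fine] sends the difference to 0 as well. *)
by case: (\int[nu]_(x in A) g^\+ x)%E => [r| |] //=; rewrite subrr.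
Qed.

Variables (M al : R).
Hypotheses (M0 : 0 < M) (al01 : 0 < al < 1) (fM : L_class M al f).

Let two_sided a b : set (measurableTypeR R) :=
  `[a, b]%classic `|` `[(- b)%R, (- a)%R]%classic.

(** The annulus is cut into shells of width h. On the one that starts at (i + 1) h the size is at
    most twice that, and there are two signs: hence the factor 4. *)
Let annulus_norm_bound eps n : 0 < eps <= 1 ->
  (\int[nu]_(x in annulus (eps / n.+1%:R) eps) (`|x|%:E) <=
   (4 * M * (eps `^ (1 - al) / (1 - al)))%:E)%E.
Proof.
move=> /andP[e0 e1]; have /andP[al0 al1] := al01.
set h := eps / n.+1%:R; have h0 : 0 < h by rewrite divr_gt0.
have epsE : n.+1%:R * h = eps by rewrite /h mulrC divfK.
pose A (i : nat) := two_sided (i.+1%:R * h) (i.+2%:R * h).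
have mA i : measurable (A i) by apply: measurableU.
have step (i : nat) : i.+1%:R * h = i%:R * h + h by rewrite -natr1; ring.
apply: (@le_trans _ _ (\int[nu]_x \sum_(i < n) (2 * (i.+1%:R * h))%:E * (\1_(A i) x)%:E)%E).
  rewrite integral_mkcond; apply: integral_le_nonmeasurable => x.
    by rewrite patchE; case: ifP.
  rewrite patchE; case: ifPn => [|_]; last first.
    by apply: sume_ge0 => i _; rewrite -EFinM lee_fin !mulr_ge0// ltW.
  rewrite inE => /= /andP[x1 x2].
  have [|j jn] := @mesh_index R n.+1 h 0 `|x : R| h0.
    by rewrite add0r epsE x2 (lt_trans h0).
  rewrite !add0r => /andP[j1 j2].
  have j0 : (0 < j)%N.
    by case: j j2 {jn j1} => //; rewrite mul1r => /(lt_le_trans x1); rewrite ltxx.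
  case: j j0 jn j1 j2 => // j _ jn j1 j2.
  rewrite (bigD1 (Ordinal (jn : (j < n)%N) : 'I_n))//= -[leLHS]adde0; apply: leeD; last first.
    by apply: sume_ge0 => i _; rewrite -EFinM lee_fin !mulr_ge0// ltW.
  rewrite indicE mem_set; last first.
    rewrite /A /two_sided /= !in_itv /=.
    have [x0|x0] := leP 0 (x : R); [left|right]; move: j1 j2.
      by rewrite ger0_norm// => /ltW -> ->.
    by rewrite ltr0_norm// => /ltW; rewrite lerNr lerNl => -> ->.
  rewrite mule1 lee_fin (le_trans j2)// step.
  have : h <= j.+1%:R * h by rewrite ler_peMl ?(ltW h0)// ler1n.
  lra.
rewrite ge0_integral_sum//; last 2 first.
- move=> i; apply: emeasurable_funM; first exact: measurable_cst.
  by apply/measurable_EFinP; exact: measurable_indic.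
- by move=> i x _; rewrite -EFinM lee_fin !mulr_ge0// ltW.
apply: (@le_trans _ _ (\sum_(i < n) (4 * M * (h * (i.+1%:R * h) `^ (- al)))%:E)%E).
  apply: lee_sum => i _; rewrite ge0_integralZl//; last 2 first.
  - by apply/measurable_EFinP; exact: measurable_indic.
  - by rewrite lee_fin !mulr_ge0// ltW.
  rewrite integral_indic// setIT.
  have ih0 : 0 < i.+1%:R * h by rewrite mulr_gt0.
  have ab : 0 < i.+1%:R * h <= i.+2%:R * h by rewrite ih0/= ler_pM2r// ler_nat leqnSn.
  have b2 : i.+2%:R * h <= 2.
    apply: (@le_trans _ _ (n.+1%:R * h)); first by rewrite ler_pM2r// ler_nat ltnS ltn_ord.
    by rewrite epsE; lra.
  apply: (@le_trans _ _ ((2 * (i.+1%:R * h))%:E *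
      (2 * ((i.+2%:R * h - i.+1%:R * h) * (M * (i.+1%:R * h) `^ (- (1 + al)))))%:E)%E).
    apply: lee_wpmul2l; first by rewrite lee_fin !mulr_ge0// ltW.
    apply: (le_trans (measureU2 _ _ _)) => //.
    set z := (_ - _) * _; have -> : 2 * z = z + z by ring.
    rewrite EFinD; apply: leeD.
      exact: (density_itvcc nu_f M0 al0 fM).
    exact: (density_itvccN nu_f M0 al0 fM).
  rewrite -EFinM lee_fin (step i.+1).
  have -> : - (1 + al) = - al - 1 by ring.
  rewrite powR_pred//; move: ih0; move: (i.+1%:R * h) => z z0.
  rewrite le_eqVlt; apply/orP; left; apply/eqP; field; exact: lt0r_neq0.
rewrite sumEFin lee_fin -mulr_sumr ler_pM2l ?mulr_gt0//.
have := sum_powR_concave n al01 h0.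
rewrite (big_addn 0 n.+1 1) subn1 /= big_mkord => hs.
rewrite (eq_bigr (fun i : 'I_n => h * ((i + 1)%N%:R * h) `^ (- al))); last by move=> i _;
  rewrite addn1.
apply: (le_trans hs); rewrite ler_pM2r ?invr_gt0 ?subr_gt0//.
rewrite ge0_ler_powR ?nnegrE ?subr_ge0 ?(ltW al1) ?(ltW e0)//.
  by rewrite mulr_ge0// ltW.
by rewrite -epsE ler_pM2r// ler_nat.
Qed.

(** The bound on the annuli does not depend on the inner radius, and Fatou's lemma carries it over
    to the ball. *)
Lemma small_jump_integrable eps : 0 < eps <= 1 ->
  nu.-integrable [set x : measurableTypeR R | (`|x| <= eps)%R] (fun x => (x : R)%:E).
Proof.
move=> eps01; have /andP[e0 e1] := eps01.
set D := [set x | _]; have mD : measurable D := measurable_ball0 _.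
apply/integrableP; split; first exact: measurable_id_EFin.
pose nrm (x : measurableTypeR R) : \bar R := (`|x : R| : R)%:E.
pose g n : measurableTypeR R -> \bar R := nrm \_ (annulus (eps / n.+1%:R) eps).
have mabs : measurable_fun setT nrm.
  by apply/measurable_EFinP; exact: normr_measurable.
have mg n : measurable_fun setT (g n).
  exact: (proj1 (measurable_restrictT nrm (measurable_annulus _ _))
    (measurable_funS measurableT (@subsetT _ _) mabs)).
have g0 k y : (0 <= g k y)%E by rewrite /g patchE; case: ifP; rewrite /nrm ?lee_fin.
have gpos k x : [set: measurableTypeR R] x -> (0 <= g k x)%E by [].
have h := fatou nu measurableT mg gpos.
apply: (@le_lt_trans _ _ (\int[nu]_x limn_einf (g ^~ x))%E).
  rewrite integral_mkcond; apply: integral_le_nonmeasurable => x.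
    by rewrite patchE; case: ifP.
  rewrite patchE; case: ifPn => [|_]; last first.
    rewrite limn_einf_lim; apply: lime_ge; first exact: is_cvg_einfs.
    by apply: nearW => n; apply: le_ereal_inf_tmp => _ [k _ <-].
  (* The origin belongs to no annulus, but the integrand is 0 there. *)
  rewrite inE /D /= => xe; have [x0|x0] := eqVneq (x : R) 0.
    rewrite x0 normr0 limn_einf_lim; apply: lime_ge; first exact: is_cvg_einfs.
    by apply: nearW => n; apply: le_ereal_inf_tmp => _ [k _ <-].
  have xg0 : 0 < `|x : R| by rewrite normr_gt0.
  have [N _ hN] := near_div eps xg0.
  rewrite limn_einf_lim; apply: lime_ge; first exact: is_cvg_einfs.
  exists N => // n /= Nn; apply: le_ereal_inf_tmp => _ [k /= nk <-].
  rewrite /g patchE mem_set ?abse_EFin//= /annulus /= xe andbT.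
  by apply: hN => /=; rewrite (leq_trans Nn)// (leq_trans nk).
apply: (le_lt_trans h); apply: (@le_lt_trans _ _ (4 * M * (eps `^ (1 - al) / (1 -
  al)))%:E); last exact: ltry.
rewrite limn_einf_lim; apply: lime_le; first exact: is_cvg_einfs.
apply: nearW => n; apply: (@le_trans _ _ (\int[nu]_x g n x)%E).
  by apply: ereal_inf_lbound; exists n => /=.
by rewrite /g -integral_mkcond; exact: annulus_norm_bound.
Qed.

(** Dominated convergence, so that t b(eps) restores in the limit the compensators taken over the
    annuli. *)
Lemma small_jump_mean_cvg eps : 0 < eps <= 1 ->
  (\int[nu]_(x in annulus (eps / j.+2%:R) eps) (x : R))%R @[j --> \oo] -->
  small_jump_mean nu eps.
Proof.
move=> eps01; have /andP[e0 e1] := eps01.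
have iD := small_jump_integrable eps01.
rewrite /small_jump_mean; set D := [set x : measurableTypeR R | _] in iD *.
have mD : measurable D := measurable_ball0 _.
pose id_ (x : measurableTypeR R) := (x : R)%:E.
pose g j := id_ \_ (annulus (eps / j.+2%:R) eps).
have mg j : measurable_fun D (g j).
  have mid : measurable_fun (annulus (eps / j.+2%:R) eps) id_ by exact: measurable_id_EFin.
  have mgT := proj1 (measurable_restrictT id_ (measurable_annulus (eps / j.+2%:R) eps)) mid.
  exact: (measurable_funS measurableT (@subsetT _ _) mgT).
have gcv : {ae nu, forall x, D x -> g ^~ x @ \oo --> id_ x}.
  apply: aeW => x Dx; apply: cvg_near_cst; have [x0|x0] := eqVneq (x : R) 0.
    by apply: nearW => j; rewrite /g patchE /id_ x0; case: ifP.
  have xg0 : 0 < `|x : R| by rewrite normr_gt0.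
  have [N _ hN] := near_div eps xg0.
  exists N => // j /= Nj; rewrite /g patchE mem_set// /annulus /=.
  rewrite (_ : `|x| <= eps)// andbT.
  by apply: hN => /=; rewrite (leq_trans Nj)// (leq_trans (leqnSn j)).
have gle : {ae nu, forall x j, D x -> (`|g j x| <= (abse \o id_) x)%E}.
  by apply: aeW => x j Dx; rewrite /g patchE /=; case: ifP => //; rewrite abse0.
have mid : measurable_fun D id_ by exact: measurable_id_EFin.
have [_ _ cv] := dominated_convergence mD mg mid gcv (integrable_abse iD) gle.
have gE j : (\int[nu]_(x in D) g j x = \int[nu]_(x in annulus (eps / j.+2%:R) eps) id_ x)%E.
  rewrite /g -integral_mkcondr; congr (integral nu _ _); apply/seteqP; split => x;
    first by case.
  by move=> /[dup] /andP[_ xe] xa; split.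
have fin : (\int[nu]_(x in D) id_ x)%E \is a fin_num by exact: integrable_fin_num.
rewrite /Rintegral -(fineK fin) in cv *.
have -> : (fun j => fine (\int[nu]_(x in annulus (eps / j.+2%:R) eps) (x : R)%:E)) =
    fine \o (fun j => \int[nu]_(x in D) g j x)%E.
  by apply/funext => j /=; rewrite gE.
exact: fine_cvg cv.
Qed.

End mean_integrals.

(** * The two tail estimates *)

Section final_steps.
Context {R : realType}.
Implicit Types (t M al eps : R).

(** This is how the range of t in the first claim enters: it gives the bound eps / (4 * 2^al), and
    2^al >= 1. *)
Lemma small_mean_of_time t M al eps : 0 < al < 1 -> 0 < eps -> 0 < M ->
  t <= (1 - al) * eps `^ al / (M * 4 `^ (1 + al)) ->
  2 * (t * M) * ((eps / 2) `^ (1 - al) / (1 - al)) <= eps / 4.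
Proof.
move=> /andP[al0 al1] e0 M0; have r1 : 0 < 1 - al by rewrite subr_gt0.
have Q0 : 0 < 4 `^ (1 + al) :> R by rewrite powR_gt0.
move=> h; rewrite ler_pdivlMr ?mulr_gt0// mulrA in h.
have pe0 : eps != 0 by rewrite gt_eqF.
have n20 : (2 : R) != 0 by [].
have e1 : (eps / 2) `^ (1 - al) = eps / eps `^ al / (2 / 2 `^ al).
  rewrite powR_div ?(ltW e0)//; congr (_ / _).
    by rewrite powRB ?pe0 ?implybT// powRr1// ltW.
  by rewrite powRB ?n20 ?implybT// powRr1.
have t4 : 4 `^ (1 + al) = 4 * (2 `^ al) ^+ 2 :> R.
  have n40 : (4 : R) != 0 by [].
  rewrite powRD ?n40 ?implybT// powRr1//; congr (_ * _).
  have -> : 4 = 2 * 2 :> R by ring.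
  by rewrite powRM// expr2.
have F1 : 1 <= 2 `^ al :> R by rewrite -[leLHS](powRr0 2); apply: ler_powR; lra.
move: h Q0; rewrite e1 t4; have := powR_gt0 al e0.
move: (eps `^ al) => E E0; move: (2 `^ al) F1 => F F1 h Q0.
have F0 : 0 < F by exact: lt_le_trans F1.
have -> : 2 * (t * M) * (eps / E / (2 / F) / (1 - al)) =
   (t * M * (4 * F ^+ 2)) * (eps / (4 * F * E * (1 - al))).
  by field; rewrite !gt_eqF.
apply: (@le_trans _ _ ((1 - al) * E * (eps / (4 * F * E * (1 - al))))).
  by apply: ler_wpM2r => //; rewrite divr_ge0 ?mulr_ge0 ?(ltW e0) ?(ltW E0) ?(ltW F0) ?(ltW r1).
have -> : (1 - al) * E * (eps / (4 * F * E * (1 - al))) = eps / 4 / F.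
  by field; rewrite !gt_eqF.
by rewrite ler_pdivrMr// ler_peMr// divr_ge0// ltW.
Qed.

Lemma measurable_norm_ge {d : measure_display} {T : measurableType d} (g : T -> R) eps :
  measurable_fun setT g -> measurable [set w | eps <= `|g w|].
Proof.
move=> mg; have mn : measurable_fun setT (fun w => `|g w|) by exact: measurableT_comp.
have := mn measurableT `[eps, +oo[%classic (measurable_itv _).
by rewrite setTI; congr measurable; apply/seteqP; split => w /=; rewrite in_itv /= andbT.
Qed.

Lemma harmonic_at_right eps : 0 < eps -> (eps / j.+2%:R) @[j --> \oo] --> 0^'+.
Proof.
move=> e0 A /nbhs_ballP[r /= r0 hA]; have [N _ hN] := near_div eps r0.
exists N => // j /= Nj; have j0 : 0 < eps / j.+2%:R by rewrite divr_gt0.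
apply: hA => //; rewrite /ball /= sub0r normrN gtr0_norm//.
by apply: hN; rewrite /= (leq_trans Nj)// (leq_trans (leqnSn j)).
Qed.

End final_steps.

Theorem theorem1 (R : realType) (alpha : R) (halpha : 0 < alpha < 1) :
  [/\ 0 < C1 alpha, 0 < C2 alpha &
  forall (d : measure_display) (T : measurableType d) (P : probability T R)
    (X : R -> {RV P >-> R})
    (nu : {measure set (measurableTypeR R) -> \bar R})
    (f : R -> R) (eps M : R) (Mt : R -> {RV P >-> R}),
  levy_process X -> levy_measure nu -> has_levy_measure X nu ->
  has_density nu f -> 0 < eps <= 1 -> 0 < M -> L_class M alpha f ->
  compensated_small_jumps X nu eps Mt ->
  (forall t, 0 < t <= (1 - alpha) * eps `^ alpha / (M * 4 `^ (1 + alpha)) ->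
    (P [set w | (eps <= `|t * small_jump_mean nu eps + Mt t w|)%R] <=
     (2 * t ^+ 2 * M ^+ 2 * C1 alpha * eps `^ (- (2 * alpha)))%:E)%E) /\
  (symmetric_fun f ->
   forall t, 0 < t <= eps `^ alpha * (2 - alpha) / (M * 2 `^ (alpha + 1)) ->
    (P [set w | (eps <= `|Mt t w|)%R] <=
     (2 * t ^+ 2 * M ^+ 2 * C2 alpha * eps `^ (- (2 * alpha)))%:E)%E)].
Proof.
split; [exact: C1_gt0|exact: C2_gt0|].
move=> d T P X nu f eps M Mt X_levy _ X_nu nu_f eps01 M0 fM X_Mt.
have /andP[eps0 eps1] := eps01.
(* Both claims compare the same constant, once with 2 C1 and once with 2 C2. *)
have powC (C t : R) : 83 / 4 * 4 `^ alpha / (2 - alpha) ^+ 2 +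
    4 * 2 `^ (1 + alpha) / (1 - alpha) <= 2 * C ->
    tail_const t M alpha eps 0 <= 2 * t ^+ 2 * M ^+ 2 * C * eps `^ (- (2 * alpha)).
  move=> hC; rewrite tail_const0E//.
  have -> : 2 * t ^+ 2 * M ^+ 2 * C * eps `^ (- (2 * alpha)) =
    2 * C * (t ^+ 2 * M ^+ 2 * eps `^ (- (2 * alpha))) by ring.
  by apply: ler_wpM2r => //; rewrite mulr_ge0 ?powR_ge0// mulr_ge0// sqr_ge0.
have mMt t : measurable_fun setT (Mt t) by exact: measurable_funP.
have jumps_cvg (t : R) : 0 < t -> {ae P, forall w,
    compensated_jump_sum nu (X ^~ w) eps (eps / j.+2%:R) t @[j --> \oo] --> Mt t w}.
  move=> t0; apply: filterS (X_Mt t (ltW t0)) => w cw.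
  exact: cvg_comp (harmonic_at_right eps0) cw.
split.
  move=> t /andP[t0 /(small_mean_of_time halpha eps0 M0) hmean].
  have mY : measurable [set w | eps <= `|t * small_jump_mean nu eps + Mt t w|].
    by apply: measurable_norm_ge; apply: measurable_funD => //; exact: measurable_cst.
  apply: (le_trans (small_jumps_tail X_levy X_nu nu_f M0 halpha fM eps01 t0 (or_introl
    hmean) mY _)).
    apply: filterS (jumps_cvg t t0) => w cw.
    have cb := small_jump_mean_cvg nu_f M0 halpha fM eps01.
    (* Adding t times the mean over the annulus undoes the compensation, and this mean tends to
       b(eps). *)
    have -> : (fun j : nat => truncated_jump_sum (X ^~ w) eps t (eps / j.+2%:R)) =
        (fun j => t * (\int[nu]_(x in annulus (eps / j.+2%:R) eps) (x : R))%R
          + compensated_jump_sum nu (X ^~ w) eps (eps / j.+2%:R) t).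
      apply/funext => j.
      by rewrite /compensated_jump_sum /truncated_jump_sum /annulus addrC subrK.
    by apply: cvgD cw; apply: cvgMr cb; exact: cvg_cst.
  by rewrite lee_fin powC// tail_const_le_C1.
move=> fsym t /andP[t0 _].
have mY : measurable [set w | eps <= `|Mt t w|] by exact: measurable_norm_ge.
apply: (le_trans (small_jumps_tail X_levy X_nu nu_f M0 halpha fM eps01 t0 (or_intror fsym)
  mY _)).
  apply: filterS (jumps_cvg t t0) => w cw.
  (* Under symmetry the mean over each annulus is 0, and the compensated sum is the plain one. *)
  have -> : (fun j : nat => truncated_jump_sum (X ^~ w) eps t (eps / j.+2%:R)) =
      (fun j => compensated_jump_sum nu (X ^~ w) eps (eps / j.+2%:R) t).
    apply/funext => j.
    by rewrite /compensated_jump_sum (symmetric_mean0 nu_f _ _ fsym) mulr0 subr0.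
  exact: cw.
by rewrite lee_fin powC// tail_const_le_C2.
Qed.
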